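(* Let $\Omega\subseteq\mathbb{R}^N$, $N\ge2$, be a domain and let $1<p<\infty$. Let $u,v\in C^1(\Omega)$ with $u\le v$ in $\Omega$ and assume that, for some $\Lambda\in\mathbb{R}$, $-\Delta_p u+\Lambda u\le-\Delta_p v+\Lambda v$ in $\Omega$ in the weak distributional sense. Let $\Omega'\Subset\Omega$ and suppose that the weight $\rho:=(|Du|+|Dv|)^{p-2}$ satisfies condition $(\mathcal M_\kappa)$ in $\Omega'$ for some $\kappa>0$; let $\mu$ be the measure $\rho\,\chi_{\Omega'}dx$. Then there exists $\chi>1$ such that, whenever $\delta>0$, $\overline{B_{6\delta}(x)}\subset\Omega'$ and $0<s<\chi$, there is a constant $C>0$ with $$\Big(\int_{B_{2\delta}(x)}(v-u)^s\,d\mu\Big)^{1/s}\le C\,\inf_{B_\delta(x)}(v-u).$$ Consequently the strong comparison principle holds in $\Omega'$: in every connected subdomain $\Omega_0\subseteq\Omega'$, either $u\equiv v$ or $u<v$.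
   Context: $\Delta_p u=\operatorname{div}(|Du|^{p-2}Du)$. The inequality in the weak distributional sense means $\int_\Omega (|Du|^{p-2}Du-|Dv|^{p-2}Dv,D\phi)\,dx\le\Lambda\int_\Omega (v-u)\phi\,dx$ for every nonnegative $\phi\in C_c^\infty(\Omega)$. $\Omega'\Subset\Omega$ means that $\Omega'$ is a subdomain whose closure is compact and contained in $\Omega$; $B_r(x)$ is the open ball. Condition $(\mathcal M_\kappa)$: for a bounded domain $\Omega'\subset\mathbb{R}^N$ and $\kappa>0$, a measurable weight $\rho:\Omega'\to(0,\infty]$ satisfies $(\mathcal M_\kappa)$ in $\Omega'$ if there are constants $\lambda_0,\Lambda_0>0$ such that $\rho\ge\lambda_0$ a.e. in $\Omega'$ and $\mu(B_r(x))\le\Lambda_0\,r^{N-2+\kappa}$ for all $x\in\mathbb{R}^N$ and all $r>0$, where $\mu=\rho\,\chi_{\Omega'}dx$. *)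

(* Defs.v *)
From HB Require Import structures.
From mathcomp Require Import all_boot all_order all_algebra.
From mathcomp Require Import all_classical all_reals all_analysis.
From mathcomp Require Import measurable_realfun.

Set Implicit Arguments.
Unset Strict Implicit.
Unset Printing Implicit Defensive.

Import Order.TTheory GRing.Theory Num.Theory.
Import numFieldNormedType.Exports.

Local Open Scope classical_set_scope.
Local Open Scope ring_scope.

Definition rV_display : measure_display. Proof. exact: default_measure_display. Qed.

Section rV_measurable.
Variables (R : realType) (n : nat).

Definition rV_coord (i : 'I_n) (x : 'rV[R]_n) : measurableTypeR R := x ord0 i.

Let rV0 : g_sigma_preimage rV_coord set0.
Proof. exact: sigma_algebra0. Qed.

Let rVC A : g_sigma_preimage rV_coord A -> g_sigma_preimage rV_coord (~` A).
Proof. exact: sigma_algebraC. Qed.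

Let rV_bigcup (F : (set 'rV[R]_n)^nat) :
  (forall i, g_sigma_preimage rV_coord (F i)) ->
  g_sigma_preimage rV_coord (\bigcup_i F i).
Proof. exact: sigma_algebra_bigcup. Qed.

HB.instance Definition _ := @isMeasurable.Build rV_display 'rV[R]_n
  (g_sigma_preimage rV_coord) rV0 rVC rV_bigcup.

End rV_measurable.

Lemma measurable_rV_coord (R : realType) n (i : 'I_n) :
  measurable_fun [set: 'rV[R]_n] (rV_coord i).
Proof.
move=> _ Y mY; rewrite setTI; apply: sub_sigma_algebra => /=.
rewrite -bigcup_seq/=; exists i => /=; first by rewrite mem_index_enum.
by exists Y => //; rewrite setTI.
Qed.

Lemma measurable_to_rVP (R : realType) d (T : measurableType d) n
    (f : T -> 'rV[R]_n) :
  measurable_fun [set: T] f <->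
  forall i, measurable_fun [set: T] (rV_coord i \o f).
Proof.
split=> [mf i|mf].
  by apply: measurableT_comp => //; exact: measurable_rV_coord.
move=> _ A mA; rewrite setTI.
have : g_sigma_preimage (fun i => rV_coord i \o f) (f @^-1` A).
  by rewrite g_sigma_preimage_comp; exists A => //; rewrite setTI.
apply: smallest_sub; first exact: sigma_algebra_measurable.
case: n => [|n] in f A mA mf *; first by rewrite big_ord0.
rewrite -bigcup_mkord_ord; apply: bigcup_sub => i Ii.
by move=> B [C mC <-]; exact: mf.
Qed.

Lemma open_rV_measurable (R : realType) n (U : set 'rV[R]_n) :
  open U -> measurable U.
Proof.
move=> oU.
pose B (q : 'rV[rat]_n) (k : nat) : set 'rV[R]_n :=
  \bigcap_(i in [set: 'I_n])
    (rV_coord i @^-1` ball (ratr (q ord0 i) : R) k.+1%:R^-1).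
pose F (z : 'rV[rat]_n * nat) : set 'rV[R]_n :=
  if `[< B z.1 z.2 `<=` U >] then B z.1 z.2 else set0.
have -> : U = \bigcup_z F z.
  apply/seteqP; split => [x Ux|x [z _]]; last first.
    by rewrite /F; case: asboolP => // BU /BU.
  have /nbhs_ballP[e /= e0 xeU] : nbhs x U by exact: open_nbhs_nbhs.
  have [k ke] : exists k : nat, k.+1%:R^-1 < e / 2.
    have e20 : 0 < e / 2 by rewrite divr_gt0.
    by have [k _ /(_ k (leqnn k))] := near_infty_natSinv_lt (PosNum e20); exists k.
  have k0 : 0 < k.+1%:R^-1 :> R by rewrite invr_gt0.
  have qex (i : 'I_n) : exists q : rat, ball (x ord0 i) k.+1%:R^-1 (ratr q : R).
    have [y [xy [q _ qy]]] := @dense_rat R (ball (x ord0 i) k.+1%:R^-1)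
      (ex_intro _ (x ord0 i) (ballxx _ k0)) ltac:(exact: ball_open).
    by exists q; rewrite qy.
  pose q := \row_i sval (cid (qex i)).
  have qE i : ball (x ord0 i) k.+1%:R^-1 (ratr (q ord0 i) : R).
    by rewrite mxE; case: cid.
  have BU : B q k `<=` U.
    move=> y Bqy; apply: xeU; split => // i j; rewrite ord1.
    rewrite (splitr e); apply: ball_triangle.
      by apply: le_ball (qE j); exact: ltW.
    by apply: le_ball (Bqy j Logic.I); exact: ltW.
  exists (q, k) => //; rewrite /F; case: asboolP => // _ i _ /=.
  exact/ball_sym/qE.
apply: countable_bigcupT_measurable; first exact: countableP.
move=> z; rewrite /F; case: asboolP => _ //.
apply: fin_bigcap_measurable => [|i _]; first exact: finite_finset.
rewrite -[X in measurable X]setTI; apply: measurable_rV_coord => //.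
by apply: open_measurable; apply: ball_open; rewrite invr_gt0.
Qed.

Lemma rV_measurableE (R : realType) n :
  @measurable _ 'rV[R]_n = <<s [set U : set 'rV[R]_n | open U] >>.
Proof.
apply/seteqP; split; last first.
  apply: smallest_sub; first exact: sigma_algebra_measurable.
  by move=> U; exact: open_rV_measurable.
apply: smallest_sub; first exact: smallest_sigma_algebra.
case: n => [|n]; first by rewrite big_ord0.
rewrite -bigcup_mkord_ord; apply: bigcup_sub => i Ii.
move=> _ [C + <-]; rewrite setTI.
change ((@ocitv R).-sigma.-measurable C -> <<s [set U : set 'rV[R]_n.+1 | open U] >>
  (rV_coord (inord i) @^-1` C)).
rewrite RGenOpens.measurableE.
set D := [set C : set R | <<s [set U : set 'rV[R]_n.+1 | open U] >>
  (rV_coord (inord i) @^-1` C)].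
suff : <<s @RGenOpens.G R >> `<=` D by apply.
apply: smallest_sub.
  split=> [|V DV|V DV].
  - by rewrite /D /= preimage_set0; exact: sigma_algebra0.
  - by rewrite /D /= setTD preimage_setC; exact: sigma_algebraC.
  - by rewrite /D /= preimage_bigcup; exact: sigma_algebra_bigcup.
move=> _ [a [b ->]]; apply: sub_sigma_algebra => /=.
apply: open_comp => [x _|]; last exact: interval_open.
exact: coord_continuous.
Qed.

Section lebesgueN.
Context {R : realType}.

Definition rV_cons n (z : measurableTypeR R * 'rV[R]_n) : 'rV[R]_n.+1 :=
  \row_i (if unlift ord0 i is Some j then z.2 ord0 j else z.1).

Lemma rV_cons0 n z : @rV_cons n z ord0 ord0 = z.1.
Proof. by rewrite mxE unlift_none. Qed.

Lemma rV_consS n z i : @rV_cons n z ord0 (lift ord0 i) = z.2 ord0 i.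
Proof. by rewrite mxE liftK. Qed.

Lemma measurable_rV_cons n : measurable_fun setT (@rV_cons n).
Proof.
apply/measurable_to_rVP => i.
case: (unliftP ord0 i) => [j|] ->.
  rewrite (_ : _ \o _ = rV_coord j \o snd).
    by apply: measurableT_comp => //; exact: measurable_rV_coord.
  by apply/funext => z /=; rewrite /rV_coord rV_consS.
rewrite (_ : _ \o _ = fst) //.
by apply/funext => z /=; rewrite /rV_coord rV_cons0.
Qed.

HB.instance Definition _ n :=
  @isMeasurableFun.Build _ _ _ _ (@rV_cons n) (@measurable_rV_cons n).

Fixpoint lebesgueN n : set 'rV[R]_n -> \bar R :=
  match n with
  | 0 => @dirac _ 'rV[R]_0 0 R
  | n'.+1 => pushforward (@lebesgue_measure R \x @lebesgueN n')%E (@rV_cons n')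
  end.

Let rV_split n (x : 'rV[R]_n.+1) : measurableTypeR R * 'rV[R]_n :=
  (x ord0 ord0, \row_i x ord0 (lift ord0 i)).

Let measurable_rV_split n : measurable_fun setT (@rV_split n).
Proof.
apply/measurable_fun_pairP; split.
  exact: (@measurable_rV_coord R n.+1 ord0).
apply/measurable_to_rVP => i.
rewrite (_ : _ \o _ = rV_coord (lift ord0 i)); first exact: measurable_rV_coord.
by apply/funext => x /=; rewrite /rV_coord mxE.
Qed.

Let rV_consK n : cancel (@rV_cons n) (@rV_split n).
Proof.
case=> a b; rewrite /rV_split rV_cons0; congr pair.
by apply/rowP => i; rewrite mxE rV_consS.
Qed.

Section lebesgueN_step.
Variables (n : nat) (m : {sigma_finite_measure set 'rV[R]_n -> \bar R}).

Let L : {sigma_finite_measure set (measurableTypeR R) -> \bar R} :=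
  @lebesgue_measure R.

Let P : {measure set (measurableTypeR R * 'rV[R]_n)%type -> \bar R} :=
  (L \x m)%E.

Let step : set 'rV[R]_n.+1 -> \bar R :=
  pushforward (@lebesgue_measure R \x m)%E (@rV_cons n).

HB.instance Definition _ := Measure.copy step
  (measure_function_pushforward__canonical__measure_function_Measure P
    (@measurable_rV_cons n)).

Let step_sigma_finite : sigma_finite setT step.
Proof.
have /sigma_finiteP[F [TF ndF Foo]] := sigma_finiteT L.
have /sigma_finiteP[G [TG ndG Goo]] := sigma_finiteT m.
exists (fun k => @rV_split n @^-1` (F k `*` G k)).
  rewrite -preimage_bigcup -(@preimage_setT _ _ (@rV_split n)).
  congr (_ @^-1` _); rewrite -setXTT TF TG predeqE => -[x y]; split.
    move=> [/= [a _ Fax] [b _ Gby]]; exists (maxn a b) => //; split.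
      by move/subsetPset : (ndF _ _ (leq_maxl a b)); exact.
    by move/subsetPset : (ndG _ _ (leq_maxr a b)); exact.
  by move=> [k _ [? ?]]; split; exists k.
move=> k; have [mF Fy] := Foo k; have [mG Gy] := Goo k; split.
  rewrite -[X in measurable X]setTI; apply: measurable_rV_split => //.
  exact: measurableX.
rewrite /step /pushforward -comp_preimage (_ : _ \o _ = idfun); last first.
  by apply/funext; exact: rV_consK.
by rewrite product_measure1E// lte_mul_pinfty// ge0_fin_numE.
Qed.

HB.instance Definition _ :=
  @Measure_isSigmaFinite.Build _ _ _ step step_sigma_finite.

Lemma lebesgueN_step : exists m' : {sigma_finite_measure set 'rV[R]_n.+1 -> \bar R},
  pushforward (@lebesgue_measure R \x m)%E (@rV_cons n) = m' :> (_ -> _).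
Proof. by exists step. Qed.

End lebesgueN_step.

Let lebesgueN_ex n : exists m : {sigma_finite_measure set 'rV[R]_n -> \bar R},
  @lebesgueN n = m :> (_ -> _).
Proof.
elim: n => [|n [m mE]] /=; first by exists (@dirac _ 'rV[R]_0 0 R).
by rewrite mE; exact: lebesgueN_step.
Qed.

Variable n : nat.

Let lebesgueN0 : @lebesgueN n set0 = 0%E.
Proof. by have [m ->] := lebesgueN_ex n; exact: measure0. Qed.

Let lebesgueN_ge0 A : (0 <= @lebesgueN n A)%E.
Proof. by have [m ->] := lebesgueN_ex n; exact: measure_ge0. Qed.

Let lebesgueN_sigma_additive : semi_sigma_additive (@lebesgueN n).
Proof.
by have [m ->] := lebesgueN_ex n; exact: measure_semi_sigma_additive.
Qed.

Let lebesgueN_sigma_finite : sigma_finite setT (@lebesgueN n).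
Proof. by have [m ->] := lebesgueN_ex n; exact: sigma_finiteT. Qed.

HB.instance Definition _ := isMeasure.Build _ _ _ (@lebesgueN n)
  lebesgueN0 lebesgueN_ge0 lebesgueN_sigma_additive.

HB.instance Definition _ :=
  @Measure_isSigmaFinite.Build _ _ _ (@lebesgueN n) lebesgueN_sigma_finite.

End lebesgueN.

Lemma lebesgueN_box (R : realType) n (a b : 'rV[R]_n) :
  (forall i, a ord0 i <= b ord0 i) ->
  lebesgueN [set x : 'rV[R]_n | forall i, a ord0 i <= x ord0 i <= b ord0 i] =
  (\prod_i (b ord0 i - a ord0 i))%:E.
Proof.
elim: n a b => [|n IH] a b ab.
  by rewrite big_ord0 /= diracE mem_set//= => -[].
rewrite big_ord_recl /= /pushforward.
pose tl (c : 'rV[R]_n.+1) := \row_(i < n) c ord0 (lift ord0 i).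
pose I : set (measurableTypeR R) := `[a ord0 ord0, b ord0 ord0]%classic.
pose B := [set x : 'rV[R]_n | forall i, tl a ord0 i <= x ord0 i <= tl b ord0 i].
have -> : @rV_cons R n @^-1` [set x : 'rV[R]_n.+1 |
    forall i, a ord0 i <= x ord0 i <= b ord0 i] = I `*` B.
  apply/seteqP; split => [[x y] /= h|[x y] /= [h1 h2] i].
    split=> [|i] /=; first by have := h ord0; rewrite rV_cons0 /I /= in_itv.
    by have := h (lift ord0 i); rewrite rV_consS !mxE.
  case: (unliftP ord0 i) => [j|] ->.
    by rewrite rV_consS; have := h2 j; rewrite !mxE.
  by rewrite rV_cons0; move: h1; rewrite /I /= in_itv.
have mB : measurable B.
  rewrite (_ : B = \bigcap_(i in [set: 'I_n])
      (rV_coord i @^-1` `[tl a ord0 i, tl b ord0 i]%classic)); last first.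
    apply/seteqP; split=> x /= h i; first by move=> _; rewrite /= in_itv; exact: h.
    by have := h i Logic.I; rewrite /= in_itv.
  apply: fin_bigcap_measurable => [|i _]; first exact: finite_finset.
  by rewrite -[X in measurable X]setTI; apply: measurable_rV_coord.
rewrite product_measure1E//=; last exact: measurable_itv.
rewrite IH; last by move=> i; rewrite !mxE.
rewrite lebesgue_measure_itv/= lte_fin; case: ltgtP (ab ord0) => // [_ _|-> _].
  by rewrite -EFinB -EFinM; congr (_ * _)%:E; apply: eq_bigr => i _; rewrite !mxE.
by rewrite mul0e subrr mul0r.
Qed.

Section euclidean.
Variables (R : realType) (N : nat).
Implicit Types (x y : 'rV[R]_N) (A : set 'rV[R]_N) (u v : 'rV[R]_N -> R).

Definition dotv x y : R := \sum_i x ord0 i * y ord0 i.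

(* The library norm on ['rV[R]_N] is the maximum norm (with the same topology),
   so the Euclidean norm and balls are defined separately. *)
Definition enorm x : R := Num.sqrt (dotv x x).

Definition eball x (r : R) : set 'rV[R]_N := [set y | enorm (y - x) < r].

Definition domain A := [/\ A !=set0, open A & connected A].

Definition subdomain_cc A B :=
  [/\ domain A, compact (closure A) & closure A `<=` B].

Definition partial (i : 'I_N) u x : R := 'D_(delta_mx ord0 i) u x.

Definition grad u x : 'rV[R]_N := \row_i partial i u x.

Definition C1_on A u := forall x, A x -> forall i : 'I_N,
  derivable u x (delta_mx ord0 i) /\ {for x, continuous (partial i u)}.

Definition iter_partial (s : seq 'I_N) u := foldr partial u s.

Definition smooth u := forall (s : seq 'I_N) x,
  {for x, continuous (iter_partial s u)} /\
  forall i : 'I_N, derivable (iter_partial s u) x (delta_mx ord0 i).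

(* elements of C_c^oo(A), extended by zero to the whole space *)
Definition test_fun A (phi : 'rV[R]_N -> R) :=
  [/\ smooth phi, compact (closure [set x | phi x != 0]) &
      closure [set x | phi x != 0] `<=` A].

(* [|xi|^(p-2) xi], equal to 0 at [xi = 0] *)
Definition pflux (p : R) (xi : 'rV[R]_N) : 'rV[R]_N :=
  (enorm xi `^ (p - 2)) *: xi.

(* - Delta_p u + L u <= - Delta_p v + L v in A, in the sense of distributions *)
Definition weak_plap_le (p L : R) A u v :=
  forall phi, test_fun A phi -> (forall x, 0 <= phi x) ->
    \int[@lebesgueN R N]_(x in A)
      dotv (pflux p (grad u x) - pflux p (grad v x)) (grad phi x)
    <= L * \int[@lebesgueN R N]_(x in A) ((v x - u x) * phi x).

(* [a ^ q] for [0 <= a], with [0 ^ q = +oo] for [q < 0] (the library has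
   [0 `^ q = 0] for [q != 0]) *)
Definition epowR (a q : R) : \bar R :=
  if (a == 0) && (q < 0) then +oo%E else (a `^ q)%:E.

Definition plap_weight (p : R) u v x : \bar R :=
  epowR (enorm (grad u x) + enorm (grad v x)) (p - 2).

(* the measure with density [rho] on [D] and 0 outside [D] *)
Definition weighted_measure (rho : 'rV[R]_N -> \bar R) (D : set 'rV[R]_N)
    (A : set 'rV[R]_N) : \bar R :=
  (\int[@lebesgueN R N]_(x in A `&` D) rho x)%E.

Lemma weighted_measure_isMeasure rho D :
  measurable D -> measurable_fun D rho -> (forall x, D x -> (0 <= rho x)%E) ->
  exists m : {measure set 'rV[R]_N -> \bar R},
    weighted_measure rho D = m :> (_ -> _).
Proof.
move=> mD mrho rho0.
have w0 : weighted_measure rho D set0 = 0%E.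
  by rewrite /weighted_measure set0I integral_set0.
have wge0 A : (0 <= weighted_measure rho D A)%E.
  by apply: integral_ge0 => x [_ /rho0].
have wadd : semi_sigma_additive (weighted_measure rho D).
  move=> F mF tF mUF; rewrite /weighted_measure setI_bigcupl.
  rewrite ge0_integral_bigcup//=.
  - by apply: is_cvg_nneseries => k _ _; exact: wge0.
  - by move=> k; exact: measurableI.
  - rewrite -setI_bigcupl; apply: measurable_funS mrho => //.
  - by move=> x [k _ [_ /rho0]].
  - apply/trivIsetP => i j _ _ ij; rewrite setIACA setIid.
    by move/trivIsetP : tF => /(_ i j Logic.I Logic.I ij) ->; rewrite set0I.
pose X := isMeasure.Build _ _ _ (weighted_measure rho D) w0 wge0 wadd.
pose m : {measure set 'rV[R]_N -> \bar R} := HB.pack (weighted_measure rho D) X.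
by exists m.
Qed.

Definition condM (kappa : R) (D : set 'rV[R]_N) (rho : 'rV[R]_N -> \bar R) :=
  [/\ measurable_fun D rho, forall x, D x -> (0 < rho x)%E &
    exists lambda0 Lambda0 : R, [/\ 0 < lambda0, 0 < Lambda0,
      {ae @lebesgueN R N, forall x, D x -> (lambda0%:E <= rho x)%E} &
      forall (x : 'rV[R]_N) (r : R), 0 < r ->
        (weighted_measure rho D (eball x r) <=
         (Lambda0 * r `^ (N%:R - 2 + kappa))%:E)%E]].

End euclidean.

(* Main.v *)
Require Import Defs.
From HB Require Import structures.
From mathcomp Require Import all_boot all_order all_algebra.
From mathcomp Require Import all_classical all_reals all_analysis.
From mathcomp Require Import measurable_realfun ring lra zify.
Import Order.TTheory GRing.Theory Num.Theory.
Import numFieldNormedType.Exports.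
Local Open Scope classical_set_scope.
Local Open Scope ring_scope.

Set Implicit Arguments.
Unset Strict Implicit.
Unset Printing Implicit Defensive.

(** The constant of the weak Harnack inequality is chosen after the functions, the ball and
    the exponent. If the infimum of [w := v - u] over the ball is positive, the constant only
    has to be large, because the left side is finite: [w] is bounded near the ball and the
    weight has finite mass there. If the infimum is 0, it is a zero of [w] by compactness,
    and the left side has to vanish. So both conclusions follow from one fact: a nonnegative
    [w] that vanishes at one point of a connected open set vanishes identically there
    ([diff_vanishing]); and for this the zero set has to be open ([local_vanishing]).

    The local fact is proved by De Giorgi's method for the potential [z := - ln (w + e)],
    with estimates that do not depend on [e > 0].

    The vector inequalities for the p-Laplacian ([pflux_bounds]) say that the difference of
    the two fluxes behaves like [rho] times the gradient of [u - v], where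
    [rho = (|Du| + |Dv|)^(p - 2)]. Testing the weak inequality with [eta^2 h (z) / (w + e)]
    gives the energy inequality
      [int rho eta^2 (h + h') (z) |Dz|^2 <= C int rho (|D eta|^2 + eta^2) h (z)]
    for all nonnegative [h] with [h' >= 0] ([energy_inequality]). The test function is only
    continuously differentiable; it is a limit, in the C1 sense, of smooth nonnegative ones
    ([C1_test_approx]): divide it by a smooth bump, approximate the quotient and its gradient
    by Bernstein polynomials, and multiply by the bump again.

    The growth condition on the weight takes the place of a Sobolev inequality: for the
    average [f_H] of [f] over a fixed cube [H],
      [int_E rho |f - f_H|^2 <= C (int_E rho)^th int |Df|^2]
    with some [th > 0] ([trace_inequality]). Indeed [f x - f_H] telescopes into differences
    of averages over cubes shrinking to [x], each of them is controlled by a Poincare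
    inequality ([poincare_cube]), and integrating the resulting series against [rho] gives a
    geometric series because the mass of a cube of side [d] is at most a constant times
    [d^(N - 2 + kappa)].

    With [h = 1] the energy of [z] is bounded ([log_energy]). If [w] is positive somewhere,
    then [z] is bounded above on a small cube there, and the trace inequality shows that the
    mass of [z > k] is small for large [k] ([level_mass_initial]). With truncations for [h]
    the same two inequalities give a superlinear recursion between the masses above
    increasing levels ([level_mass_step]), so that these decay to 0 ([fast_decay]) and [z] is
    at most [k + 1] near the centre, whatever [e] is. At a zero of [w] this is absurd, since
    there [z = - ln e] is as large as one likes. *)

(** * Iterated integrals and cubes *)

Section tonelli.
Context d1 d2 (T1 : measurableType d1) (T2 : measurableType d2) (R : realType).
Variables (m1 : {sigma_finite_measure set T1 -> \bar R})
  (m2 : {sigma_finite_measure set T2 -> \bar R}).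
Local Open Scope ereal_scope.

Lemma measurable_integral_snd (B : set T2) (K : T1 * T2 -> \bar R) :
  measurable B -> measurable_fun setT K -> (forall z, 0 <= K z) ->
  measurable_fun setT (fun x => \int[m2]_(y in B) K (x, y)).
Proof.
move=> mB mK K0.
have -> : (fun x => \int[m2]_(y in B) K (x, y)) =
    fubini_F m2 (K \_ (setT `*` B)).
  apply/funext => x; rewrite /fubini_F [LHS]integral_mkcond.
  by apply: eq_integral => y _; rewrite !patchE in_setX in_setT.
apply: measurable_fun_fubini_tonelli_F.
  apply/(measurable_restrictT _ _).1; first exact: measurableX.
  exact: measurable_funS mK.
by move=> z; apply: erestrict_ge0.
Qed.

(** Tonelli's theorem holds for nonnegative kernels on the full product; restricting the
    kernel to a rectangle moves it to iterated integrals over measurable sets. *)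
Lemma tonelli_sets (A : set T1) (B : set T2) (K : T1 * T2 -> \bar R) :
  measurable A -> measurable B ->
  measurable_fun setT K -> (forall z, 0 <= K z) ->
  \int[m1]_(x in A) \int[m2]_(y in B) K (x, y) =
  \int[m2]_(y in B) \int[m1]_(x in A) K (x, y).
Proof.
move=> mA mB mK K0; pose K' := K \_ (A `*` B).
have mK' : measurable_fun setT K'.
  apply/(measurable_restrictT _ _).1; first exact: measurableX.
  exact: measurable_funS mK.
have K'0 z : 0 <= K' z by apply: erestrict_ge0.
transitivity (\int[m1]_x \int[m2]_y K' (x, y)).
  rewrite [LHS]integral_mkcond; apply: eq_integral => x _.
  rewrite patchE; case: ifPn => xA.
    rewrite [LHS]integral_mkcond; apply: eq_integral => y _.
    by rewrite /K' !patchE in_setX xA.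
  rewrite integral0_eq// => y _.
  by rewrite /K' !patchE in_setX (negbTE xA).
rewrite fubini_tonelli//; apply/esym.
rewrite [LHS]integral_mkcond; apply: eq_integral => y _.
rewrite patchE; case: ifPn => yB.
  rewrite [LHS]integral_mkcond; apply: eq_integral => x _.
  by rewrite /K' !patchE in_setX yB andbT.
rewrite integral0_eq// => x _.
by rewrite /K' !patchE in_setX (negbTE yB) andbF.
Qed.

End tonelli.

Section cubes.
Context {R : realType}.

(** Closed cube of half-side [s]: the ball of the maximum norm. Cubes are products of
    intervals, so integrals over them can be computed one coordinate at a time. *)
Definition cube n (c : 'rV[R]_n) (s : R) : set 'rV[R]_n :=
  [set x | forall i, `|x ord0 i - c ord0 i| <= s].

Definition rV_behead n (c : 'rV[R]_n.+1) : 'rV[R]_n :=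
  \row_i c ord0 (lift ord0 i).

Lemma measurable_cube n (c : 'rV[R]_n) s : measurable (cube c s).
Proof.
rewrite (_ : cube c s = \bigcap_(i in [set: 'I_n])
    (rV_coord i @^-1` `[c ord0 i - s, c ord0 i + s]%classic)); last first.
  apply/seteqP; split=> x /= h i.
    by move=> _; rewrite /= in_itv /= -ler_distl; exact: h.
  by have := h i Logic.I; rewrite /= in_itv /= -ler_distl.
apply: fin_bigcap_measurable => [|i _]; first exact: finite_finset.
by rewrite -[X in measurable X]setTI; apply: measurable_rV_coord.
Qed.

Lemma lebesgueN_cube n (c : 'rV[R]_n) s : 0 <= s ->
  lebesgueN (cube c s) = ((2 * s) ^+ n)%:E.
Proof.
move=> s0; pose a := \row_i (c ord0 i - s); pose b := \row_i (c ord0 i + s).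
have -> : cube c s = [set x | forall i, a ord0 i <= x ord0 i <= b ord0 i].
  by apply/seteqP; split => x h i; have := h i; rewrite !mxE ler_distl.
rewrite lebesgueN_box; last by move=> i; rewrite !mxE lerD2l; lra.
congr EFin; rewrite -[in RHS](card_ord n) -prodr_const.
by apply: eq_bigr => i _; rewrite !mxE; ring.
Qed.

Lemma preimage_cube n (c : 'rV[R]_n.+1) s : @rV_cons R n @^-1` cube c s =
  `[c ord0 ord0 - s, c ord0 ord0 + s]%classic `*` cube (rV_behead c) s.
Proof.
apply/seteqP; split => [[x y] /= h|[x y] /= [h1 h2] i].
  split=> [|i] /=.
    by have := h ord0; rewrite rV_cons0 /= in_itv/= ler_distl.
  by have := h (lift ord0 i); rewrite rV_consS !mxE.
case: (unliftP ord0 i) => [j|] ->.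
  by rewrite rV_consS; have := h2 j; rewrite !mxE.
by rewrite rV_cons0; move: h1; rewrite /= in_itv/= ler_distl.
Qed.

Local Open Scope ereal_scope.

(** A cube in dimension [n.+1] is the product of an interval and a cube in dimension
    [n], which is the induction step for inequalities on cubes. *)
Lemma integral_cubeS n (c : 'rV[R]_n.+1) s (g : 'rV[R]_n.+1 -> \bar R) :
  measurable_fun setT g -> (forall x, 0 <= g x) ->
  \int[@lebesgueN R n.+1]_(x in cube c s) g x =
  \int[@lebesgue_measure R]_(a in `[(c ord0 ord0 - s)%R, (c ord0 ord0 + s)%R]%classic)
    \int[@lebesgueN R n]_(y in cube (rV_behead c) s) g (rV_cons (a, y)).
Proof.
move=> mg g0.
rewrite (@ge0_integral_pushforward _ _ _ _ _ _ (@measurable_rV_cons R n)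
  (@lebesgue_measure R \x @lebesgueN R n))//; last 2 first.
  - exact: measurable_cube.
  - exact: measurable_funS mg.
rewrite preimage_cube.
set I := `[_, _]%classic; set B := cube _ _.
have mB : measurable B by exact: measurable_cube.
have mI : measurable I by exact: measurable_itv.
have mgc : measurable_fun setT (g \o @rV_cons R n).
  by apply: measurableT_comp => //; exact: measurable_rV_cons.
rewrite [LHS]integral_mkcond fubini_tonelli1; last 2 first.
  - apply/(measurable_restrictT _ _).1; first exact: measurableX.
    exact: measurable_funS mgc.
  - by move=> z; apply: erestrict_ge0 => y _; exact: g0.
rewrite [RHS]integral_mkcond; apply: eq_integral => a _.
rewrite /fubini_F [in RHS]patchE; case: ifPn => aI.
  rewrite [RHS]integral_mkcond; apply: eq_integral => y _.
  by rewrite !patchE in_setX aI.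
rewrite integral0_eq// => y _.
by rewrite !patchE in_setX (negbTE aI).
Qed.

End cubes.

(** * A Poincare inequality on cubes *)

Section poincare.
Context {R : realType}.
Local Notation leb := (@lebesgue_measure R).

Definition set_coord n (x : 'rV[R]_n) (i : 'I_n) (t : R) : 'rV[R]_n :=
  \row_j (if j == i then t else x ord0 j).

Lemma set_coord_cons0 n a (x : 'rV[R]_n) t :
  set_coord (rV_cons (a, x)) ord0 t = rV_cons (t, x).
Proof.
apply/rowP => j; rewrite mxE; case: (unliftP ord0 j) => [k|] ->.
  by rewrite !rV_consS.
by rewrite eqxx rV_cons0.
Qed.

Lemma set_coord_consS n a (x : 'rV[R]_n) i t :
  set_coord (rV_cons (a, x)) (lift ord0 i) t = rV_cons (a, set_coord x i t).
Proof.
apply/rowP => j; rewrite mxE; case: (unliftP ord0 j) => [k|] ->.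
  by rewrite (inj_eq lift_inj) !rV_consS mxE.
by rewrite (negbTE (neq_lift _ _)) !rV_cons0.
Qed.

Lemma cube_cons n (c : 'rV[R]_n.+1) s a x :
  cube c s (rV_cons (a, x)) <->
  `|a - c ord0 ord0| <= s /\ cube (rV_behead c) s x.
Proof.
have := congr1 (fun S => S (a, x)) (preimage_cube c s); rewrite /= => ->.
by rewrite in_itv/= ler_distl.
Qed.

Lemma measurable_dist d (T : measurableType d) (f g : T -> R) :
  measurable_fun setT f -> measurable_fun setT g ->
  measurable_fun setT (fun z => (`|f z - g z|)%:E).
Proof.
move=> mf mg; apply/measurable_EFinP; apply: measurableT_comp => //.
exact: measurable_funB.
Qed.

Lemma measurable_consl n (a : R) : measurable_fun setT (fun y : 'rV[R]_n => rV_cons (a, y)).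
Proof.
apply: (measurableT_comp (@measurable_rV_cons R n)).
exact: measurable_pair1.
Qed.

Local Open Scope ereal_scope.

(** Induction on the dimension. To compare [f] at [(a, x)] and at [(b, y)], change the
    first coordinate at fixed [x], which costs the line integral of [G] through [x], and
    then change [x] into [y] at fixed [b], which is the case of dimension [n].
    Integrating the first cost over all four variables yields [(2 * s) ^+ n.+2] times
    the integral of [G], and the second one is the induction hypothesis integrated in
    [b]. Only line integrals of [G] enter, so [G] may be any majorant of the
    gradient. *)
Lemma poincare_cube n (c : 'rV[R]_n) (s : R) (f G : 'rV[R]_n -> R) :
  (0 < s)%R -> measurable_fun setT f -> measurable_fun setT G ->
  (forall x, 0 <= G x)%R ->
  (forall i x a b, cube c s x -> (`|a - c ord0 i| <= s)%R -> (`|b - c ord0 i| <= s)%R ->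
    `|f (set_coord x i a) - f (set_coord x i b)|%:E <=
    \int[leb]_(t in `[(c ord0 i - s)%R, (c ord0 i + s)%R]%classic)
      (G (set_coord x i t))%:E) ->
  \int[@lebesgueN R n]_(x in cube c s) \int[@lebesgueN R n]_(y in cube c s)
    `|f x - f y|%:E <=
  (n%:R * (2 * s) ^+ n.+1)%:E * \int[@lebesgueN R n]_(x in cube c s) (G x)%:E.
Proof.
move=> s0; elim: n => [|n IH] in c f G *.
  move=> mf mG G0 _; rewrite mul0r mul0e.
  rewrite integral0_eq// => x _; rewrite integral0_eq// => y _.
  by rewrite (_ : x = y) ?subrr ?normr0//; apply/rowP => -[].
move=> mf mG G0 fG.
set I := `[(c ord0 ord0 - s)%R, (c ord0 ord0 + s)%R]%classic.
set Q := cube (rV_behead c) s.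
have mQ : measurable Q by exact: measurable_cube.
have mI : measurable I by exact: measurable_itv.
have muI : leb I = (2 * s)%:E.
  rewrite lebesgue_measure_itv/= lte_fin ifT; last by lra.
  by rewrite -EFinB; congr EFin; ring.
have s20 : (0 <= 2 * s)%R by lra.
have muQ : @lebesgueN R n Q = ((2 * s) ^+ n)%:E by rewrite lebesgueN_cube// ltW.
pose f' z := f (rV_cons z); pose G' z := G (rV_cons z).
have mf' : measurable_fun setT f'.
  by apply: measurableT_comp => //; exact: measurable_rV_cons.
have mG' : measurable_fun setT G'.
  by apply: measurableT_comp => //; exact: measurable_rV_cons.
have G'0 z : (0 <= G' z)%R by exact: G0.
pose J := \int[leb]_(a in I) \int[@lebesgueN R n]_(x in Q) (G' (a, x))%:E.
have -> : \int[@lebesgueN R n.+1]_(x in cube c s) (G x)%:E = J.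
  rewrite integral_cubeS//; exact/measurable_EFinP.
(* The two costs of the path, integrated over the variables other than [x]. *)
pose Phi x := \int[leb]_(t in I) (G' (t, x))%:E.
pose Psi x := \int[leb]_(b in I) \int[@lebesgueN R n]_(y in Q)
  `|f' (b, x) - f' (b, y)|%:E.
have Phi0 x : 0 <= Phi x by apply: integral_ge0 => t _; rewrite lee_fin.
have Psi0 x : 0 <= Psi x.
  by apply: integral_ge0 => t _; apply: integral_ge0 => y _; rewrite lee_fin.
have mPhi : measurable_fun setT Phi.
  apply: (@measurable_integral_snd _ _ _ _ _ leb I
    (fun z => (G' (z.2, z.1))%:E)) => //.
    by apply/measurable_EFinP; apply: (measurableT_comp mG'); exact: measurable_swap.
  by move=> z; rewrite lee_fin.
have mK : measurable_fun setT (fun z : ('rV[R]_n * measurableTypeR R) * 'rV[R]_n =>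
    (`|f' (z.1.2, z.1.1) - f' (z.1.2, z.2)|)%:E).
  apply: measurable_dist; apply: (measurableT_comp mf').
    apply/measurable_fun_pairP; split=> /=.
      by apply: (measurableT_comp measurable_snd); exact: measurable_fst.
    by apply: (measurableT_comp measurable_fst); exact: measurable_fst.
  apply/measurable_fun_pairP; split=> /=; last exact: measurable_snd.
  by apply: (measurableT_comp measurable_snd); exact: measurable_fst.
have mK2 : measurable_fun setT (fun z : 'rV[R]_n * measurableTypeR R =>
    \int[@lebesgueN R n]_(y in Q) (`|f' (z.2, z.1) - f' (z.2, y)|)%:E).
  exact: (@measurable_integral_snd _ _ _ _ _ (@lebesgueN R n) Q _ mQ mK).
have mKs : measurable_fun setT (fun z : (measurableTypeR R * 'rV[R]_n) * 'rV[R]_n =>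
    (`|f' (z.1.1, z.1.2) - f' (z.1.1, z.2)|)%:E).
  have m11 : measurable_fun setT (fun z : (measurableTypeR R * 'rV[R]_n) * 'rV[R]_n => z.1.1).
    exact: (measurableT_comp measurable_fst measurable_fst).
  have m12 : measurable_fun setT (fun z : (measurableTypeR R * 'rV[R]_n) * 'rV[R]_n => z.1.2).
    exact: (measurableT_comp measurable_snd measurable_fst).
  apply: measurable_dist; apply: (measurableT_comp mf').
    by apply/measurable_fun_pairP; split.
  by apply/measurable_fun_pairP; split=> //=; exact: measurable_snd.
have mK2s : measurable_fun setT (fun z : measurableTypeR R * 'rV[R]_n =>
    \int[@lebesgueN R n]_(y in Q) (`|f' (z.1, z.2) - f' (z.1, y)|)%:E).
  exact: (@measurable_integral_snd _ _ _ _ _ (@lebesgueN R n) Q _ mQ mKs).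
have mPsi : measurable_fun setT Psi.
  apply: (@measurable_integral_snd _ _ _ _ _ leb I
    (fun z => \int[@lebesgueN R n]_(y in Q) (`|f' (z.2, z.1) - f' (z.2, y)|)%:E)) => //.
  by move=> z; apply: integral_ge0 => y _; rewrite lee_fin.
have mfc b : measurable_fun setT (fun x : 'rV[R]_n => f' (b, x)).
  by apply: (measurableT_comp mf); exact: measurable_consl.
have mGc b : measurable_fun setT (fun x : 'rV[R]_n => G' (b, x)).
  by apply: (measurableT_comp mG); exact: measurable_consl.
have intPhi : \int[@lebesgueN R n]_(x in Q) Phi x = J.
  rewrite /Phi /J; apply/esym.
  apply: (@tonelli_sets _ _ _ _ _ leb (@lebesgueN R n) I Q (fun z => (G' z)%:E)) => //.
  by apply/measurable_EFinP.
have intPsi : \int[@lebesgueN R n]_(x in Q) Psi x <= (n%:R * (2 * s) ^+ n.+1)%:E * J.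
  rewrite /Psi.
  rewrite (@tonelli_sets _ _ _ _ _ (@lebesgueN R n) leb Q I (fun z =>
    \int[@lebesgueN R n]_(y in Q) (`|f' (z.2, z.1) - f' (z.2, y)|)%:E))//=; last first.
    by move=> z; apply: integral_ge0 => y _; rewrite lee_fin.
  rewrite /J -ge0_integralZl//; last 3 first.
  - apply: measurable_funTS.
    apply: (@measurable_integral_snd _ _ _ _ _ (@lebesgueN R n) Q
      (fun z => (G' z)%:E)) => //.
    by apply/measurable_EFinP.
  - by move=> a _; apply: integral_ge0 => y _; rewrite lee_fin.
  - by rewrite lee_fin mulr_ge0// exprn_ge0.
  apply: ge0_le_integral => //.
  - by move=> b _; apply: integral_ge0 => x _; apply: integral_ge0 => y _; rewrite lee_fin.
  - apply: measurable_funTS.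
    apply: (@measurable_integral_snd _ _ _ _ _ (@lebesgueN R n) Q
      (fun z => \int[@lebesgueN R n]_(y in Q) (`|f' (z.1, z.2) - f' (z.1, y)|)%:E)) => //.
    by move=> z; apply: integral_ge0 => y _; rewrite lee_fin.
  - apply: measurable_funTS; apply: measurable_funeM.
    apply: (@measurable_integral_snd _ _ _ _ _ (@lebesgueN R n) Q
      (fun z => (G' z)%:E)) => //.
    by apply/measurable_EFinP.
  move=> b Ib.
  apply: (IH (rV_behead c) (fun x => f' (b, x)) (fun x => G' (b, x))) => //.
  move=> i x a b' Qx aI bI.
  have := fG (lift ord0 i) (rV_cons (b, x)) a b'.
  rewrite !set_coord_consS (_ : c _ (lift ord0 i) = rV_behead c ord0 i); last by rewrite mxE.
  under eq_integral do rewrite set_coord_consS.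
  apply => //; apply/cube_cons; split=> //.
  by move: Ib; rewrite /I /= in_itv/= ler_distl.
rewrite integral_cubeS//; last 2 first.
  - apply: (@measurable_integral_snd _ _ _ _ _ (@lebesgueN R n.+1) (cube c s)
      (fun z => (`|f z.1 - f z.2|)%:E)) => //; first exact: measurable_cube.
    apply: measurable_dist; apply: (measurableT_comp mf).
      exact: measurable_fst.
    exact: measurable_snd.
  - by move=> x; apply: integral_ge0 => y _; rewrite lee_fin.
rewrite -/I -/Q.
have mPP : measurable_fun setT (fun x => ((2 * s) ^+ n.+1)%:E * Phi x + Psi x).
  by apply: emeasurable_funD => //; exact: measurable_funeM.
have PP0 x : 0 <= ((2 * s) ^+ n.+1)%:E * Phi x + Psi x.
  by rewrite adde_ge0// mule_ge0// lee_fin exprn_ge0.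
have mF : measurable_fun setT (fun x => \int[@lebesgueN R n.+1]_(y in cube c s)
    `|f x - f y|%:E).
  apply: (@measurable_integral_snd _ _ _ _ _ (@lebesgueN R n.+1) (cube c s)
    (fun z => (`|f z.1 - f z.2|)%:E)) => //; first exact: measurable_cube.
  apply: measurable_dist; apply: (measurableT_comp mf).
    exact: measurable_fst.
  exact: measurable_snd.
have mF' a : measurable_fun setT (fun x : 'rV[R]_n => \int[@lebesgueN R n.+1]_(y in cube c s)
    `|f (rV_cons (a, x)) - f y|%:E).
  by apply: (measurableT_comp mF); exact: measurable_consl.
apply: (@le_trans _ _ (\int[leb]_(a in I) \int[@lebesgueN R n]_(x in Q)
    (((2 * s) ^+ n.+1)%:E * Phi x + Psi x))).
  apply: ge0_le_integral => //.
  - by move=> a _; apply: integral_ge0 => x _; apply: integral_ge0 => y _; rewrite lee_fin.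
  - apply: measurable_funTS.
    apply: (@measurable_integral_snd _ _ _ _ _ (@lebesgueN R n) Q (fun z =>
      \int[@lebesgueN R n.+1]_(y in cube c s) `|f (rV_cons (z.1, z.2)) - f y|%:E)) => //.
      rewrite (_ : (fun _ => _) = (fun x => \int[@lebesgueN R n.+1]_(y in cube c s)
          `|f x - f y|%:E) \o @rV_cons R n); last by apply/funext => -[].
      by apply: (measurableT_comp mF); exact: measurable_rV_cons.
    by move=> z; apply: integral_ge0 => y _; rewrite lee_fin.
  move=> a Ia; apply: ge0_le_integral => //.
  - by move=> x _; apply: integral_ge0 => y _; rewrite lee_fin.
  - exact: measurable_funTS.
  - exact: measurable_funTS.
  move=> x Qx; rewrite integral_cubeS//; last first.
    by apply: measurable_dist => //.
  rewrite -/I -/Q.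
  have mc2 : measurable_fun setT (fun z : measurableTypeR R * 'rV[R]_n =>
       `|f' (z.1, x) - f' z|%:E).
    apply: measurable_dist => //; apply: (measurableT_comp mf').
    by apply/measurable_fun_pairP; split => /=; [exact: measurable_fst|exact: measurable_cst].
  have mc3 : measurable_fun setT (fun z : measurableTypeR R * 'rV[R]_n =>
       Phi x + `|f' (z.1, x) - f' z|%:E).
    by apply: emeasurable_funD.
  apply: (@le_trans _ _ (\int[leb]_(b in I) \int[@lebesgueN R n]_(y in Q)
      (Phi x + `|f' (b, x) - f' (b, y)|%:E))).
    apply: ge0_le_integral => //.
    - by move=> b _; apply: integral_ge0 => y _; rewrite lee_fin.
    - apply: measurable_funTS.
      apply: (@measurable_integral_snd _ _ _ _ _ (@lebesgueN R n) Q (fun z =>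
        `|f (rV_cons (a, x)) - f (rV_cons z)|%:E)) => //.
      exact: measurable_dist.
    - apply: measurable_funTS.
      apply: (@measurable_integral_snd _ _ _ _ _ (@lebesgueN R n) Q (fun z =>
         Phi x + `|f' (z.1, x) - f' z|%:E)) => //.
      by move=> z; rewrite adde_ge0// lee_fin.
    move=> b Ib; apply: ge0_le_integral => //.
    - by apply: measurable_funTS; apply: measurable_dist; [exact: measurable_cst|exact: mfc].
    - apply: measurable_funTS; apply: emeasurable_funD => //.
      exact: measurable_dist.
    move=> y Qy.
    have -> : (f (rV_cons (a, x)) - f (rV_cons (b, y)) =
      (f' (a, x) - f' (b, x)) + (f' (b, x) - f' (b, y)))%R by rewrite /f'; ring.
    apply: (@le_trans _ _ (`|f' (a, x) - f' (b, x)|%:E + `|f' (b, x) - f' (b, y)|%:E)).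
      by rewrite -EFinD lee_fin ler_normD.
    rewrite leeD2r//.
    have := fG ord0 (rV_cons (a, x)) a b.
    rewrite !set_coord_cons0.
    under eq_integral do rewrite set_coord_cons0.
    have dI t : I t -> (`|t - c ord0 ord0| <= s)%R by rewrite /I /= in_itv/= ler_distl.
    by apply; [apply/cube_cons; split => //; exact: dI|exact: dI|exact: dI].
  under eq_integral => b _.
    rewrite ge0_integralD//; last first.
      by apply: measurable_funTS; exact: measurable_dist.
    rewrite integral_cst// [X in _ * X + _]muQ.
  over.
  have c0 b : I b -> 0 <= Phi x * ((2 * s) ^+ n)%:E.
    by move=> _; rewrite mule_ge0// lee_fin exprn_ge0.
  have i0 b : I b -> 0 <= \int[@lebesgueN R n]_(y in Q) `|f' (b, x) - f' (b, y)|%:E.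
    by move=> _; apply: integral_ge0 => y _; rewrite lee_fin.
  rewrite ge0_integralD//; last first.
    apply: measurable_funTS.
    exact: (@measurable_integral_snd _ _ _ _ _ (@lebesgueN R n) Q _ mQ mc2).
  rewrite integral_cst// [X in _ * _ * X + _]muI -/(Psi x) leeD2r// -muleA -EFinM -exprSr.
  by rewrite muleC.
have c0 x : Q x -> 0 <= ((2 * s) ^+ n.+1)%:E * Phi x.
  by move=> _; rewrite mule_ge0// lee_fin exprn_ge0.
have mPhi' : measurable_fun Q Phi by exact: measurable_funTS.
have mcPhi : measurable_fun Q (fun x => ((2 * s) ^+ n.+1)%:E * Phi x).
  by apply: measurable_funTS; exact: measurable_funeM.
have mPsi' : measurable_fun Q Psi by exact: measurable_funTS.
under eq_integral => a _.
  rewrite ge0_integralD//.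
  rewrite ge0_integralZl ?lee_fin ?exprn_ge0//.
  rewrite intPhi.
over.
rewrite integral_cst// [X in _ * X]muI.
have J0 : 0 <= J by apply: integral_ge0 => a _; apply: integral_ge0 => x _; rewrite lee_fin.
apply: (@le_trans _ _ ((((2 * s) ^+ n.+1)%:E * J + (n%:R * (2 * s) ^+ n.+1)%:E * J) * (2 * s)%:E)).
  by apply: lee_wpmul2r; rewrite ?lee_fin// leeD2l.
rewrite -ge0_muleDl ?lee_fin ?mulr_ge0 ?exprn_ge0//.
rewrite muleAC -EFinD -EFinM lee_wpmul2r// lee_fin.
by rewrite -natr1 [in leRHS]exprSr; rewrite le_eqVlt; apply/orP; left; apply/eqP; ring.
Qed.

End poincare.

(** * Averages over cubes *)

Section averages.
Context {R : realType}.
Local Notation leb := (@lebesgue_measure R).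

(** Cauchy-Schwarz against a geometric weight: the inductive step is the inequality [(a
    + S)^2 <= a^2 / (1 - q) + S^2 / q]. *)
Lemma sum_sqr_geometric (q : R) (a : nat -> R) (J : nat) : 0 < q -> q < 1 ->
  (\sum_(j < J) a j) ^+ 2 <= (1 - q)^-1 * \sum_(j < J) q^-1 ^+ j * a j ^+ 2.
Proof.
move=> q0 q1; elim: J a => [|J IH] a.
  by rewrite !big_ord0 mulr0 expr2 mulr0.
rewrite !big_ord_recl /= expr0 mul1r.
have := IH (fun j => a j.+1).
under [X in _ <= _ * (_ + X)]eq_bigr do rewrite /bump /= add1n exprS -mulrA.
rewrite -mulr_sumr.
set S := (X in X ^+ 2 <= _); set T := (X in _ <= _ * X).
rewrite (_ : \sum_(i < J) a (bump 0 i) = S) // => ST.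
have q1' : 0 < 1 - q by lra.
apply: (@le_trans _ _ ((1 - q)^-1 * a 0%N ^+ 2 + q^-1 * S ^+ 2)).
  rewrite -subr_ge0.
  have -> : (1 - q)^-1 * a 0%N ^+ 2 + q^-1 * S ^+ 2 - (a 0%N + S) ^+ 2 =
     ((1 - q) * q)^-1 * (q * a 0%N - (1 - q) * S) ^+ 2.
    by field; rewrite ?gt_eqF.
  by rewrite mulr_ge0 ?sqr_ge0// invr_ge0 mulr_ge0// ltW.
rewrite mulrDr lerD2l [leRHS]mulrCA ler_wpM2l ?invr_ge0 ?(ltW q0)//.
Qed.

Section average.
Variable n : nat.
Implicit Types (f : 'rV[R]_n -> R) (c : 'rV[R]_n).

Definition average f c s : R :=
  (\int[@lebesgueN R n]_(x in cube c s) f x) / (2 * s) ^+ n.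

Lemma bounded_integrable_cube f c s M : 0 <= s -> measurable_fun (cube c s) f ->
  (forall x, cube c s x -> `|f x| <= M) ->
  (@lebesgueN R n).-integrable (cube c s) (EFin \o f).
Proof.
move=> s0 mf fM; apply: measurable_bounded_integrable => //.
- exact: measurable_cube.
- by rewrite [X in (X < _)%E](lebesgueN_cube c s0) ltry.
- exists M; split; first exact: num_real.
  by move=> K MK x Qx; apply: (le_trans (fM x Qx)); exact: ltW.
Qed.

Lemma dist_average f c s M k : 0 < s -> measurable_fun setT f ->
  (forall x, cube c s x -> `|f x| <= M) ->
  ((`|average f c s - k| * (2 * s) ^+ n)%:E <=
   \int[@lebesgueN R n]_(x in cube c s) `|f x - k|%:E)%E.
Proof.
move=> s0 mf fM.
have s20 : 0 < (2 * s) ^+ n by rewrite exprn_gt0// mulr_gt0.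
have mQ := @measurable_cube R n c s.
have muQ := @lebesgueN_cube R n c s (ltW s0).
have If := bounded_integrable_cube (ltW s0) (measurable_funTS mf) fM.
have Ik : (@lebesgueN R n).-integrable (cube c s) (EFin \o cst k).
  by apply: (@bounded_integrable_cube _ c s `|k|) => //; exact: ltW.
have Ifk : (@lebesgueN R n).-integrable (cube c s) (EFin \o (fun x => f x - k)).
  apply: (@bounded_integrable_cube _ c s (M + `|k|)) => //; first exact: ltW.
    by apply: measurable_funTS; exact: measurable_funB.
  by move=> x Qx; rewrite (le_trans (ler_normB _ _))// lerD2r fM.
have -> : `|average f c s - k| * (2 * s) ^+ n =
    `|\int[@lebesgueN R n]_(x in cube c s) (f x - k)|.
  rewrite RintegralB// Rintegral_cst//.
  rewrite (_ : fine _ = (2 * s) ^+ n); last by rewrite [X in fine X]muQ.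
  rewrite -{1}[(2 * s) ^+ n]ger0_norm ?ltW// -normrM mulrBl /average divfK//.
  by rewrite gt_eqF.
have := le_normr_Rintegral mQ Ifk.
rewrite /Rintegral -lee_fin fineK//.
exact: (integrable_fin_num _ (integrable_norm Ifk)).
Qed.

(** The Cauchy-Schwarz inequality against the constant 1, for extended real values: [2 m
    X <= Y + m^2 V] holds for every [m > 0], and [m = X / V] is the best choice. *)
Lemma integral_sqr_cube c s (G : 'rV[R]_n -> R) : 0 < s ->
  measurable_fun setT G -> (forall x, 0 <= G x) ->
  ((\int[@lebesgueN R n]_(x in cube c s) (G x)%:E) *
   (\int[@lebesgueN R n]_(x in cube c s) (G x)%:E) <=
   ((2 * s) ^+ n)%:E * \int[@lebesgueN R n]_(x in cube c s) (G x ^+ 2)%:E)%E.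
Proof.
move=> s0 mG G0.
have V0 : 0 < (2 * s) ^+ n by rewrite exprn_gt0// mulr_gt0.
have mQ := @measurable_cube R n c s.
have muQ := @lebesgueN_cube R n c s (ltW s0).
have key (m : R) : 0 < m -> ((2 * m)%:E * \int[@lebesgueN R n]_(x in cube c s) (G x)%:E <=
  \int[@lebesgueN R n]_(x in cube c s) (G x ^+ 2)%:E + (m ^+ 2 * (2 * s) ^+ n)%:E)%E.
  move=> m0.
  have -> : (m ^+ 2 * (2 * s) ^+ n)%:E = (\int[@lebesgueN R n]_(x in cube c s) (m ^+ 2)%:E)%E.
    rewrite integral_cst// EFinM; congr (_ * _)%E; exact/esym.
  have mG2 : measurable_fun setT (fun x => (G x ^+ 2)%:E).
    by apply/measurable_EFinP; exact: measurable_funX.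
  have G20 x : cube c s x -> (0 <= (G x ^+ 2)%:E)%E by rewrite lee_fin sqr_ge0.
  have m20 x : cube c s x -> (0 <= (m ^+ 2)%:E)%E by rewrite lee_fin sqr_ge0.
  rewrite -ge0_integralD//; last exact: measurable_funTS.
  rewrite -ge0_integralZl//; last 3 first.
  - by apply: measurable_funTS; exact/measurable_EFinP.
  - by move=> x _; rewrite lee_fin.
  - by rewrite lee_fin mulr_ge0// ltW.
  apply: ge0_le_integral => //.
  - by move=> x _; rewrite -EFinM lee_fin !mulr_ge0// ltW.
  - by apply: measurable_funTS; apply: measurable_funeM; exact/measurable_EFinP.
  - by apply: measurable_funTS; apply: emeasurable_funD.
  move=> x _; rewrite -EFinM -EFinD lee_fin.
  by have := sqr_ge0 (G x - m); nra.
have X0 : (0 <= \int[@lebesgueN R n]_(x in cube c s) (G x)%:E)%E.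
  by apply: integral_ge0 => x _; rewrite lee_fin.
have Y0 : (0 <= \int[@lebesgueN R n]_(x in cube c s) (G x ^+ 2)%:E)%E.
  by apply: integral_ge0 => x _; rewrite lee_fin sqr_ge0.
move: key X0 Y0; set X := (\int[_]_(x in _) (G x)%:E)%E; set Y := integral _ _ _; move: X Y => X Y key X0 Y0; move: Y Y0 key.
case=> [y| |] // Y0 key; last by rewrite gt0_muley ?lte_fin// leey.
have : (X < +oo)%E.
  have := key 1 ltr01; case: X {key X0} => [x| |] //; first by rewrite ltry.
  by rewrite gt0_muley ?lte_fin// ?mulr_gt0// -EFinD.
case: X key X0 => [x| |] // key x0.
rewrite lee_fin in x0; move=> _.
rewrite -!EFinM lee_fin; set V := (2 * s) ^+ n in key V0 *.
have [->|xn0] := eqVneq x 0; first by rewrite mulr0 mulr_ge0// ltW.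
have xp : 0 < x by rewrite lt_def xn0.
have := key (x / V) (divr_gt0 xp V0); rewrite -EFinM -EFinD lee_fin.
rewrite (_ : 2 * (x / V) * x = 2 * (x * x) / V); last by field; rewrite gt_eqF.
rewrite (_ : (x / V) ^+ 2 * V = (x * x) / V); last by field; rewrite gt_eqF.
rewrite -lerBlDr -mulrBl ler_pdivrMr//; lra.
Qed.

(** Both averages are taken inside a common cube, so their difference is at most the
    double integral of [`|f x - f y|] divided by the two volumes; the Poincare
    inequality and then Cauchy-Schwarz turn it into the integral of [G ^+ 2]. *)
Lemma average_sub_sqr f (G : 'rV[R]_n -> R) (c a b : 'rV[R]_n) (s sa sb M : R) :
  (0 < n)%N -> 0 < s -> 0 < sa -> 0 < sb -> measurable_fun setT f -> measurable_fun setT G ->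
  (forall x, 0 <= G x) ->
  (forall x, cube c s x -> `|f x| <= M) ->
  cube a sa `<=` cube c s -> cube b sb `<=` cube c s ->
  (forall i x t t', cube c s x -> `|t - c ord0 i| <= s -> `|t' - c ord0 i| <= s ->
    (`|f (set_coord x i t) - f (set_coord x i t')|%:E <=
    \int[leb]_(r in `[(c ord0 i - s)%R, (c ord0 i + s)%R]%classic)
      (G (set_coord x i r))%:E)%E) ->
  (((average f a sa - average f b sb) ^+ 2)%:E <=
   (n%:R ^+ 2 * (2 * s) ^+ (3 * n + 2) / ((2 * sa) ^+ n * (2 * sb) ^+ n) ^+ 2)%:E *
   \int[@lebesgueN R n]_(x in cube c s) (G x ^+ 2)%:E)%E.
Proof.
move=> n0 s0 sa0 sb0 mf mG G0 fM ac bc fG.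
have mQ := @measurable_cube R n.
have Va : 0 < (2 * sa) ^+ n by rewrite exprn_gt0// mulr_gt0.
have Vb : 0 < (2 * sb) ^+ n by rewrite exprn_gt0// mulr_gt0.
have mfk k : measurable_fun setT (fun x => (`|f x - k|)%:E) by exact: measurable_dist.
have mff : measurable_fun setT (fun z : 'rV[R]_n * 'rV[R]_n => (`|f z.1 - f z.2|)%:E).
  by apply: measurable_dist; apply: (measurableT_comp mf);
    [exact: measurable_fst|exact: measurable_snd].
have mfd (B : set 'rV[R]_n) : measurable B ->
  measurable_fun setT (fun x => \int[@lebesgueN R n]_(y in B) (`|f x - f y|)%:E)%E.
  by move=> mB; exact: (@measurable_integral_snd _ _ _ _ _ (@lebesgueN R n) B _ mB mff).
have h1 : ((`|average f a sa - average f b sb| * ((2 * sa) ^+ n * (2 * sb) ^+ n))%:E <=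
    \int[@lebesgueN R n]_(x in cube c s) \int[@lebesgueN R n]_(y in cube c s)
    `|f x - f y|%:E)%E.
  rewrite mulrA EFinM.
  have := @dist_average f a sa M (average f b sb) sa0 mf (fun x ax => fM x (ac x ax)).
  move/(lee_wpmul2r (_ : 0 <= ((2 * sb) ^+ n)%:E)%E) => /(_ _)/le_trans; apply.
    by rewrite lee_fin ltW.
  rewrite muleC -ge0_integralZl//; last 2 first.
  - exact: measurable_funTS.
  - by rewrite lee_fin ltW.
  apply: (@le_trans _ _ (\int[@lebesgueN R n]_(x in cube a sa) \int[@lebesgueN R n]_(y in cube c s)
    `|f x - f y|%:E)%E); last first.
    apply: ge0_subset_integral => //.
    - by apply: measurable_funTS; apply: mfd; exact: mQ.
    - by move=> x _; apply: integral_ge0 => y _; rewrite lee_fin.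
  apply: ge0_le_integral => //.
  - by move=> x _; rewrite mule_ge0// lee_fin ltW.
  - by apply: measurable_funTS; apply: measurable_funeM.
  - by apply: measurable_funTS; apply: mfd; exact: mQ.
  move=> x ax; rewrite -EFinM mulrC distrC.
  apply: (le_trans (@dist_average f b sb M (f x) sb0 mf (fun x ax => fM x (bc x ax)))).
  under eq_integral do rewrite distrC.
  apply: ge0_subset_integral => //.
  by apply: measurable_funTS; exact: measurable_dist.
have := le_trans h1 (poincare_cube s0 mf mG G0 fG).
have := @integral_sqr_cube c s G s0 mG G0.
have X0 : (0 <= \int[@lebesgueN R n]_(x in cube c s) (G x)%:E)%E.
  by apply: integral_ge0 => x _; rewrite lee_fin.
have Y0 : (0 <= \int[@lebesgueN R n]_(x in cube c s) (G x ^+ 2)%:E)%E.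
  by apply: integral_ge0 => x _; rewrite lee_fin sqr_ge0.
move: X0 Y0; set X := (\int[_]_(x in _) (G x)%:E)%E; set Y := integral _ _ _; move: X Y => X Y X0 Y0.
set d := `|_ - _|; rewrite -(real_normK (num_real (_ - _))) -/d.
have d0 : 0 <= d by exact: normr_ge0.
have s20 : 0 < 2 * s by lra.
move=> {h1}; have W0 := mulr_gt0 Va Vb; set W := _ ^+ n * _ ^+ n in W0 *.
move: Y Y0; case=> [y| |] // Y0; last first.
  move=> _ _; rewrite gt0_muley ?leey// lte_fin divr_gt0 ?exprn_gt0//.
  by rewrite mulr_gt0 ?exprn_gt0// ltr0n.
case: X X0 => [x| |] //; rewrite -?EFinM ?lee_fin => x0 xy dx.
rewrite mulrAC ler_pdivlMr ?exprn_gt0// -exprMn.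
apply: (@le_trans _ _ ((n%:R * (2 * s) ^+ n.+1 * x) ^+ 2)).
  apply: lerXn2r => //; rewrite nnegrE.
    by rewrite mulr_ge0// ltW.
  by rewrite !mulr_ge0// exprn_ge0// ltW.
have -> : (n%:R * (2 * s) ^+ n.+1 * x) ^+ 2 =
    n%:R ^+ 2 * (((2 * s) ^+ n.+1) ^+ 2 * (x * x)) by ring.
rewrite -[leRHS]mulrA ler_wpM2l ?sqr_ge0//.
apply: (@le_trans _ _ (((2 * s) ^+ n.+1) ^+ 2 * ((2 * s) ^+ n * y))).
  by rewrite ler_wpM2l ?sqr_ge0.
rewrite mulrA -exprM -exprD.
by rewrite (_ : (n.+1 * 2 + n = 3 * n + 2)%N)//; lia.
Qed.

End average.
End averages.

(** * Oscillation along shrinking cubes *)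

Ltac positivity := repeat first
  [ done | assumption | by apply: ltW
  | apply: sqr_ge0 | apply: exprn_gt0 | apply: exprn_ge0
  | apply: mulr_gt0 | apply: mulr_ge0 | apply: addr_gt0 | apply: addr_ge0
  | rewrite invr_gt0 | rewrite invr_ge0 | apply: powR_gt0 | apply: powR_ge0 ].

Section trace.
Context {R : realType}.
Local Notation leb := (@lebesgue_measure R).

(** Writing [t] as [t `^ th * t `^ (1 - th)] lets each factor be bounded by a different
    majorant of [t]. *)
Lemma geometric_mean_le (t a b th : R) : 0 <= t -> t <= a -> t <= b ->
  0 < th -> th < 1 -> t <= a `^ th * b `^ (1 - th).
Proof.
move=> t0 ta tb th0 th1.
have -> : t = t `^ th * t `^ (1 - th).
  rewrite -powRD; last by rewrite (_ : th + (1 - th) = 1) ?oner_eq0//; ring.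
  by rewrite (_ : th + (1 - th) = 1) ?powRr1//; ring.
by rewrite ler_pM ?powR_ge0// ge0_ler_powR ?nnegrE//; lra.
Qed.

Lemma cube_sub n (c d : 'rV[R]_n) s t : cube d (t - s) c -> cube c s `<=` cube d t.
Proof.
move=> dc x xc i; have := dc i; have := xc i => h1 h2.
by have := ler_distD (c ord0 i) (x ord0 i) (d ord0 i); lra.
Qed.

Lemma nbhs_cube n (x : 'rV[R]_n) (A : set 'rV[R]_n) : nbhs x A ->
  exists2 d : R, 0 < d & cube x d `<=` A.
Proof.
move=> /nbhs_ballP[e /= e0 xeA]; exists (e / 2); first by rewrite divr_gt0.
move=> y xy; apply: xeA; split => // i j; rewrite ord1.
by rewrite /ball /= distrC (le_lt_trans (xy j))//; lra.
Qed.

Lemma average_cvg n (f : 'rV[R]_n -> R) (x : 'rV[R]_n) (s0 M : R) (t : nat -> R) :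
  measurable_fun setT f -> (forall y, cube x s0 y -> `|f y| <= M) ->
  {for x, continuous f} -> (forall j, 0 < t j <= s0) -> t @ \oo --> (0 : R) ->
  (fun j => average f x (t j)) @ \oo --> f x.
Proof.
move=> mf fM cf ts0 t0; apply/cvgrPdist_le => e e0.
have /nbhs_cube[d d0 xd] : nbhs x [set y | `|f x - f y| <= e].
  by move/cvgrPdist_le : cf => /(_ _ e0).
have /cvgrPdist_le/(_ _ d0) := t0.
apply: filterS => j; rewrite sub0r normrN => tjd.
have /andP[tj0 tjs] := ts0 j.
have tjd' : t j <= d by rewrite (le_trans _ tjd)// ler_norm.
have V0 : 0 < (2 * t j) ^+ n by rewrite exprn_gt0// mulr_gt0.
rewrite distrC -(ler_pM2r V0) -lee_fin.
apply: (le_trans (@dist_average _ _ _ _ _ M (f x) tj0 mf _)).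
  move=> y; move/(cube_sub (_ : cube x (s0 - t j) x)) => xs; apply: fM; apply: xs.
  by move=> i; rewrite subrr normr0 subr_ge0.
apply: (@le_trans _ _ (\int[@lebesgueN R n]_(y in cube x (t j)) e%:E)%E).
  apply: ge0_le_integral => //.
  - exact: measurable_cube.
  - by apply: measurable_funTS; exact: measurable_dist.
  move=> y /(cube_sub (_ : cube x (d - t j) x)) xd'.
  rewrite lee_fin distrC; apply: xd; apply: xd'.
  by move=> i; rewrite subrr normr0 subr_ge0.
rewrite integral_cst//; last exact: measurable_cube.
by rewrite EFinM lee_wpmul2l ?lee_fin ?(ltW e0)// [leLHS](lebesgueN_cube _ (ltW tj0)).
Qed.

End trace.

Section scaling.
Context {R : realType}.

Lemma poincare_half_const (N d : R) (m n : nat) : n = (m + 2)%N -> d != 0 ->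
  N ^+ 2 * (2 * d) ^+ (3 * n + 2) / ((2 * (2^-1 * d)) ^+ n * (2 * d) ^+ n) ^+ 2 =
  N ^+ 2 * 4 ^+ n * ((2 * d) ^+ m)^-1.
Proof.
move=> -> d0; rewrite (_ : 2 * (2^-1 * d) = d); last by field.
rewrite (_ : (3 * (m + 2) + 2 = m + m + m + 8)%N); last by lia.
rewrite !exprD !(exprMn m).
have -> : (4 : R) ^+ m = 2 ^+ m * 2 ^+ m by rewrite -exprMn -natrM.
have : d ^+ m != 0 by rewrite expf_neq0.
have : (2 : R) ^+ m != 0 by rewrite expf_neq0// pnatr_eq0.
move: (d ^+ m) (2 ^+ m) => D T T0 D0.
by field; rewrite T0 D0 d0.
Qed.

Lemma poincare_full_const (N d w : R) (m n : nat) : n = (m + 2)%N -> d != 0 -> w != 0 ->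
  N ^+ 2 * d ^+ (3 * n + 2) / (d ^+ n * w) ^+ 2 =
  N ^+ 2 * d ^+ (2 * n) / w ^+ 2 * (d ^+ m)^-1.
Proof.
move=> -> d0 w0.
rewrite (_ : (3 * (m + 2) + 2 = m + m + m + 8)%N); last by lia.
rewrite (_ : (2 * (m + 2) = m + m + 4)%N); last by lia.
rewrite !exprD.
have : d ^+ m != 0 by rewrite expf_neq0.
move: (d ^+ m) => D D0.
by field; rewrite D0 d0 w0.
Qed.

End scaling.

Section trace_ineq.
Context {R : realType}.
Local Notation leb := (@lebesgue_measure R).
Variable m : nat.
Let n := m.+2.

(** [G] dominates the gradient of [f] in the form used by the Poincare inequality,
    through the increments of [f] along coordinate segments. *)
Definition line_bound (D : set 'rV[R]_n) (f G : 'rV[R]_n -> R) :=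
  forall c s, 0 < s -> cube c s `<=` D ->
  forall i x t t', cube c s x -> `|t - c ord0 i| <= s -> `|t' - c ord0 i| <= s ->
    (`|f (set_coord x i t) - f (set_coord x i t')|%:E <=
    \int[leb]_(r in `[(c ord0 i - s)%R, (c ord0 i + s)%R]%classic)
      (G (set_coord x i r))%:E)%E.

(** Telescoping along the cubes of half-side [r / 2 ^+ j] around [x]: consecutive
    averages differ by what the Poincare inequality allows, the averages tend to [f x],
    and [sum_sqr_geometric] squares the series at the price of the weights [q^-1 ^+ j].
    The first term compares the largest cube with the fixed cube of centre [h]. *)
Lemma sqr_dist_average_le (q r sh : R) : 0 < q -> q < 1 -> 0 < r -> 0 < sh ->
  exists2 K : R, 0 < K &
  forall (x h : 'rV[R]_n) (f G : 'rV[R]_n -> R) (M : R),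
  measurable_fun setT f -> measurable_fun setT G -> (forall y, 0 <= G y) ->
  (forall y, cube x r y -> `|f y| <= M) -> {for x, continuous f} ->
  line_bound (cube x r) f G -> cube h sh `<=` cube x r ->
  (((f x - average f h sh) ^+ 2)%:E <= K%:E * \sum_(j <oo)
    (q^-1 ^+ j * ((2 * (r / 2 ^+ j)) ^+ m)^-1)%:E *
    \int[@lebesgueN R n]_(y in cube x (r / 2 ^+ j)) (G y ^+ 2)%:E)%E.
Proof.
move=> q0 q1 r0 sh0.
pose K0 : R := n%:R ^+ 2 * (2 * r) ^+ (2 * n) / ((2 * sh) ^+ n) ^+ 2.
pose K1 : R := n%:R ^+ 2 * 4 ^+ n.
have q1' : 0 < 1 - q by lra.
have n0 : 0 < n%:R :> R by rewrite ltr0n.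
have K00 : 0 < K0.
  by rewrite /K0; positivity.
have K10 : 0 < K1 by rewrite /K1; positivity.
exists ((1 - q)^-1 * (K0 + q^-1 * K1)).
  by positivity.
move=> x h f G M mf mG G0 fM cf fG hx.
pose I j := (\int[@lebesgueN R n]_(y in cube x (r / 2 ^+ j)) (G y ^+ 2)%:E)%E.
pose t j := ((q^-1 ^+ j * ((2 * (r / 2 ^+ j)) ^+ m)^-1)%:E * I j)%E.
have r_gt0 j : 0 < r / 2 ^+ j by rewrite divr_gt0 ?exprn_gt0.
have I0 j : (0 <= I j)%E by apply: integral_ge0 => y _; rewrite lee_fin sqr_ge0.
have t0 j : (0 <= t j)%E.
  by rewrite mule_ge0// lee_fin; have rj := ltW (r_gt0 j); positivity.
have xx s : 0 <= s -> cube x s x by move=> s1 i; rewrite subrr normr0.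
have sub j : cube x (r / 2 ^+ j) `<=` cube x r.
  apply: cube_sub; apply: xx; rewrite subr_ge0 ler_pdivrMr ?exprn_gt0//.
  by rewrite ler_peMr ?(ltW r0)// exprn_ege1// ler1n.
have subS j : cube x (r / 2 ^+ j.+1) `<=` cube x (r / 2 ^+ j).
  apply: cube_sub; apply: xx; rewrite exprS; have := r_gt0 j.
  by rewrite invfM mulrCA; lra.
pose A j := average f x (r / 2 ^+ j).
set H := average f h sh.
pose a j := if j is j'.+1 then `|A j'.+1 - A j'| else `|A 0%N - H|.
have a2 j : (((a j.+1) ^+ 2)%:E <= (K1 * ((2 * (r / 2 ^+ j)) ^+ m)^-1)%:E * I j)%E.
  rewrite /a real_normK ?num_real//.
  have := @average_sub_sqr _ _ f G x x x (r / 2 ^+ j) (r / 2 ^+ j.+1) (r / 2 ^+ j) M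
    isT (r_gt0 _) (r_gt0 _) (r_gt0 _) mf mG G0
    (fun y xy => fM y (sub _ _ xy)) (@subS j) (fun y xy => xy) (fG x _ (r_gt0 _) (@sub _)).
  move/le_trans; apply; apply: lee_wpmul2r; first exact: I0.
  rewrite lee_fin /K1.
  have hS : r / 2 ^+ j.+1 = 2^-1 * (r / 2 ^+ j) by rewrite exprS invfM mulrCA.
  have := r_gt0 j; rewrite hS; set d := r / _ => d0.
  by rewrite (@poincare_half_const _ _ _ m) ?addn2// gt_eqF.
have a20 : (((a 0%N) ^+ 2)%:E <= K0%:E * t 0%N)%E.
  rewrite /a real_normK ?num_real//.
  have hx' : cube h sh `<=` cube x (r / 2 ^+ 0) by rewrite expr0 divr1.
  have := @average_sub_sqr _ _ f G x x h (r / 2 ^+ 0) (r / 2 ^+ 0) sh M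
    isT (r_gt0 _) (r_gt0 _) sh0 mf mG G0
    (fun y xy => fM y (sub _ _ xy)) (fun y xy => xy) hx' (fG x _ (r_gt0 _) (@sub _)).
  move/le_trans; apply; rewrite /t muleA; apply: lee_wpmul2r; first exact: I0.
  rewrite -EFinM lee_fin /K0 !expr0 !divr1 mul1r.
  rewrite (@poincare_full_const _ _ _ _ m) ?addn2//.
    by rewrite gt_eqF// mulr_gt0.
  by rewrite expf_neq0// gt_eqF// mulr_gt0.
set S := (\sum_(j <oo) _)%E.
have tS J : (\sum_(0 <= j < J) t j <= S)%E by exact: nneseries_lim_ge.
have tS0 : (t 0%N <= S)%E by rewrite (le_trans _ (tS 1%N))// big_nat1.
have S0 : (0 <= S)%E by rewrite (le_trans _ tS0).
have AJ J : `|A J - H| <= \sum_(j < J.+1) a j.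
  elim: J => [|J IH]; first by rewrite big_ord_recr big_ord0 /= add0r.
  rewrite big_ord_recr /= addrC (_ : A J.+1 - H = (A J.+1 - A J) + (A J - H)); last by ring.
  by rewrite (le_trans (ler_normD _ _))// lerD2l.
have a_ge0 j : 0 <= a j by case: j => [|j] /=; exact: normr_ge0.
have asum J : ((\sum_(j < J.+1) q^-1 ^+ j * a j ^+ 2)%:E <= (K0 + q^-1 * K1)%:E * S)%E.
  rewrite big_ord_recl expr0 mul1r EFinD EFinD ge0_muleDl ?lee_fin; last 2 first.
  - exact: ltW.
  - by positivity.
  apply: leeD.
    by rewrite (le_trans a20)// lee_wpmul2l// lee_fin ltW.
  apply: (@le_trans _ _ ((q^-1 * K1)%:E * \sum_(0 <= j < J) t j)%E); last first.
    by rewrite lee_wpmul2l// lee_fin; positivity.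
  rewrite ge0_sume_distrr// -sumEFin big_mkord; apply: lee_sum => j _.
  rewrite /t muleA -EFinM lift0 (exprS q^-1).
  apply: (@le_trans _ _ ((q^-1 * q^-1 ^+ j)%:E * (a j.+1 ^+ 2)%:E)%E).
    by rewrite -EFinM.
  apply: (le_trans (lee_wpmul2l _ (a2 j))); first by rewrite lee_fin; positivity.
  rewrite muleA -EFinM lee_wpmul2r// lee_fin le_eqVlt; apply/orP; left; apply/eqP.
  ring.
have bnd J : (((A J - H) ^+ 2)%:E <= ((1 - q)^-1 * (K0 + q^-1 * K1))%:E * S)%E.
  rewrite [X in (_ <= X * _)%E]EFinM -muleA.
  apply: (@le_trans _ _ (((1 - q)^-1)%:E * (\sum_(j < J.+1) q^-1 ^+ j * a j ^+ 2)%:E)%E); last first.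
    by rewrite lee_wpmul2l// lee_fin; positivity.
  rewrite -EFinM lee_fin; apply: le_trans (sum_sqr_geometric _ _ q0 q1).
  by rewrite -real_normK ?num_real// lerXn2r ?nnegrE ?sumr_ge0//.
have Acvg : (fun J => (A J - H) ^+ 2) @ \oo --> (f x - H) ^+ 2.
  have AA : A J @[J --> \oo] --> f x.
    apply: (average_cvg (s0 := r) (M := M)) => //.
      move=> j; rewrite r_gt0/= ler_pdivrMr ?exprn_gt0//.
      by rewrite ler_peMr ?(ltW r0)// exprn_ege1// ler1n.
    rewrite -[X in _ --> X](mulr0 r); apply: cvgMr.
    under eq_fun do rewrite -exprVn.
    by apply: cvg_expr; rewrite gtr0_norm ?invf_lt1// ?ltr1n.
  by apply: cvgM; apply: cvgB => //; exact: cvg_cst.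
case: (_ * S)%E bnd => [b| |] bnd; rewrite ?leey//; last by have := bnd 0%N.
rewrite lee_fin -(cvg_lim _ Acvg)//; apply: limr_le.
  by apply/cvg_ex; exists ((f x - H) ^+ 2).
by apply: nearW => J; have := bnd J; rewrite lee_fin.
Qed.

End trace_ineq.

(** * A weighted trace inequality *)

Section trace_inequality.
Context {R : realType}.
Variable m : nat.
Let n := m.+2.

(** The scaling behind the trace inequality: the factor [d ^+ m] of the Poincare
    inequality cancels against [d `^ (m%:R + kappa / 2)], a power of the mass of a cube,
    and the remaining power of [d] beats the weight [q^-1 ^+ j] because [q] was chosen
    as [2^-1 `^ (kappa / 4)]. *)
Lemma scale_sum_const (q w d r kappa : R) (j : nat) : 0 < r -> 0 < kappa ->
  q = 2^-1 `^ (kappa / 4) -> d = 2 * r / 2 ^+ j ->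
  q^-1 ^+ j * ((2 * d) ^+ m)^-1 * (w * (d `^ (m%:R + kappa / 2))) =
  w * (2^-1 ^+ m * (2 * r) `^ (kappa / 2)) * q ^+ j.
Proof.
move=> r0 k0 qE dE.
have d0 : 0 < d by rewrite dE divr_gt0 ?mulr_gt0 ?exprn_gt0.
have q0 : 0 < q by rewrite qE powR_gt0.
have -> : d `^ (m%:R + kappa / 2) = d ^+ m * d `^ (kappa / 2).
  rewrite powRD ?powR_mulrn ?(ltW d0)//.
  by rewrite (gt_eqF d0) implybT.
have -> : d `^ (kappa / 2) = (2 * r) `^ (kappa / 2) * (q ^+ j * q ^+ j).
  rewrite dE powRM ?mulr_ge0 ?(ltW r0)// ?invr_ge0 ?exprn_ge0//.
  congr (_ * _).
  have h2 : 0 <= 2^-1 :> R by rewrite invr_ge0.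
  rewrite -exprVn -(powR_mulrn j h2) -powRrM -exprD -(powR_mulrn (j + j) (ltW q0)) qE -powRrM.
  by congr powR; rewrite natrD; field.
rewrite exprMn !exprVn.
have : d ^+ m != 0 by rewrite expf_neq0// gt_eqF.
have : q ^+ j != 0 by rewrite expf_neq0// gt_eqF.
have : (2 : R) ^+ m != 0 by rewrite expf_neq0// pnatr_eq0.
move: (d ^+ m) (q ^+ j) (2 ^+ m) (_ `^ _) => D Q T P T0 Q0 D0.
by field; rewrite T0 D0 Q0.
Qed.

Lemma measurable_near_diag (r : R) :
  measurable [set z : 'rV[R]_n * 'rV[R]_n | cube z.1 r z.2].
Proof.
rewrite (_ : [set _ | _] = \bigcap_(i in [set: 'I_n])
    ((fun z : 'rV[R]_n * 'rV[R]_n => `|z.2 ord0 i - z.1 ord0 i|) @^-1` `]-oo, r]%classic)); last first.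
  apply/seteqP; split=> x /= h i; first by move=> _; rewrite /= in_itv /=; exact: h.
  by have := h i Logic.I; rewrite /= in_itv.
apply: fin_bigcap_measurable => [|i _]; first exact: finite_finset.
rewrite -[X in measurable X]setTI.
have mc : measurable_fun setT (fun z : 'rV[R]_n * 'rV[R]_n => `|z.2 ord0 i - z.1 ord0 i|).
  apply: measurableT_comp => //; apply: measurable_funB.
    by apply: (measurableT_comp (@measurable_rV_coord R n i)); exact: measurable_snd.
  by apply: (measurableT_comp (@measurable_rV_coord R n i)); exact: measurable_fst.
by apply: mc => //; exact: measurable_itv.
Qed.

Lemma cube_sym (x y : 'rV[R]_n) r : cube x r y -> cube y r x.
Proof. by move=> h i; rewrite distrC. Qed.

Local Open Scope ereal_scope.

Lemma ge0_integralZl_EFinT d (T : measurableType d) (mu : {measure set T -> \bar R})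
    (D : set T) (g : T -> R) (k : R) :
  measurable D -> measurable_fun setT g -> (forall x, 0 <= g x)%R -> (0 <= k)%R ->
  \int[mu]_(x in D) (k%:E * (g x)%:E) = k%:E * \int[mu]_(x in D) (g x)%:E.
Proof.
move=> mD mg g0 k0; apply: ge0_integralZl => //.
- by apply: measurable_funTS; exact/measurable_EFinP.
- by move=> x _; rewrite lee_fin.
Qed.

(** Tonelli on the strip of pairs at distance at most [r]: for fixed [y], the points [x]
    of [E] that see [y] lie in the cube of half-side [r] around [y], where [E] has mass
    at most [X]. *)
Lemma integral_near_diag (rho G : 'rV[R]_n -> R) (D E : set 'rV[R]_n) (r X : R) :
  measurable_fun setT rho -> measurable_fun setT G -> (forall x, 0 <= rho x)%R ->
  (forall x, 0 <= G x)%R -> measurable D -> measurable E -> (0 <= X)%R ->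
  (forall x, E x -> cube x r `<=` D) ->
  (forall y, \int[@lebesgueN R n]_(x in E `&` cube y r) (rho x)%:E <= X%:E) ->
  \int[@lebesgueN R n]_(x in E) ((rho x)%:E *
    \int[@lebesgueN R n]_(y in cube x r) (G y)%:E) <=
  X%:E * \int[@lebesgueN R n]_(y in D) (G y)%:E.
Proof.
move=> mrho mG rho0 G0 mD mE X0 ED EX.
pose C := [set z : 'rV[R]_n * 'rV[R]_n | cube z.1 r z.2].
have mC : measurable C by exact: measurable_near_diag.
pose K0 (z : 'rV[R]_n * 'rV[R]_n) := (rho z.1 * G z.2)%:E.
have mK0 : measurable_fun setT K0.
  apply/measurable_EFinP; apply: measurable_funM.
    by apply: (measurableT_comp mrho); exact: measurable_fst.
  by apply: (measurableT_comp mG); exact: measurable_snd.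
have K00 z : 0 <= K0 z by rewrite lee_fin mulr_ge0.
pose K := K0 \_ C.
have mK : measurable_fun setT K.
  by apply/(measurable_restrictT _ _).1 => //; exact: measurable_funTS.
have K_ge0 z : 0 <= K z by apply: erestrict_ge0 => y _; exact: K00.
have -> : \int[@lebesgueN R n]_(x in E) ((rho x)%:E *
    \int[@lebesgueN R n]_(y in cube x r) (G y)%:E) =
  \int[@lebesgueN R n]_(x in E) \int[@lebesgueN R n]_(y in D) K (x, y).
  apply: eq_integral => x; rewrite inE => Ex.
  rewrite -(@ge0_integralZl_EFinT _ _ _ (cube x r) G (rho x))//; last exact: measurable_cube.
  rewrite -[in LHS](setIidr (ED _ Ex)) integral_mkcondr.
  apply: eq_integral => y _; rewrite /K !patchE /K0/= EFinM.
  by congr (if _ then _ else _); apply/idP/idP; rewrite !inE.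
rewrite tonelli_sets//.
rewrite -(@ge0_integralZl_EFinT _ _ _ D G X)//.
apply: ge0_le_integral => //.
- by move=> y _; exact: integral_ge0.
- apply: measurable_funTS.
  apply: (@measurable_integral_snd _ _ _ _ _ (@lebesgueN R n) E (fun z => K (z.2, z.1))) => //.
  exact: (measurableT_comp mK (@measurable_swap _ _ _ _)).
- by apply: measurable_funTS; apply: measurable_funeM; exact/measurable_EFinP.
move=> y _.
have -> : \int[@lebesgueN R n]_(x in E) K (x, y) = (G y)%:E *
    \int[@lebesgueN R n]_(x in E `&` cube y r) (rho x)%:E.
  rewrite -(@ge0_integralZl_EFinT _ _ _ (E `&` cube y r) rho (G y))//; last first.
    by apply: measurableI => //; exact: measurable_cube.
  rewrite [RHS]integral_mkcondr.
  apply: eq_integral => x _; rewrite /K !patchE /K0/= muleC EFinM.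
  by congr (if _ then _ else _); apply/idP/idP; rewrite !inE; exact: cube_sym.
by rewrite muleC lee_wpmul2r// ?lee_fin//; exact: EX.
Qed.

(** This replaces the Sobolev inequality for the measure with density [rho]. Insert the
    pointwise bound [sqr_dist_average_le], integrate each term against [rho] by
    [integral_near_diag], and bound the mass of [E] in a cube of half-side [d] both by
    the mass of [E] and by [Lam * d `^ beta]. A geometric mean of the two keeps the
    positive power [mu `^ th] of the mass and still leaves a summable series, since
    [beta > m], where [m.+2] is the dimension. *)
Lemma trace_inequality (r sh beta Lam : R) :
  (0 < r)%R -> (0 < sh)%R -> (m%:R < beta)%R -> (0 < Lam)%R ->
  exists C th : R, [/\ (0 < C)%R, (0 < th)%R &
  forall (x0 h : 'rV[R]_n) (rho f G : 'rV[R]_n -> R) (M mu : R) (E : set 'rV[R]_n),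
  measurable_fun setT rho -> (forall x, 0 <= rho x)%R ->
  (forall y s, (0 < s)%R ->
    \int[@lebesgueN R n]_(x in cube y s) (rho x)%:E <= (Lam * s `^ beta)%:E) ->
  measurable_fun setT f -> measurable_fun setT G -> (forall y, 0 <= G y)%R ->
  (forall y, cube x0 (3 * r) y -> `|f y| <= M)%R ->
  (forall x, cube x0 r x -> {for x, continuous f}) ->
  line_bound (cube x0 (3 * r)) f G -> cube h sh `<=` cube x0 r ->
  measurable E -> E `<=` cube x0 r -> (0 <= mu)%R ->
  \int[@lebesgueN R n]_(x in E) (rho x)%:E <= mu%:E ->
  \int[@lebesgueN R n]_(x in E) (rho x * (f x - average f h sh) ^+ 2)%:E <=
  (C * mu `^ th)%:E * \int[@lebesgueN R n]_(y in cube x0 (3 * r)) (G y ^+ 2)%:E].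
Proof.
move=> r0 sh0 mbeta Lam0.
pose kappa := (beta - m%:R)%R; have k0 : (0 < kappa)%R by rewrite subr_gt0.
have beta0 : (0 < beta)%R by rewrite (le_lt_trans _ mbeta).
(* The exponent for which [beta * (1 - th) = m%:R + kappa / 2]. *)
pose th := (kappa / 2 / beta)%R.
have th0 : (0 < th)%R by rewrite !divr_gt0.
have th1 : (th < 1)%R.
  rewrite ltr_pdivrMr// mul1r /kappa.
  by have : (0 <= m%:R :> R)%R by []; lra.
pose q : R := (2^-1 `^ (kappa / 4))%R.
have q0 : (0 < q)%R by rewrite powR_gt0.
have q1 : (q < 1)%R.
  have <- : ((1 : R) `^ (kappa / 4) = 1)%R by rewrite powR1.
  rewrite /q gt0_ltr_powR ?divr_gt0// ?nnegrE//.
  by rewrite invf_lt1// ltr1n.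
have r20 : (0 < 2 * r)%R by rewrite mulr_gt0.
have [K K0 HK] := @sqr_dist_average_le R m q (2 * r)%R sh q0 q1 r20 sh0.
pose C1 := (Lam `^ (1 - th) * (2^-1 ^+ m * (2 * r) `^ (kappa / 2)))%R.
have C10 : (0 < C1)%R.
  by rewrite /C1 !mulr_gt0 ?powR_gt0 ?exprn_gt0 ?invr_gt0.
have q1' : (0 < 1 - q)%R by rewrite subr_gt0.
exists (K * C1 / (1 - q))%R, th; split=> //.
  by rewrite divr_gt0// mulr_gt0.
move=> x0 h rho f G M mu E mrho rho0 growth mf mG G0 fM cf fG hx mE Ex mu0 Emu.
set D := cube x0 (3 * r).
have mD : measurable D by exact: measurable_cube.
set GG := \int[_]_(y in D) _.
have GG0 : 0 <= GG by apply: integral_ge0 => y _; rewrite lee_fin sqr_ge0.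
pose rr j := (2 * r / 2 ^+ j)%R.
have rr0 j : (0 < rr j)%R by rewrite divr_gt0 ?exprn_gt0.
pose cc j := (q^-1 ^+ j * ((2 * rr j) ^+ m)^-1)%R.
have cc0 j : (0 <= cc j)%R.
  by rewrite /cc; have rj := ltW (rr0 j); positivity.
pose I j x := \int[@lebesgueN R n]_(y in cube x (rr j)) (G y ^+ 2)%:E.
have I0 j x : 0 <= I j x by apply: integral_ge0 => y _; rewrite lee_fin sqr_ge0.
have sub x : E x -> cube x (2 * r) `<=` D.
  move=> /Ex x0x; apply: cube_sub => i; apply: (le_trans (x0x i)); lra.
have mG2 : measurable_fun setT (fun y => G y ^+ 2)%R by exact: measurable_funX.
have mG2E : measurable_fun setT (fun y => (G y ^+ 2)%:E) by exact/measurable_EFinP.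
have mI j : measurable_fun setT (I j).
  have mdiag := @measurable_near_diag (rr j).
  rewrite (_ : I j = fun x => \int[@lebesgueN R n]_(y in setT)
    (((fun z : 'rV[R]_n * 'rV[R]_n => (G z.2 ^+ 2)%:E) \_ [set z | cube z.1 (rr j) z.2]) (x, y))).
    apply: (@measurable_integral_snd _ _ _ _ _ (@lebesgueN R n) setT) => //.
      apply/(measurable_restrictT _ _).1 => //; apply: measurable_funTS.
      by apply: (measurableT_comp mG2E); exact: measurable_snd.
    by move=> z; apply: erestrict_ge0 => y _; rewrite lee_fin sqr_ge0.
  apply/funext => x; rewrite /I [LHS]integral_mkcond; apply: eq_integral => y _.
  by rewrite !patchE; congr (if _ then _ else _); apply/idP/idP; rewrite !inE.
have mrhoE : measurable_fun setT (fun x => (rho x)%:E) by exact/measurable_EFinP.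
apply: (@le_trans _ _ (\int[@lebesgueN R n]_(x in E) (K%:E * \sum_(j <oo)
    ((cc j)%:E * ((rho x)%:E * I j x))))).
  apply: ge0_le_integral => //.
  - by move=> x _; rewrite lee_fin mulr_ge0// sqr_ge0.
  - apply: measurable_funTS; apply/measurable_EFinP; apply: measurable_funM => //.
    by apply: measurable_funX; exact: measurable_funB.
  - apply: measurable_funTS; apply: measurable_funeM.
    apply: ge0_emeasurable_sum => //.
      by move=> j x _ _; rewrite !mule_ge0// lee_fin.
    by move=> j _; apply: measurable_funeM; apply: emeasurable_funM.
  move=> x xE; rewrite EFinM.
  have -> : \sum_(j <oo) ((cc j)%:E * ((rho x)%:E * I j x)) =
     (rho x)%:E * \sum_(j <oo) ((cc j)%:E * I j x).
    rewrite -nneseriesZl//; last by move=> j _; rewrite mule_ge0// lee_fin.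
    by apply: eq_eseriesr => j _; rewrite muleCA.
  rewrite muleCA; apply: lee_wpmul2l; first by rewrite lee_fin.
  apply: HK => //.
  - by move=> y /(sub _ xE); exact: fM.
  - by apply: cf; exact: Ex.
  - by move=> c s s0 cs; apply: fG => // y /cs/(sub _ xE).
  - apply: (subset_trans hx) => y x0y i.
    have := x0y i; have := Ex _ xE i => h1 h2.
    by have := ler_distD (x0 ord0 i) (y ord0 i) (x ord0 i); rewrite (distrC (x0 _ _)); lra.
have nn j x : 0 <= (cc j)%:E * ((rho x)%:E * I j x).
  by rewrite !mule_ge0// lee_fin.
have mnn j : measurable_fun E (fun x => (cc j)%:E * ((rho x)%:E * I j x)).
  by apply: measurable_funTS; apply: measurable_funeM; apply: emeasurable_funM.
rewrite ge0_integralZl//; last 3 first.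
- apply: ge0_emeasurable_sum => //.
- by move=> x _; apply: nneseries_ge0 => j _ _.
- by rewrite lee_fin ltW.
rewrite integral_nneseries//.
rewrite (_ : K * C1 / (1 - q) * mu `^ th = K * ((C1 * mu `^ th) / (1 - q)))%R; last by field; rewrite gt_eqF.
rewrite EFinM -muleA; apply: lee_wpmul2l; first by rewrite lee_fin ltW.
apply: lime_le.
  by apply: is_cvg_nneseries => j _ _; apply: integral_ge0 => x _; exact: nn.
apply: nearW => J.
apply: (@le_trans _ _ (\sum_(0 <= j < J) ((C1 * mu `^ th * q ^+ j)%:E * GG))).
  apply: lee_sum => j _.
  have X0 : (0 <= mu `^ th * (Lam * rr j `^ beta) `^ (1 - th))%R by rewrite mulr_ge0 ?powR_ge0.
  have := @integral_near_diag rho (fun y => G y ^+ 2)%R D E (rr j) _ mrho mG2 rho0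
    (fun x => sqr_ge0 _) mD mE X0.
  move=> H; rewrite ge0_integralZl//; last 3 first.
  - by apply: measurable_funTS; apply: emeasurable_funM.
  - by move=> x _; rewrite mule_ge0// lee_fin.
  - by rewrite lee_fin.
  apply: (@le_trans _ _ ((cc j)%:E * ((mu `^ th * (Lam * rr j `^ beta) `^ (1 - th))%:E * GG))).
    apply: lee_wpmul2l; first by rewrite lee_fin.
    apply: H.
      move=> x Ex'; apply: subset_trans (sub _ Ex'); apply: cube_sub => i.
      rewrite subrr normr0 subr_ge0 /rr ler_pdivrMr ?exprn_gt0//.
      by rewrite ler_peMr ?(ltW r20)// exprn_ege1// ler1n.
    move=> y.
    have mc := @measurable_cube R n y (rr j).
    have mEc : measurable (E `&` cube y (rr j)) by exact: measurableI.
    have h1 : \int[@lebesgueN R n]_(x in E `&` cube y (rr j)) (rho x)%:E <= mu%:E.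
      apply: le_trans Emu; apply: ge0_subset_integral => //.
      - exact: measurable_funTS.
      - by move=> x _; rewrite lee_fin.
    have h2 : \int[@lebesgueN R n]_(x in E `&` cube y (rr j)) (rho x)%:E <= (Lam * rr j `^ beta)%:E.
      apply: le_trans (growth y _ (rr0 j)); apply: ge0_subset_integral => //.
      - exact: measurable_funTS.
      - by move=> x _; rewrite lee_fin.
    have h0 : 0 <= \int[@lebesgueN R n]_(x in E `&` cube y (rr j)) (rho x)%:E.
      by apply: integral_ge0 => x _; rewrite lee_fin.
    move: h0 h1 h2; case: (integral _ _ _) => [t| |] //; rewrite !lee_fin => t0 t1 t2.
    exact: geometric_mean_le.
  rewrite muleA -EFinM; apply: lee_wpmul2r => //; rewrite lee_fin /C1.
  rewrite powRM ?powR_ge0 ?(ltW Lam0)// -powRrM.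
  have -> : (beta * (1 - th) = m%:R + kappa / 2)%R.
    by rewrite /th /kappa; field; rewrite gt_eqF.
  have := @scale_sum_const q (Lam `^ (1 - th))%R (rr j) r kappa j r0 k0 erefl erefl.
  rewrite -/(cc j) => e.
  rewrite (_ : cc j * _ = mu `^ th * (cc j * (Lam `^ (1 - th) * rr j `^ (m%:R + kappa / 2))))%R; last by ring.
  by rewrite e le_eqVlt; apply/orP; left; apply/eqP; ring.
rewrite -ge0_sume_distrl; last first.
  by move=> j _; rewrite lee_fin !mulr_ge0 ?exprn_ge0 ?powR_ge0 ?(ltW C10) ?(ltW q0).
apply: lee_wpmul2r => //; rewrite sumEFin lee_fin -mulr_sumr.
apply: ler_wpM2l; first by rewrite mulr_ge0 ?powR_ge0// ltW.
have qn : (`|q| < 1)%R by rewrite gtr0_norm.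
have := @geometric_le_lim R J 1%R q ler01 q0 qn.
rewrite mul1r; apply: le_trans; rewrite /series /= le_eqVlt; apply/orP; left; apply/eqP.
by apply: eq_bigr => j _; rewrite /geometric /= mul1r.
Qed.

End trace_inequality.

(** * Functions with a continuous gradient *)

Section calculus.
Context {R : realType} {n : nat}.
Local Notation V := 'rV[R]_n.
Implicit Types (A : set V) (f h : V -> R) (g : 'I_n -> V -> R) (i : 'I_n).
Local Notation leb := (@lebesgue_measure R).
Local Notation e_ i := (delta_mx ord0 i : V).

(** Continuous differentiability with a named gradient [g]: products, compositions and
    quotients then have explicit gradients, and the pair can be extended by zero or
    restricted without computing derivatives again. *)
Definition C1with A f g := forall x, A x -> forall i,
  is_derive x (e_ i) f (g i x) /\ {for x, continuous (g i)}.

Lemma C1with_partial A f : C1_on A f -> C1with A f (fun i => partial i f).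
Proof. by move=> fA x Ax i; have [d c] := fA _ Ax i; split=> //; exact: DeriveDef. Qed.

Lemma partialE A f g x i : C1with A f g -> A x -> partial i f x = g i x.
Proof. by move=> /(_ x) fA Ax; have [? _] := fA Ax i; exact: derive_val. Qed.

Lemma C1with_sub A B f g : B `<=` A -> C1with A f g -> C1with B f g.
Proof. by move=> BA fA x /BA Ax i; exact: fA. Qed.

(** Directional derivatives are derivatives at 0 of one-variable functions, which brings
    the one-variable chain rule and mean value theorem to bear. *)
Lemma is_derive_lineE f x v d :
  is_derive x v f d <-> is_derive (0 : R) 1 (fun t : R => f (t *: v + x)) d.
Proof.
have E : (fun h : R => h^-1 *: ((fun t : R => f (t *: v + x)) (h *: 1 + 0) -
    f (0 *: v + x))) = (fun h : R => h^-1 *: (f (h *: v + x) - f x)).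
  by apply/funext => h; rewrite scale0r add0r addr0 /GRing.scale/= mulr1.
split=> -[d1 d2]; split.
- by rewrite /derivable E.
- by rewrite -d2 /derive E.
- by move: d1; rewrite /derivable E.
- by rewrite -d2 /derive E.
Qed.

Lemma is_derive_comp f x v d (F : R -> R) (D : R) :
  is_derive x v f d -> is_derive (f x) 1 F D -> is_derive x v (F \o f) (D * d).
Proof.
move=> /is_derive_lineE fd FD; apply/is_derive_lineE.
have FD' : is_derive (f (0 *: v + x)) 1 F D by rewrite scale0r add0r.
exact: (@is_derive1_comp _ F (fun t : R => f (t *: v + x)) 0 D d FD' fd).
Qed.

Lemma set_coord_add (x : V) i (t h : R) :
  set_coord x i (h + t) = h *: e_ i + set_coord x i t.
Proof. by apply/rowP => j; rewrite !mxE eqxx; case: eqP => _ /=; ring. Qed.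

Lemma set_coord_id (x : V) i : set_coord x i (x ord0 i) = x.
Proof. by apply/rowP => j; rewrite !mxE; case: eqP => // ->. Qed.

Lemma is_derive_set_coord f x i t d : is_derive (set_coord x i t) (e_ i) f d ->
  is_derive t 1 (fun s => f (set_coord x i s)) d.
Proof.
have E : (fun h : R => h^-1 *: (f (set_coord x i (h *: 1 + t)) - f (set_coord x i t))) =
   (fun h : R => h^-1 *: (f (h *: e_ i + set_coord x i t) - f (set_coord x i t))).
  by apply/funext => h; rewrite set_coord_add /GRing.scale/= mulr1.
move=> [d1 d2]; split; first by rewrite /derivable E.
by rewrite -d2 /derive E.
Qed.

Lemma continuous_set_coord (x : V) i : continuous (set_coord x i).
Proof.
move=> t; apply/cvg_ballP => e e0; near=> s.
split => // j k; rewrite !mxE; case: eqP => _; last exact: ballxx.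
by near: s; exact: (nbhsx_ballx t e e0).
Unshelve. all: end_near. Qed.

Lemma cube_set_coord (c x : V) s i t : cube c s x -> `|t - c ord0 i| <= s ->
  cube c s (set_coord x i t).
Proof. by move=> xc tc j; rewrite mxE; case: eqP => [->|]. Qed.

Lemma mvt_set_coord A f g c s x i (t t' M : R) : C1with A f g -> cube c s `<=` A ->
  cube c s x -> `|t - c ord0 i| <= s -> `|t' - c ord0 i| <= s ->
  (forall y, cube c s y -> `|g i y| <= M) ->
  `|f (set_coord x i t) - f (set_coord x i t')| <= M * `|t - t'|.
Proof.
move=> fA cA cx; wlog tt' : t t' / t' <= t.
  move=> H; case: (leP t' t) => [|/ltW] tt' ht ht' gM; first exact: H.
  by rewrite distrC (distrC t); exact: H.
move=> ht ht' gM; set phi := fun r => f (set_coord x i r).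
have inI r : r \in `[t', t]%R -> cube c s (set_coord x i r).
  rewrite in_itv/= => /andP[r1 r2]; apply: cube_set_coord => //.
  by move: ht ht'; rewrite !ler_distl; lra.
have der r : r \in `[t', t]%R -> is_derive r 1 phi (g i (set_coord x i r)).
  by move=> /inI/cA Ar; apply: is_derive_set_coord; have [] := fA _ Ar i.
have [r rI ->] := @MVT_segment R phi (fun r => g i (set_coord x i r)) t' t tt'
  (fun r rI => der r (subset_itv_oo_cc rI))
  (derivable_within_continuous (fun r rI => @ex_derive _ _ _ _ _ _ _ (der r rI))).
by rewrite normrM ler_wpM2r//; exact: gM (inI _ rI).
Qed.

(** Continuous partial derivatives are bounded near [x], so changing the coordinates of
    [x] into those of [y] one after the other changes [f] by at most a constant times
    the distance. *)
Lemma C1with_continuous A f g x : open A -> C1with A f g -> A x ->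
  {for x, continuous f}.
Proof.
move=> oA fA Ax.
have [d0 d00 dA] : exists2 d, 0 < d & cube x d `<=` A.
  by apply: nbhs_cube; exact: open_nbhs_nbhs.
pose M := 1 + \sum_i `|g i x|.
have M0 : 0 < M by rewrite ltr_pwDl// sumr_ge0.
have : nbhs x [set y | forall i, `|g i y| <= M].
  apply: (@filter_forall _ _ (fun i => [set y | `|g i y| <= M]) _ (nbhs_filter x)) => i.
  have [_ /cvgrPdist_le/(_ _ ltr01)] := fA _ Ax i.
  apply: filterS => y yx /=.
  have -> : g i y = g i x - (g i x - g i y) by ring.
  rewrite (le_trans (ler_normB _ _))// addrC lerD//.
  by rewrite (bigD1 i)//= lerDl sumr_ge0.
move=> /nbhs_cube[d1 d10 dM].
apply/(@cvgrPdist_le _ _ _ (nbhs x) (nbhs_filter x)) => e e0.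
pose d := Num.min (Num.min d0 d1) (e / (n.+1%:R * M)).
have d_gt0 : 0 < d by rewrite !lt_min d00 d10 divr_gt0// mulr_gt0.
have dA' : cube x d `<=` A.
  move=> y xy; apply: dA => i; apply: (le_trans (xy i)).
  by rewrite /d !ge_min lexx.
have dM' y i : cube x d y -> `|g i y| <= M.
  move=> xy; apply: dM => j; apply: (le_trans (xy j)).
  by rewrite /d !ge_min lexx orbT.
have key y : cube x d y -> `|f x - f y| <= e.
  move=> xy; pose p k : V := \row_j (if (j < k)%N then y ord0 j else x ord0 j).
  have cp k : cube x d (p k).
    move=> j; rewrite mxE; case: ifP => _; first exact: xy.
    by rewrite subrr normr0 ltW.
  have step k : (k <= n)%N -> `|f (p k) - f x| <= k%:R * (M * d).
    elim: k => [|k IH] kn.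
      rewrite (_ : p 0%N = x) ?subrr ?normr0 ?mul0r//.
      by apply/rowP => j; rewrite mxE ltn0.
    pose i := Ordinal kn.
    have pk1 : p k.+1 = set_coord (p k) i (y ord0 i).
      apply/rowP => j; rewrite !mxE ltnS leq_eqVlt -(inj_eq val_inj) /=.
      by case: eqP => [e1|_] //=; congr (y _ _); apply: val_inj.
    have pk : p k = set_coord (p k) i (p k ord0 i) by rewrite set_coord_id.
    rewrite (_ : f _ - f x = (f (p k.+1) - f (p k)) + (f (p k) - f x)); last by ring.
    rewrite (le_trans (ler_normD _ _))// -natr1 mulrDl mul1r addrC lerD//; first exact/IH/ltnW.
    rewrite pk1 [in X in _ - f X]pk.
    apply: (le_trans (mvt_set_coord fA dA' (cp k) (xy i) (cp k i) (fun y => dM' y i))).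
    have -> : p k ord0 i = x ord0 i by rewrite mxE /= ltnn.
    by apply: ler_wpM2l; [exact: ltW|exact: xy].
  have := step n (leqnn n).
  rewrite (_ : p n = y); last by apply/rowP => j; rewrite mxE ltn_ord.
  rewrite distrC => /le_trans; apply.
  apply: (@le_trans _ _ (n.+1%:R * (M * d))).
    by apply: ler_wpM2r; [apply: mulr_ge0; exact: ltW|rewrite ler_nat].
  by rewrite mulrA mulrC -ler_pdivlMr ?mulr_gt0// /d ge_min lexx orbT.
apply/nbhs_ballP; exists d => //= y xy; apply: key => i.
have [_ /(_ ord0 i)] := xy.
by rewrite /ball /= distrC => /ltW.
Qed.

End calculus.

(** * Calculus of continuously differentiable functions *)

Section cube_topology.
Context {R : realType} {N : nat}.
Local Notation V := 'rV[R]_N.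

Lemma closed_cube (c : V) s : closed (cube c s).
Proof.
rewrite (_ : cube c s = \bigcap_(i in [set: 'I_N]) [set x : V | `|x ord0 i - c ord0 i| <= s]).
  apply: closed_bigI => i _.
  apply: (@closed_comp _ _ (fun x : V => `|x ord0 i - c ord0 i|) [set t | t <= s]); last exact: closed_le.
  move=> x _; apply: (@continuous_comp _ _ _ (fun x : V => x ord0 i - c ord0 i) (fun t : R => `|t|));
    last exact: norm_continuous.
  apply: (@continuousB _ _ _ (fun x : V => x ord0 i) (cst (c ord0 i))); last exact: cst_continuous.
  exact: coord_continuous.
by apply/seteqP; split => [x h i _|x h i]; [exact: h|exact: (h i)].
Qed.

Lemma compact_cube (c : V) s : compact (cube c s).
Proof.
rewrite (_ : cube c s = [set v | forall i, `[c ord0 i - s, c ord0 i + s]%classic (v ord0 i)]).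
  apply: (@rV_compact R N (fun i => `[c ord0 i - s, c ord0 i + s]%classic)) => i.
  exact: segment_compact.
by apply/seteqP; split => v h i; have := h i; rewrite /= in_itv/= ler_distl.
Qed.

Lemma bounded_in_cube (f : V -> R) c s : (forall x, cube c s x -> {for x, continuous f}) ->
  exists2 M : R, 0 <= M & forall x, cube c s x -> `|f x| <= M.
Proof.
move=> cf; have [C0|C0] := pselect (cube c s !=set0); last first.
  by exists 0 => // x xc; exfalso; apply: C0; exists x.
have cn : {within cube c s, continuous (fun x => `|f x|)}.
  apply: continuous_in_subspaceT => x; rewrite inE => xc.
  apply: (@continuous_comp _ _ _ f (fun t : R => `|t|)); first exact: cf.
  exact: norm_continuous.
have [m mc mm] := compact_EVT_max C0 (@compact_cube c s) cn.
by exists `|f m| => // x xc; apply: mm; rewrite inE.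
Qed.

End cube_topology.

Section calculus2.
Context {R : realType} {n : nat}.
Local Notation V := 'rV[R]_n.
Implicit Types (A : set V) (f h : V -> R) (g : 'I_n -> V -> R) (i : 'I_n).
Local Notation leb := (@lebesgue_measure R).
Local Notation e_ i := (delta_mx ord0 i : V).

Lemma C1withM A f1 g1 f2 g2 : open A -> C1with A f1 g1 -> C1with A f2 g2 ->
  C1with A (fun x => f1 x * f2 x) (fun i x => f1 x * g2 i x + f2 x * g1 i x).
Proof.
move=> oA f1A f2A x Ax i.
have [d1 c1] := f1A _ Ax i; have [d2 c2] := f2A _ Ax i.
have cf1 := C1with_continuous oA f1A Ax; have cf2 := C1with_continuous oA f2A Ax.
split; first exact: (is_deriveM d1 d2).
by apply: continuousD; apply: continuousM.
Qed.

Lemma C1withB A f1 g1 f2 g2 : C1with A f1 g1 -> C1with A f2 g2 ->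
  C1with A (fun x => f1 x - f2 x) (fun i x => g1 i x - g2 i x).
Proof.
move=> f1A f2A x Ax i.
have [d1 c1] := f1A _ Ax i; have [d2 c2] := f2A _ Ax i.
split; first exact: (is_deriveB d1 d2).
exact: continuousB.
Qed.

Lemma C1with_comp A f g (F F' : R -> R) : open A -> C1with A f g ->
  (forall x, A x -> is_derive (f x) 1 F (F' (f x)) /\ {for f x, continuous F'}) ->
  C1with A (fun x => F (f x)) (fun i x => F' (f x) * g i x).
Proof.
move=> oA fA FA x Ax i.
have [d1 c1] := fA _ Ax i; have [dF cF] := FA _ Ax.
split; first exact: (is_derive_comp d1 dF).
apply: continuousM => //; apply: continuous_comp => //.
exact: C1with_continuous fA Ax.
Qed.

(** Off the closed set [K] the function is locally 0, and at the points of [K] it is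
    differentiable because [A] is a neighbourhood of them. *)
Lemma C1with_glue A (K : set V) f g : open A -> closed K -> K `<=` A ->
  C1with A f g -> (forall x, ~ K x -> f x = 0) -> (forall x i, ~ K x -> g i x = 0) ->
  C1with setT f g.
Proof.
move=> oA cK KA fA f0 g0 x _ i.
have [/KA Ax|nKx] := pselect (K x); first exact: fA.
have nK : \forall y \near x, ~ K y.
  by apply: open_nbhs_nbhs; split => //; exact: closed_openC.
rewrite g0//; split.
  have h := is_derive_cst (0 : R) x (e_ i); apply: (near_eq_is_derive _ h).
  by apply: filterS nK => y /f0 ->.
rewrite /prop_for /continuous_at g0//.
apply: (@cvg_near_cst _ _ _ _ (nbhs x)).
by apply: filterS nK => y /(g0 _ i) ->.
Qed.

Lemma continuous_measurable_rV A f : open A -> (forall x, A x -> {for x, continuous f}) ->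
  measurable_fun A f.
Proof.
move=> oA cf; have mA := open_rV_measurable oA.
apply: (measurability _ (RGenOInfty.measurableE R)).
move=> _ [_ [a ->] <-]; apply: open_rV_measurable.
rewrite openE => x [Ax]; rewrite /= in_itv/= andbT => ax.
apply: filterI; first exact: open_nbhs_nbhs.
have := cf x Ax; move=> /(_ `]a, +oo[%classic); apply.
by apply: open_nbhs_nbhs; split; [exact: interval_open|rewrite /= in_itv/= ax].
Qed.

(** The fundamental theorem of calculus along the segment that moves the coordinate
    [i]. *)
Lemma line_bound_cube A f g (G : V -> R) (c : V) s i x t t' :
  C1with A f g -> cube c s `<=` A -> measurable_fun setT G ->
  (forall y, cube c s y -> `|g i y| <= G y) ->
  cube c s x -> `|t - c ord0 i| <= s -> `|t' - c ord0 i| <= s ->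
  (`|f (set_coord x i t) - f (set_coord x i t')|%:E <=
      \int[leb]_(r in `[(c ord0 i - s)%R, (c ord0 i + s)%R]%classic)
      (G (set_coord x i r))%:E)%E.
Proof.
move=> fA cA mG gG cx; wlog tt' : t t' / t' < t.
  move=> H ht ht'; case: (ltgtP t' t) => tt'; first exact: H.
    by rewrite distrC; exact: H.
  rewrite tt' subrr normr0; apply: integral_ge0 => r rI; rewrite lee_fin.
  rewrite (le_trans _ (gG _ _))//; apply: cube_set_coord => //.
  by move: rI; rewrite /= in_itv/= ler_distl.
move=> ht ht'; set phi := fun r => f (set_coord x i r).
pose phi' r := g i (set_coord x i r).
have inI r : r \in `[t', t]%R -> cube c s (set_coord x i r).
  rewrite in_itv/= => /andP[r1 r2]; apply: cube_set_coord => //.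
  by move: ht ht'; rewrite !ler_distl; lra.
have der r : r \in `[t', t]%R -> is_derive r 1 phi (phi' r).
  by move=> /inI/cA Ar; apply: is_derive_set_coord; have [] := fA _ Ar i.
have cphi r : r \in `[t', t]%R -> {for r, continuous phi}.
  move=> rI; apply/differentiable_continuous/derivable1_diffP.
  by have [] := der r rI.
have cphi' : {within `[t', t], continuous phi'}.
  apply: continuous_in_subspaceT => r; rewrite inE => rI.
  have [_ cg] := fA _ (cA _ (inI _ rI)) i.
  by apply: (cvg_comp _ _ (@continuous_set_coord _ _ x i r)); exact: cg.
have mset : measurable_fun setT (fun r => set_coord x i r).
  apply/measurable_to_rVP => j.
  rewrite (_ : _ \o _ = if j == i then id else cst (x ord0 j)).
    by case: eqP => _; [exact: measurable_id|exact: measurable_cst].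
  by apply/funext => r; rewrite /= /rV_coord mxE; case: eqP.
have mphi' : measurable_fun `[t', t] phi'.
  by apply: subspace_continuous_measurable_fun => //; exact: measurable_itv.
have FTC : (\int[leb]_(r in `[t', t]) (phi' r)%:E = (phi t)%:E - (phi t')%:E)%E.
  apply: continuous_FTC2 => //.
  - split.
    + by move=> r /subset_itv_oo_cc rI; have [] := der r rI.
    + apply: cvg_at_right_filter; apply: cphi; by rewrite in_itv/= lexx ltW.
    + apply: cvg_at_left_filter; apply: cphi; by rewrite in_itv/= lexx ltW.
  - by move=> r /subset_itv_oo_cc rI; rewrite derive1E; have := der r rI => ?; exact: derive_val.
rewrite -EFinB in FTC.
have -> : (`|phi t - phi t'|%:E = `|\int[leb]_(r in `[t', t]) (phi' r)%:E|)%E by rewrite FTC.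
have mI := @measurable_itv R `[t', t].
apply: (le_trans (le_abse_integral _ _ _)) => //; first exact/measurable_EFinP.
apply: (@le_trans _ _ (\int[leb]_(r in `[t', t]) (G (set_coord x i r))%:E)%E).
  apply: ge0_le_integral => //.
  - by apply: measurableT_comp => //; exact/measurable_EFinP.
  - by apply: measurable_funTS; apply/measurable_EFinP; exact: measurableT_comp.
  - by move=> r rI; rewrite /= lee_fin; apply: gG; exact: inI.
apply: ge0_subset_integral => //.
- by apply: measurable_funTS; apply/measurable_EFinP; exact: measurableT_comp.
- move=> r rI; rewrite lee_fin (le_trans _ (gG _ _))//; apply: cube_set_coord => //.
  by move: rI; rewrite /= in_itv/= ler_distl.
- move=> r /=; rewrite !in_itv/= => /andP[r1 r2].
  by move: ht ht'; rewrite !ler_distl; lra.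
Qed.

End calculus2.

(** * Smooth functions of product form *)

Section smooth1.
Context {R : realType}.
Implicit Types f g : R -> R.

(** [k]-fold differentiability with the derivatives given by existence, so that closure
    under sums and products is a plain induction on [k]. *)
Fixpoint diffn (k : nat) f : Prop :=
  if k is k'.+1 then
    exists f' : R -> R, (forall x : R, is_derive x 1 f (f' x)) /\ diffn k' f'
  else True.

Definition smooth1 f := forall k, diffn k f.

Lemma smooth1_derive f : smooth1 f ->
  exists f', (forall x : R, is_derive x 1 f (f' x)) /\ smooth1 f'.
Proof.
move=> sf; have [f' [df _]] := sf 1%N; exists f'; split => // k.
have [f'' [df'' sf'']] := sf k.+1.
rewrite (_ : f' = f'')//; apply/funext => x.
by have [_ <-] := df x; have [_ <-] := df'' x.
Qed.

Lemma smooth1_continuous f : smooth1 f -> continuous f.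
Proof.
move=> sf x; have [f' [df _]] := sf 1%N.
by apply/differentiable_continuous/derivable1_diffP; have [] := df x.
Qed.

Lemma smooth1_cst c : smooth1 (fun=> c).
Proof.
move=> k; elim: k c => //= k IH c; exists (fun=> 0); split => // x.
exact: is_derive_cst.
Qed.

Lemma diffnS k f : diffn k.+1 f -> diffn k f.
Proof. by elim: k f => //= k IH f [f' [df /IH sf]]; exists f'. Qed.

Lemma diffnD k f g : diffn k f -> diffn k g -> diffn k (fun x => f x + g x).
Proof.
elim: k f g => //= k IH f g [f' [df sf]] [g' [dg sg]].
exists (fun x => f' x + g' x); split; last exact: IH.
by move=> x; exact: is_deriveD.
Qed.

Lemma diffnM k f g : diffn k f -> diffn k g -> diffn k (fun x => f x * g x).
Proof.
elim: k f g => //= k IH f g [f' [df sf]] [g' [dg sg]].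
exists (fun x => f x * g' x + g x * f' x); split; last first.
  by apply: diffnD; apply: IH => //; apply: diffnS => /=; [exists f'|exists g'].
by move=> x; exact: is_deriveM.
Qed.

Lemma smooth1D f g : smooth1 f -> smooth1 g -> smooth1 (fun x => f x + g x).
Proof. by move=> sf sg k; exact: diffnD. Qed.

Lemma smooth1M f g : smooth1 f -> smooth1 g -> smooth1 (fun x => f x * g x).
Proof. by move=> sf sg k; exact: diffnM. Qed.

Lemma is_derive_affine (a b x : R) : is_derive x 1 (fun t : R => a * t + b) a.
Proof.
have h := is_deriveD (is_deriveZ a (is_derive_id x (1 : R))) (is_derive_cst b x (1 : R)).
by move: h; rewrite addr0 /GRing.scale /= mulr1.
Qed.

Lemma smooth1_affine f (a b : R) : smooth1 f -> smooth1 (fun x => f (a * x + b)).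
Proof.
move=> sf k; elim: k f sf => //= k IH f sf.
have [f' [df sf']] := smooth1_derive sf.
exists (fun x => f' (a * x + b) * a); split; last first.
  by apply: diffnM; [exact: IH|exact: smooth1_cst].
move=> x; have h := is_derive_affine a b x.
exact: (@is_derive1_comp _ f _ x _ _ (df (a * x + b)) h).
Qed.

Lemma smooth1_id : smooth1 id.
Proof.
move=> [|k] //=; exists (fun=> 1); split; last exact: smooth1_cst.
by move=> x; exact: is_derive_id.
Qed.

(** The functions [P (1/t) exp (-1/t)] extended by 0 form a class that is stable under
    differentiation, which makes them smooth at 0 in one stroke. *)
Definition flat_exp (P : {poly R}) (t : R) : R :=
  if 0 < t then P.[t^-1] * expR (- t^-1) else 0.

Lemma expR_ge_pow (y : R) k : 0 <= y -> y ^+ k <= k`!%:R * expR y.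
Proof.
move=> y0; have k0 : 0 < k`!%:R :> R by rewrite ltr0n fact_gt0.
rewrite mulrC -ler_pdivrMr//; case: k k0 => [|k] k0.
  by rewrite expr0 divr1 -expR0 ler_expR.
by apply: le_trans (expR_ge1Dxn k y0); rewrite lerDr.
Qed.

Lemma poly_bound (P : {poly R}) : exists C : R, 0 <= C /\
  forall y, 1 <= y -> `|P.[y]| <= C * y ^+ size P.
Proof.
exists (\sum_(i < size P) `|P`_i|); split; first by rewrite sumr_ge0.
move=> y y1; rewrite horner_coef (le_trans (ler_norm_sum _ _ _))//.
rewrite mulr_suml; apply: ler_sum => i _; rewrite normrM ler_wpM2l//.
rewrite ger0_norm ?exprn_ge0 ?(le_trans ler01 y1)//.
by rewrite ler_weXn2l// ltnW.
Qed.

Lemma flat_exp_bound (P : {poly R}) : exists C : R, 0 <= C /\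
  forall t, `|t| <= 1 -> `|flat_exp P t| <= C * `|t| ^+ 2.
Proof.
have [C [C0 PC]] := poly_bound P.
pose k := (size P + 2)%N.
exists (C * k`!%:R); split; first by rewrite mulr_ge0.
move=> t t1; rewrite /flat_exp; case: ifPn => t0; last first.
  by rewrite normr0 !mulr_ge0// exprn_ge0.
rewrite (gtr0_norm t0) in t1 *.
have y1 : 1 <= t^-1 by rewrite invf_ge1.
rewrite normrM [X in _ * X]gtr0_norm ?expR_gt0//.
apply: (@le_trans _ _ (C * (t^-1) ^+ size P * expR (- t^-1))).
  by rewrite ler_wpM2r ?expR_ge0 ?PC.
have := @expR_ge_pow t^-1 k (le_trans ler01 y1).
rewrite -ler_pdivrMr ?expR_gt0// -expRN => h.
rewrite -!mulrA ler_wpM2l//.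
have -> : (t^-1) ^+ size P = t^-1 ^+ k * t ^+ 2.
  by rewrite exprD -mulrA -exprMn mulVf ?expr1n ?mulr1// gt_eqF.
by rewrite mulrAC ler_wpM2r ?exprn_ge0// ltW.
Qed.

(** At 0 the difference quotient tends to 0 because [flat_exp P] is quadratically small,
    the exponential beating every power of [1/t]. *)
Lemma flat_exp_derive (P : {poly R}) (x : R) :
  is_derive x 1 (flat_exp P) (flat_exp ('X ^+ 2 * (P - P^`())) x).
Proof.
have [x0|x0|x0] := ltgtP x 0.
- rewrite {2}/flat_exp ltNge (ltW x0) /=.
  have h := is_derive_cst (0 : R) x (1 : R); apply: (near_eq_is_derive _ h).
  near=> t; rewrite /flat_exp ltNge ltW//.
  by near: t; exact: lt_nbhsl.
- rewrite {2}/flat_exp x0.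
  have xn : x != 0 by rewrite gt_eqF.
  have hV : is_derive x 1 (fun t : R => t^-1) (- x ^- 2).
    have := @is_deriveV R id x 1 1 xn (is_derive_id x 1).
    by rewrite /GRing.scale /= mulr1.
  have hP := @is_derive1_comp _ (horner P) _ x _ _ (is_derive_poly P x^-1) hV.
  have hN := is_deriveN hV.
  have hE := @is_derive1_comp _ expR _ x _ _ (is_derive_expR (- x^-1)) hN.
  have hM := is_deriveM hP hE.
  apply: (near_eq_is_derive (f := fun t : R => P.[t^-1] * expR (- t^-1))).
    near=> t; rewrite /flat_exp ifT//.
    by near: t; exact: lt_nbhsr.
  apply: (is_derive_eq hM).
  rewrite !hornerE /GRing.scale /= -?exprVn.
  have -> : expR ((- [eta GRing.inv]) x) = expR (- x^-1) by [].
  ring.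
- rewrite x0 {2}/flat_exp ltxx.
  have [C [C0 hC]] := flat_exp_bound P.
  have cv : h^-1 *: (flat_exp P (h *: (1 : R) + 0) - flat_exp P 0) @[h --> (0 : R)^'] --> (0 : R).
    apply/cvgrPdist_le => e e0.
    near=> h.
    rewrite sub0r normrN /GRing.scale /= mulr1 addr0 {2}/flat_exp ltxx subr0.
    have hn0 : h != 0 by near: h; exact: nbhs_dnbhs_neq.
    have h1 : `|h| <= 1.
      by near: h; exact: dnbhs0_le.
    have h2 : `|h| <= e / (C + 1).
      near: h; apply: dnbhs0_le; rewrite divr_gt0//.
      by rewrite ltr_wpDl.
    rewrite normrM normfV ler_pdivrMl ?normr_gt0// (le_trans (hC _ h1))//.
    rewrite expr2 mulrA mulrC ler_wpM2l// (le_trans (ler_wpM2l C0 h2))//.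
    rewrite mulrCA ler_piMr ?ltW// ltr_pdivrMr; lra.
  split; first by apply/cvg_ex; exists 0.
  exact/cvg_lim.
Unshelve. all: end_near. Qed.

Lemma smooth1_flat_exp P : smooth1 (flat_exp P).
Proof.
move=> k; elim: k P => //= k IH P.
exists (flat_exp ('X ^+ 2 * (P - P^`()))); split; last exact: IH.
exact: flat_exp_derive.
Qed.

End smooth1.

Section smooth_products.
Context {R : realType} {n : nat}.
Local Notation V := 'rV[R]_n.

(** Finite sums of products of one-variable functions. The class is stable under partial
    derivatives, so iterated partial derivatives need to be computed in one variable
    only; it contains both the tensor bumps and the multivariate Bernstein
    polynomials. *)
Definition sum_of_products (s : seq (R * ('I_n -> R -> R))) (x : V) : R :=
  \sum_(F <- s) F.1 * \prod_(i < n) F.2 i (x ord0 i).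

Definition smooth_family (F : 'I_n -> R -> R) := forall i, smooth1 (F i).

Definition smooth_factors (s : seq (R * ('I_n -> R -> R))) :=
  forall F, List.In F s -> smooth_family F.2.

Lemma prod_is_derive (F : 'I_n -> R -> R) (i : 'I_n) (F' : R -> R) (x : V) :
  (forall t : R, is_derive t 1 (F i) (F' t)) ->
  is_derive x (delta_mx ord0 i) (fun y : V => \prod_(j < n) F j (y ord0 j))
    (\prod_(j < n) (if j == i then F' else F j) (x ord0 j)).
Proof.
move=> dF; apply/is_derive_lineE.
pose c := \prod_(j < n | j != i) F j (x ord0 j).
have -> : (fun t : R => \prod_(j < n) F j ((t *: delta_mx ord0 i + x) ord0 j)) =
    (fun t : R => c * F i (1 * t + x ord0 i)).
  apply/funext => t; rewrite (bigD1 i)//= mulrC !mxE !eqxx /= mulr1 mul1r; congr (_ * _).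
  by apply: eq_bigr => j ji; rewrite !mxE (negbTE ji) andbF mulr0 add0r.
have h := is_derive_affine 1 (x ord0 i) 0.
have := is_deriveZ c (@is_derive1_comp _ (F i) _ 0 _ _ (dF _) h).
move=> /is_derive_eq; apply.
rewrite (bigD1 i)//= eqxx mulr0 add0r mulr1 mulrC; congr (_ * _).
by apply: eq_bigr => j /negbTE ->.
Qed.

Lemma prod_continuous (F : 'I_n -> R -> R) : smooth_family F ->
  continuous (fun y : V => \prod_(j < n) F j (y ord0 j)).
Proof.
move=> sF; apply: continuous_big => [|i _]; first exact: mul_continuous.
move=> x; apply: continuous_comp; first exact: coord_continuous.
exact: smooth1_continuous.
Qed.

Lemma sum_of_products_continuous s : smooth_factors s -> continuous (sum_of_products s).
Proof.
elim: s => [|F s IH] sF x.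
  rewrite (_ : sum_of_products _ = cst 0); first exact: cst_continuous.
  by apply/funext => y; rewrite /sum_of_products big_nil.
rewrite (_ : sum_of_products _ = fun y =>
    F.1 * (\prod_(i < n) F.2 i (y ord0 i)) + sum_of_products s y); last first.
  by apply/funext => y; rewrite /sum_of_products big_cons.
apply: (@continuousD _ _ _ _ (sum_of_products s) x); last first.
  by apply: IH => G Gs; apply: sF; right.
apply: (@continuousM _ _ (cst F.1)); first exact: cst_continuous.
by apply: prod_continuous; apply: sF; left.
Qed.

(** A partial derivative replaces one factor of each product by its derivative, hence
    stays in the class. *)
Lemma sum_of_products_derive s i : smooth_factors s ->
  exists2 s', smooth_factors s' & forall x : V,
    is_derive x (delta_mx ord0 i) (sum_of_products s) (sum_of_products s' x).
Proof.
elim: s => [|F s IH] sF.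
  exists [::] => // x; rewrite (_ : sum_of_products _ = cst 0).
    exact: is_derive_cst.
  by apply/funext => y; rewrite /sum_of_products big_nil.
have [|s' ss' ds'] := IH; first by move=> G Gs; apply: sF; right.
have sF0 : smooth_family F.2 by apply: sF; left.
have [F' [dF' sF']] := smooth1_derive (sF0 i).
exists ((F.1, fun j => if j == i then F' else F.2 j) :: s').
  by move=> G [<- j /=|]; [case: eqP|exact: ss'].
move=> x; rewrite (_ : sum_of_products (F :: s) = fun y =>
    F.1 * (\prod_(i < n) F.2 i (y ord0 i)) + sum_of_products s y); last first.
  by apply/funext => y; rewrite /sum_of_products big_cons.
rewrite [X in is_derive _ _ _ X]/sum_of_products big_cons -/(sum_of_products s' x); apply: is_deriveD.
exact: (is_deriveZ F.1 (prod_is_derive x dF')).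
Qed.

Lemma sum_of_products_smooth s : smooth_factors s -> smooth (sum_of_products s).
Proof.
move=> ss.
have H t : exists2 s', smooth_factors s' & iter_partial t (sum_of_products s) = sum_of_products s'.
  elim: t => [|i t [s' ss' E]]; first by exists s.
  have [s'' ss'' ds''] := sum_of_products_derive i ss'.
  exists s'' => //=; rewrite E; apply/funext => x.
  by have ? := ds'' x; exact: derive_val.
move=> t x; have [s' ss' ->] := H t; split; first exact: sum_of_products_continuous.
move=> i; have [s'' _ ds''] := sum_of_products_derive i ss'.
by have [] := ds'' x.
Qed.

End smooth_products.

(** * Bernstein polynomials *)

Section bernstein.
Context {R : realType}.

(** The Bernstein basis polynomial of degree [n] and index [k], by the recursion of the
    binomial law: a coin of bias [y] is tossed once more. Its moments then follow by
    induction on [n]. *)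
Fixpoint bern (n k : nat) (y : R) : R :=
  match n, k with
  | 0%N, 0%N => 1
  | 0%N, _.+1 => 0
  | n'.+1, 0%N => (1 - y) * bern n' 0 y
  | n'.+1, k'.+1 => y * bern n' k' y + (1 - y) * bern n' k'.+1 y
  end.

Definition bern_prev (n k : nat) (y : R) : R := if k is k'.+1 then bern n k' y else 0.

Lemma bernS n k y : bern n.+1 k y = y * bern_prev n k y + (1 - y) * bern n k y.
Proof. by case: k => [|k] //=; rewrite mulr0 add0r. Qed.

Lemma bern_ge0 n k y : 0 <= y <= 1 -> 0 <= bern n k y.
Proof.
move=> /andP[y0 y1]; elim: n k => [|n IH] [|k] //=.
  by rewrite mulr_ge0// subr_ge0.
by rewrite addr_ge0// mulr_ge0// subr_ge0.
Qed.

Lemma bern_small n k y : (n < k)%N -> bern n k y = 0.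
Proof.
elim: n k => [|n IH] [|k] //= nk.
by rewrite !IH ?mulr0 ?addr0// ltnW.
Qed.

Lemma smooth1_bern n k : smooth1 (bern n k).
Proof.
have s1 : smooth1 (fun y : R => 1 - y).
  rewrite (_ : (fun y => _) = (fun y : R => (-1) * y + 1)); last first.
    by apply/funext => y /=; ring.
  exact: (smooth1_affine (-1) 1 smooth1_id).
elim: n k => [|n IH] [|k] /=; try exact: smooth1_cst.
  exact: (smooth1M s1 (IH 0%N)).
exact: (smooth1D (smooth1M smooth1_id (IH k)) (smooth1M s1 (IH k.+1))).
Qed.

Lemma bern_derive n k (y : R) :
  is_derive y 1 (bern n.+1 k) (n.+1%:R * (bern_prev n k y - bern n k y)).
Proof.
have d1 : is_derive y 1 (fun y : R => 1 - y) (-1).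
  have h := is_derive_affine (-1) 1 y.
  rewrite (_ : (fun y : R => 1 - y) = (fun t => -1 * t + 1))//.
  by apply/funext => t; ring.
have d2 := is_derive_id y (1 : R).
elim: n k => [|n IH] k.
  case: k => [|[|k]] /=.
  - rewrite (_ : (fun y => _) = (fun y : R => 1 - y)); last first.
      by apply/funext => t; rewrite mulr1.
    by apply: (is_derive_eq d1); rewrite /bern_prev /=; ring.
  - rewrite (_ : (fun y => _) = id); last by apply/funext => t; rewrite /=; ring.
    by apply: (is_derive_eq d2); rewrite /bern_prev /=; ring.
  - rewrite (_ : (fun y => _) = cst 0); last by apply/funext => t; rewrite /=; ring.
    by apply: (is_derive_eq (is_derive_cst (0 : R) y (1 : R))); rewrite /bern_prev /=; ring.
rewrite (_ : bern n.+2 k = fun t => t * bern_prev n.+1 k t + (1 - t) * bern n.+1 k t); last first.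
  by apply/funext => t; rewrite bernS.
have dp : is_derive y 1 (bern_prev n.+1 k)
    (n.+1%:R * (bern_prev n k.-1 y - bern_prev n k y)).
  case: k => [|k]; last exact: IH.
  by apply: (is_derive_eq (is_derive_cst (0 : R) y (1 : R))); rewrite /=; ring.
have := is_deriveD (is_deriveM d2 dp) (is_deriveM d1 (IH k)).
move=> h; apply: (is_derive_eq h); rewrite {}/GRing.scale [n.+2%:R]mulrSr.
have bp : bern_prev n.+1 k y = y * bern_prev n k.-1 y + (1 - y) * bern_prev n k y.
  by case: k {dp h} => [|k]; [rewrite /=; ring|exact: bernS].
rewrite /= -/(bern n.+1 k y) bp bernS; ring.
Qed.

(** The expectation of [phi] under the binomial law with parameters [n] and [y]. *)
Definition bern_mean n (phi : nat -> R) y := \sum_(k < n.+1) phi k * bern n k y.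

Lemma bern_mean_rec n phi y :
  bern_mean n.+1 phi y = y * bern_mean n (phi \o S) y + (1 - y) * bern_mean n phi y.
Proof.
rewrite /bern_mean big_ord_recl /=.
have -> : \sum_(k < n.+1) phi k * bern n k y =
  phi 0%N * bern n 0 y + \sum_(k < n.+1) phi k.+1 * bern n k.+1 y.
  transitivity (\sum_(k < n.+2) phi k * bern n k y).
    by rewrite [RHS]big_ord_recr /= bern_small// mulr0 addr0.
  by rewrite big_ord_recl.
rewrite mulrDr !mulr_sumr addrCA -big_split /=; congr (_ + _); first by ring.
by apply: eq_bigr => k _; rewrite /bump /= ?add1n; ring.
Qed.

Lemma bern_mean_cst n c y : bern_mean n (fun=> c) y = c.
Proof.
elim: n => [|n IH]; first by rewrite /bern_mean big_ord_recr big_ord0 /= mulr1 add0r.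
by rewrite bern_mean_rec /comp IH; ring.
Qed.

Lemma bern_meanD n f g y :
  bern_mean n (fun k => f k + g k) y = bern_mean n f y + bern_mean n g y.
Proof. by rewrite /bern_mean -big_split; apply: eq_bigr => k _; rewrite mulrDl. Qed.

Lemma bern_meanZ n c g y : bern_mean n (fun k => c * g k) y = c * bern_mean n g y.
Proof. by rewrite /bern_mean mulr_sumr; apply: eq_bigr => k _; rewrite mulrA. Qed.

Lemma bern_mean1 n y : bern_mean n (fun k => k%:R) y = n%:R * y.
Proof.
elim: n => [|n IH]; first by rewrite /bern_mean big_ord_recr big_ord0 /=; ring.
rewrite bern_mean_rec IH.
rewrite (_ : _ \o S = fun k => k%:R + 1); last by apply/funext => k /=; rewrite natr1.
by rewrite bern_meanD IH bern_mean_cst -natr1; ring.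
Qed.

Lemma bern_mean2 n y : bern_mean n (fun k => k%:R ^+ 2) y =
  n%:R * y * (1 - y) + (n%:R * y) ^+ 2.
Proof.
elim: n => [|n IH]; first by rewrite /bern_mean big_ord_recr big_ord0 /=; ring.
rewrite bern_mean_rec IH.
rewrite (_ : _ \o S = fun k => k%:R ^+ 2 + (2 * k%:R + 1)); last first.
  by apply/funext => k /=; rewrite -natr1; ring.
by rewrite !bern_meanD bern_meanZ IH bern_mean1 bern_mean_cst -natr1; ring.
Qed.

Lemma bern_variance n y : bern_mean n (fun k => (k%:R - n%:R * y) ^+ 2) y =
  n%:R * y * (1 - y).
Proof.
rewrite (_ : (fun k => _) = fun k => k%:R ^+ 2 + (((- 2) * (n%:R * y)) * k%:R + (n%:R * y) ^+ 2)); last first.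
  by apply/funext => k; ring.
by rewrite !bern_meanD bern_meanZ bern_mean1 bern_mean2 bern_mean_cst; ring.
Qed.

End bernstein.

Section weights.
Context {R : realType} {N : nat}.
Local Notation V := 'rV[R]_N.

(** Uniform continuity in the form that suits a variance estimate: where the increment
    of [g] is at least [e], compactness bounds the squared distance from below, so a
    large multiple of it dominates the increment. *)
Lemma quadratic_modulus (g : V -> R) (x0 : V) (S e : R) : 0 < e ->
  continuous g ->
  exists2 C : R, 0 <= C & forall x z, cube x0 S x -> cube x0 S z ->
    `|g z - g x| <= e + C * \sum_i (z ord0 i - x ord0 i) ^+ 2.
Proof.
move=> e0 cg.
have cK := @compact_cube R N x0 S.
pose d (z : V * V) := `|g z.2 - g z.1|.
pose q (z : V * V) := \sum_i (z.2 ord0 i - z.1 ord0 i) ^+ 2.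
have cd : continuous d.
  move=> z; apply: (@continuous_comp _ _ _ (fun z : V * V => g z.2 - g z.1) (fun t : R => `|t|) z);
    last exact: norm_continuous.
  apply: (@continuousB _ _ _ (g \o snd) (g \o fst)).
    by apply: continuous_comp; [exact: cvg_snd|exact: cg].
  by apply: continuous_comp; [exact: cvg_fst|exact: cg].
have cq : continuous q.
  have H (i : 'I_N) : true -> continuous (fun z : V * V => (z.2 ord0 i - z.1 ord0 i) ^+ 2).
    move=> _ z; apply: (@continuous_comp _ _ _ (fun z : V * V => z.2 ord0 i - z.1 ord0 i) (fun t => t ^+ 2)).
      apply: (@continuousB _ _ _ (fun z : V * V => z.2 ord0 i) (fun z : V * V => z.1 ord0 i)).
        by apply: (@continuous_comp _ _ _ snd (fun v : V => v ord0 i));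
          [exact: cvg_snd|exact: coord_continuous].
      by apply: (@continuous_comp _ _ _ fst (fun v : V => v ord0 i));
          [exact: cvg_fst|exact: coord_continuous].
    exact: exprn_continuous.
  by apply: continuous_big => [|i _]; [exact: add_continuous|exact: H].
pose T := (cube x0 S `*` cube x0 S) `&` [set z | e <= d z].
have cT : compact T.
  apply: compact_closedI; first exact: compact_setX.
  by apply: (@closed_comp _ _ d [set t | e <= t]); [move=> z _; exact: cd|exact: closed_ge].
have [T0|T0] := pselect (T !=set0); last first.
  exists 0 => // x z xK zK; rewrite mul0r addr0 leNgt; apply/negP => h.
  by apply: T0; exists (x, z); split=> //=; exact: ltW.
have [m mT mmin] := compact_EVT_min T0 cT (continuous_subspaceT cq).
have [M MT Mmax] := compact_EVT_max T0 cT (continuous_subspaceT cd).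
have q0 : 0 < q m.
  have qm0 : 0 <= q m by apply: sumr_ge0 => i _; exact: sqr_ge0.
  rewrite lt_def qm0 andbT; apply/eqP => qm.
  have : m.2 = m.1.
    apply/rowP => i; apply/eqP; rewrite -subr_eq0 -sqrf_eq0; apply/eqP.
    by apply: (psumr_eq0P _ qm) => // j _; exact: sqr_ge0.
  move: mT; rewrite inE => -[_ /= h] E; move: h; rewrite /d E subrr normr0.
  by rewrite leNgt e0.
have C0 : 0 <= d M / q m by rewrite divr_ge0 ?(ltW q0)//; exact: normr_ge0.
exists (d M / q m) => //.
move=> x z xK zK; have [h|h] := leP e (d (x, z)); last first.
  rewrite -[leLHS]addr0 lerD// ?(ltW h)// mulr_ge0//.
  by apply: sumr_ge0 => i _; exact: sqr_ge0.
have zT : (x, z) \in T by rewrite inE; split.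
rewrite (le_trans (Mmax _ zT))// -[leLHS]add0r lerD// ?(ltW e0)//.
rewrite -mulrA ler_peMr//; first exact: normr_ge0.
by rewrite mulrC ler_pdivlMr// mul1r; exact: (mmin _ zT).
Qed.

(** Chebyshev's argument: a probability with small variance around [x] averages [g] to
    almost [g x]. *)
Lemma weighted_mean_approx (K : finType) (W : K -> R) (xi : K -> V) (x : V) (g : V -> R)
    (e C eta : R) : (forall k, 0 <= W k) -> \sum_k W k = 1 -> 0 <= C ->
  (forall k, `|g (xi k) - g x| <= e + C * \sum_i (xi k ord0 i - x ord0 i) ^+ 2) ->
  (forall i, \sum_k W k * (xi k ord0 i - x ord0 i) ^+ 2 <= eta) ->
  `|\sum_k W k * g (xi k) - g x| <= e + C * (N%:R * eta).
Proof.
move=> W0 W1 C0 hg hv.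
have -> : \sum_k W k * g (xi k) - g x = \sum_k W k * (g (xi k) - g x).
  rewrite -[X in _ - X]mul1r -W1 mulr_suml -sumrB.
  by apply: eq_bigr => k _; rewrite mulrBr.
rewrite (le_trans (ler_norm_sum _ _ _))//.
apply: (@le_trans _ _ (\sum_k W k * (e + C * \sum_i (xi k ord0 i - x ord0 i) ^+ 2))).
  by apply: ler_sum => k _; rewrite normrM ger0_norm// ler_wpM2l.
under eq_bigr do rewrite mulrDr.
rewrite big_split /= -mulr_suml W1 mul1r lerD2l.
under eq_bigr do rewrite mulrCA mulr_sumr.
rewrite -mulr_sumr ler_wpM2l// exchange_big /=.
rewrite (le_trans (ler_sum _ (fun i _ => hv i)))//.
by rewrite sumr_const card_ord mulr_natl.
Qed.

End weights.

(** * Tensor products of Bernstein polynomials *)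

Section bernstein_multi.
Context {R : realType} {N : nat}.
Local Notation V := 'rV[R]_N.
Variables (x0 : V) (S : R).
Hypothesis S0 : 0 < S.
Let L := 2 * S.
Let a i := x0 ord0 i - S.
Implicit Types x : V.

Lemma L_gt0 : 0 < L. Proof. by rewrite mulr_gt0. Qed.

Definition unit_coord (x : V) i : R := L^-1 * x ord0 i + - (L^-1 * a i).

Lemma unit_coordE x i : x ord0 i = a i + L * unit_coord x i.
Proof.
by rewrite /unit_coord mulrDr mulrN !mulrA mulfV ?gt_eqF ?L_gt0//; ring.
Qed.

Lemma unit_coord01 x i : cube x0 S x -> 0 <= unit_coord x i <= 1.
Proof.
have L0 := L_gt0.
move=> /(_ i); rewrite unit_coordE ler_distl /a /L => /andP[h1 h2].
by apply/andP; split; rewrite -(ler_pM2l L0) /L; lra.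
Qed.

Variable n : nat.
Let D : R := n.+1%:R.
Local Notation index := {ffun 'I_N -> 'I_n.+2}.
Implicit Types k : index.

Definition node k : V := \row_i (a i + L * ((k i)%:R / D)).

Lemma D_gt0 : 0 < D. Proof. by rewrite ltr0n. Qed.

Lemma node_cube k : cube x0 S (node k).
Proof.
move=> i; rewrite mxE ler_distl /a /L.
have h : 0 <= (k i)%:R / D <= 1.
  by rewrite divr_ge0// ler_pdivrMr ?D_gt0// mul1r ler_nat -ltnS ltn_ord.
move: h; move: (_ / D) => h /andP[h1 h2]; have S1 := S0.
by apply/andP; split; nra.
Qed.

Definition bern_weight k (x : V) : R := \prod_i bern n.+1 (k i) (unit_coord x i).

(** The weight [bern_weight] with the factor of index [j] replaced by [b n];
    differentiating a Bernstein polynomial of degree [n.+1] produces the two choices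
    [bern_prev] and [bern]. *)
Definition bern_weight_d (b : nat -> nat -> R -> R) j k (x : V) : R :=
  \prod_i (if i == j then b n (k i) (unit_coord x i) else bern n.+1 (k i) (unit_coord x i)).

(** The tensor Bernstein polynomial of [f] on the cube, written as a sum of products so
    that its smoothness is automatic. *)
Definition bern_factors (f : V -> R) : seq (R * ('I_N -> R -> R)) :=
  [seq (f (node k), fun i t => bern n.+1 (k i) (L^-1 * t + - (L^-1 * a i))) |
    k <- index_enum {ffun 'I_N -> 'I_n.+2}].

Lemma bern_factorsE f x : sum_of_products (bern_factors f) x = \sum_(k : index) f (node k) * bern_weight k x.
Proof. by rewrite /sum_of_products big_map. Qed.

Lemma bern_factors_smooth f : smooth_factors (bern_factors f).
Proof.
rewrite /bern_factors; elim: (index_enum _) => [|k s IH] //= F [<- i /=|]; last exact: IH.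
exact: (smooth1_affine _ _ (smooth1_bern n.+1 (k i))).
Qed.

Lemma prod_if (A B : 'I_N -> R) j :
  \prod_i (if i == j then A i else B i) = A j * \prod_(i | i != j) B i.
Proof.
by rewrite (bigD1 j)//= eqxx; congr (_ * _); apply: eq_bigr => i /negbTE ->.
Qed.

Lemma bern_factors_derive f x j :
  is_derive x (delta_mx ord0 j) (sum_of_products (bern_factors f))
   (\sum_(k : index) f (node k) * (L^-1 * D * (bern_weight_d bern_prev j k x - bern_weight_d bern j k x))).
Proof.
have E : sum_of_products (bern_factors f) = fun x => \sum_(k : index) f (node k) * bern_weight k x.
  by apply/funext => y; exact: bern_factorsE.
rewrite E {E}.
have dk k : is_derive x (delta_mx ord0 j) (bern_weight k)
    (L^-1 * D * (bern_weight_d bern_prev j k x - bern_weight_d bern j k x)).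
  pose F' (t : R) := n.+1%:R * (bern_prev n (k j) (L^-1 * t + - (L^-1 * a j)) -
       bern n (k j) (L^-1 * t + - (L^-1 * a j))) * L^-1.
  have dF (t : R) : is_derive t 1 (fun t => bern n.+1 (k j) (L^-1 * t + - (L^-1 * a j))) (F' t).
    have h := is_derive_affine L^-1 (- (L^-1 * a j)) t.
    exact: (@is_derive1_comp _ (bern n.+1 (k j)) _ t _ _ (bern_derive _ _ _) h).
  have := @prod_is_derive _ _ (fun i t => bern n.+1 (k i) (L^-1 * t + - (L^-1 * a i))) j F' x dF.
  move=> h; apply: (is_derive_eq h).
  transitivity (\prod_i (if i == j then F' (x ord0 i) else bern n.+1 (k i) (unit_coord x i))).
    by apply: eq_bigr => i _; case: eqP.
  rewrite /bern_weight_d !prod_if /F' -/(unit_coord x j) -/D; ring.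
elim: (index_enum _) => [|k s IH].
  rewrite (_ : (fun _ => _) = cst 0); last by apply/funext => y; rewrite big_nil.
  by rewrite big_nil; exact: is_derive_cst.
rewrite (_ : (fun _ => _) = fun x => f (node k) * bern_weight k x +
    \sum_(k <- s) f (node k) * bern_weight k x); last first.
  by apply/funext => y; rewrite big_cons.
rewrite big_cons; apply: (@is_deriveD _ _ _ (fun x => f (node k) * bern_weight k x)) => //.
Qed.

(** The successor in the coordinate [j], taken cyclically to be a bijection of the index
    set. The wrapped index does no harm because the weight of degree [n] vanishes
    there. *)
Definition shift_index j k : {ffun 'I_N -> 'I_n.+2} :=
  [ffun i => if i == j then ordS (k i) else k i].

Lemma shift_index_bij j : bijective (shift_index j).
Proof.
exists (fun k : {ffun 'I_N -> 'I_n.+2} => [ffun i => if i == j then ord_pred (k i) else k i]) => k;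
  by apply/ffunP => i; rewrite !ffunE; case: eqP => _; rewrite ?ordSK ?ord_predK.
Qed.

(** Summation by parts: reindexing by [shift_index] turns the two terms of the
    derivative into one sum of finite differences of [f] against a probability. *)
Lemma bern_weight_d_shift j k x :
  bern_weight_d bern_prev j (shift_index j k) x = bern_weight_d bern j k x.
Proof.
rewrite /bern_weight_d (bigD1 j)//= [in RHS](bigD1 j)//= eqxx ffunE eqxx; congr (_ * _).
  have [kj|kj] := ltnP (k j) n.+1.
    by rewrite /= modn_small.
  rewrite /=; have -> : (k j : nat) = n.+1 by apply/eqP; rewrite eqn_leq kj -ltnS ltn_ord.
  by rewrite modnn /= bern_small.
by apply: eq_bigr => i /negbTE ij; rewrite ij ffunE ij.
Qed.

Lemma tensor_sum (c : 'I_N -> nat -> R) :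
  \sum_(k : index) \prod_i c i (k i) = \prod_i \sum_(l < n.+2) c i l.
Proof. by rewrite bigA_distr_bigA. Qed.

Lemma bern_sum_mean (phi : nat -> R) y :
  \sum_(l < n.+2) phi l * bern n l y = bern_mean n phi y.
Proof. by rewrite big_ord_recr /= bern_small// mulr0 addr0. Qed.

Lemma bern_sum1 (y : R) : \sum_(l < n.+2) bern n l y = 1.
Proof.
by rewrite -[RHS](bern_mean_cst n 1 y) -bern_sum_mean; apply: eq_bigr => l _; rewrite mul1r.
Qed.

Lemma bernS_sum1 (y : R) : \sum_(l < n.+2) bern n.+1 l y = 1.
Proof.
by rewrite -[RHS](bern_mean_cst n.+1 1 y); apply: eq_bigr => l _; rewrite mul1r.
Qed.

Lemma bern_weight_ge0 k x : cube x0 S x -> 0 <= bern_weight k x.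
Proof. by move=> xS; apply: prodr_ge0 => i _; apply: bern_ge0; exact: unit_coord01. Qed.

Lemma bern_weight_d_ge0 j k x : cube x0 S x -> 0 <= bern_weight_d bern j k x.
Proof.
by move=> xS; apply: prodr_ge0 => i _; case: eqP => _; apply: bern_ge0; exact: unit_coord01.
Qed.

Lemma bern_weight_sum x : \sum_(k : index) bern_weight k x = 1.
Proof.
rewrite (tensor_sum (fun i l => bern n.+1 l (unit_coord x i))).
by apply: big1 => i _; exact: bernS_sum1.
Qed.

Lemma bern_weight_d_sum j x : \sum_(k : index) bern_weight_d bern j k x = 1.
Proof.
rewrite (tensor_sum (fun i l => if i == j then bern n l (unit_coord x i)
  else bern n.+1 l (unit_coord x i))).
by apply: big1 => i _; case: eqP => _; [exact: bern_sum1|exact: bernS_sum1].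
Qed.

Lemma tensor_moment (c : 'I_N -> nat -> R) (phi : nat -> R) i :
  (forall i', \sum_(l < n.+2) c i' l = 1) ->
  \sum_(k : index) (\prod_i' c i' (k i')) * phi (k i) = \sum_(l < n.+2) c i l * phi l.
Proof.
move=> c1; rewrite (eq_bigr (fun k : index => \prod_i' (c i' (k i') * (if i' == i then phi (k i') else 1)))).
  rewrite (tensor_sum (fun i' l => c i' l * (if i' == i then phi l else 1))).
  rewrite (bigD1 i)//= eqxx [X in _ * X]big1 ?mulr1// => i' /negbTE ->.
  by under eq_bigr do rewrite mulr1; exact: c1.
move=> k _; rewrite big_split /=; congr (_ * _).
by rewrite (bigD1 i)//= eqxx big1 ?mulr1// => i' /negbTE ->.
Qed.

Lemma bernS_var y : 0 <= y <= 1 ->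
  \sum_(l < n.+2) bern n.+1 l y * (L * (l%:R / D - y)) ^+ 2 <= L ^+ 2 / D.
Proof.
move=> /andP[y0 y1].
have -> : \sum_(l < n.+2) bern n.+1 l y * (L * (l%:R / D - y)) ^+ 2 =
    (L / D) ^+ 2 * bern_mean n.+1 (fun l => (l%:R - n.+1%:R * y) ^+ 2) y.
  rewrite /bern_mean mulr_sumr; apply: eq_bigr => l _; rewrite -/D.
  by field; rewrite gt_eqF ?D_gt0.
rewrite bern_variance -/D.
have -> : (L / D) ^+ 2 * (D * y * (1 - y)) = L ^+ 2 / D * (y * (1 - y)).
  by field; rewrite gt_eqF ?D_gt0.
rewrite ler_piMr ?divr_ge0 ?sqr_ge0 ?(ltW D_gt0)//; nra.
Qed.

Lemma node_sub k x i :
  node k ord0 i - x ord0 i = L * ((k i)%:R / D - unit_coord x i).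
Proof. by rewrite mxE [X in _ - X](unit_coordE x i); ring. Qed.

Lemma bern_weight_var x i : cube x0 S x ->
  \sum_(k : index) bern_weight k x * (node k ord0 i - x ord0 i) ^+ 2 <= 2 * L ^+ 2 / D.
Proof.
move=> xS.
under eq_bigr => k _ do rewrite node_sub.
rewrite (@tensor_moment (fun i l => bern n.+1 l (unit_coord x i))
  (fun l => (L * (l%:R / D - unit_coord x i)) ^+ 2)); last by move=> i'; exact: bernS_sum1.
rewrite (le_trans (bernS_var (unit_coord01 i xS)))// -mulrA ler_peMl// ?ler1n//.
by rewrite divr_ge0 ?sqr_ge0 ?(ltW D_gt0).
Qed.

(** In the coordinate [j] the weight has degree [n] whereas the nodes are spaced by [1 /
    n.+1] and displaced by at most one step; both discrepancies are of order [1 / n] and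
    only add a constant to the variance. *)
Lemma bern_weight_d_var j x (xi : {ffun 'I_N -> 'I_n.+2} -> V) i : cube x0 S x ->
  (forall k i, i != j -> xi k ord0 i = node k ord0 i) ->
  (forall k, node k ord0 j <= xi k ord0 j <= node k ord0 j + L / D) ->
  \sum_(k : index) bern_weight_d bern j k x * (xi k ord0 i - x ord0 i) ^+ 2 <= 2 * L ^+ 2 / D.
Proof.
move=> xS xi1 xi2.
have D0 := D_gt0; have L0 := L_gt0.
pose c i l := if i == j then bern n l (unit_coord x i) else bern n.+1 l (unit_coord x i).
have c1 i' : \sum_(l < n.+2) c i' l = 1.
  by rewrite /c; case: eqP => _; [exact: bern_sum1|exact: bernS_sum1].
have [ij|ij] := eqVneq i j; last first.
  under eq_bigr => k _ do rewrite xi1// node_sub.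
  rewrite (@tensor_moment c (fun l => (L * (l%:R / D - unit_coord x i)) ^+ 2))//.
  rewrite /c (negbTE ij) (le_trans (bernS_var (unit_coord01 i xS)))// -mulrA ler_peMl// ?ler1n//.
  by rewrite divr_ge0 ?sqr_ge0 ?(ltW D_gt0).
rewrite {}ij {i}; set y := unit_coord x j.
have /andP[y0 y1] := unit_coord01 j xS; rewrite -/y in y0 y1.
apply: (@le_trans _ _ (\sum_(k : index) bern_weight_d bern j k x *
   ((L / D) ^+ 2 * (2 * ((k j)%:R - n%:R * y) ^+ 2 + 2)))).
  apply: ler_sum => k _; rewrite ler_wpM2l ?bern_weight_d_ge0//.
  have := xi2 k; rewrite mxE (unit_coordE x j) -/y => /andP[h1 h2].
  set t := xi k ord0 j in h1 h2 *.
  (* The displacement from the node, in units of the mesh. *)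
  pose w := (t - a j) / (L / D) - (k j)%:R.
  have LD0 : 0 < L / D by rewrite divr_gt0.
  have tE : t = a j + (L / D) * (w + (k j)%:R).
    by rewrite /w; field; rewrite !gt_eqF.
  have kE : L * ((k j)%:R / D) = (k j)%:R * (L / D) by ring.
  rewrite kE in h1 h2.
  have w0 : 0 <= w by rewrite subr_ge0 ler_pdivlMr// lerBrDl.
  have w1 : w <= 1 by rewrite lerBlDr ler_pdivrMr// mulrDl mul1r lerBlDl (addrC (L / D)) addrA.
  have -> : t - (a j + L * y) = (L / D) * (((k j)%:R - n%:R * y) + (w - y)).
    by rewrite tE /D -natr1; field; rewrite natr1 gt_eqF ?D_gt0.
  rewrite exprMn ler_wpM2l ?sqr_ge0//.
  set A := _ - _; have : -1 <= w - y <= 1 by apply/andP; split; lra.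
  by move: (w - y) => B /andP[B1 B2]; have := sqr_ge0 (A - B); nra.
rewrite (@tensor_moment c (fun l => (L / D) ^+ 2 * (2 * (l%:R - n%:R * y) ^+ 2 + 2)))//.
rewrite /c eqxx -/y.
have -> : \sum_(l < n.+2) bern n l y * ((L / D) ^+ 2 * (2 * (l%:R - n%:R * y) ^+ 2 + 2)) =
    (L / D) ^+ 2 * (2 * bern_mean n (fun l => (l%:R - n%:R * y) ^+ 2) y + 2 * bern_mean n (fun=> 1) y).
  rewrite -!bern_sum_mean !mulr_sumr -big_split /= mulr_sumr; apply: eq_bigr => l _; ring.
rewrite bern_variance bern_mean_cst.
have -> : 2 * L ^+ 2 / D = (L / D) ^+ 2 * (2 * D) by field; rewrite gt_eqF.
rewrite ler_wpM2l ?sqr_ge0// /D -(natr1 n).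
have : 0 <= n%:R :> R by [].
move: (n%:R) => m m0; have h : y * (1 - y) <= 1 by nra.
by have := ler_wpM2l m0 h; lra.
Qed.

End bernstein_multi.

(** * Uniform approximation of a function and its gradient *)

Section test_functions.
Context {R : realType} {N : nat}.
Local Notation V := 'rV[R]_N.
Implicit Types x : V.

(** The derivative of the Bernstein polynomial is a mean of difference quotients of [f]
    between neighbouring nodes, and by the mean value theorem each quotient is a value
    of the partial derivative [g j] nearby. *)
Lemma bern_derivative_mean (x0 : V) (S : R) (n : nat) (f : V -> R) g j x :
  0 < S -> C1with setT f g -> cube x0 S x ->
  exists xi : {ffun 'I_N -> 'I_n.+2} -> V, [/\ forall k, cube x0 S (xi k),
    forall k i, i != j -> xi k ord0 i = node x0 S k ord0 i,
    forall k, node x0 S k ord0 j <= xi k ord0 j <= node x0 S k ord0 j + 2 * S / n.+1%:R &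
    partial j (sum_of_products (bern_factors x0 S n f)) x =
    \sum_k bern_weight_d x0 S bern j k x * g j (xi k)].
Proof.
move=> S0 fg xS; set L := 2 * S; set D := n.+1%:R : R.
have D0 : 0 < D by rewrite ltr0n.
have L0 : 0 < L by rewrite mulr_gt0.
have LD0 : 0 < L / D by rewrite divr_gt0.
have /choice[xi Hxi] : forall k : {ffun 'I_N -> 'I_n.+2}, exists y : V, [/\ cube x0 S y,
   forall i, i != j -> y ord0 i = node x0 S k ord0 i,
   node x0 S k ord0 j <= y ord0 j <= node x0 S k ord0 j + L / D &
   (L^-1 * D * (f (node x0 S (shift_index j k)) - f (node x0 S k))) * bern_weight_d x0 S bern j k x =
   bern_weight_d x0 S bern j k x * g j y].
  move=> k; have [kj|kj] := ltnP (k j) n.+1; last first.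
    (* The weight vanishes at the last index, where the shift wraps around. *)
    exists (node x0 S k); split=> //; first exact: node_cube.
      by rewrite lexx lerDl ltW.
    suff -> : bern_weight_d x0 S bern j k x = 0 by rewrite mulr0 mul0r.
    rewrite /bern_weight_d (bigD1 j)//= eqxx bern_small ?mul0r//.
  set z := node x0 S k; pose t0 := z ord0 j; pose t1 := t0 + L / D.
  have zS : cube x0 S z by exact: node_cube.
  have sE : node x0 S (shift_index j k) = set_coord z j t1.
    apply/rowP => i; rewrite !mxE ffunE; case: eqP => // ->.
    rewrite /t1 /t0 /z mxE /= modn_small// -/L -/D -natr1.
    by rewrite mulrDl mul1r mulrDr addrA.
  have t1S : `|t1 - x0 ord0 j| <= S.
    have := @node_cube R N x0 S S0 n (shift_index j k) j.
    by rewrite sE mxE eqxx.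
  have t0S : `|t0 - x0 ord0 j| <= S by exact: zS.
  have inS r : r \in `[t0, t1]%R -> cube x0 S (set_coord z j r).
    rewrite in_itv/= => /andP[r1 r2]; apply: cube_set_coord => //.
    by move: t0S t1S; rewrite !ler_distl; lra.
  pose phi r := f (set_coord z j r).
  have der (r : R) : is_derive r 1 phi (g j (set_coord z j r)).
    by apply: is_derive_set_coord; have [] := fg (set_coord z j r) Logic.I j.
  have t01 : t0 <= t1 by rewrite lerDl ltW.
  have [r rI rE] := @MVT_segment R phi (fun r => g j (set_coord z j r)) t0 t1 t01
    (fun r _ => der r)
    (derivable_within_continuous (fun r _ => @ex_derive _ _ _ _ _ _ _ (der r))).
  exists (set_coord z j r); split.
  - exact: inS.
  - by move=> i /negbTE ij; rewrite [LHS]mxE ij.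
  - have -> : set_coord z j r ord0 j = r by rewrite mxE eqxx.
    by move: rI; rewrite in_itv.
  - have -> : f (node x0 S (shift_index j k)) - f z = g j (set_coord z j r) * (L / D).
      rewrite sE (_ : L / D = t1 - t0); last by rewrite /t1; ring.
      by rewrite -rE /phi /t0 set_coord_id.
    by rewrite mulrC; field; rewrite !gt_eqF.
exists xi; split=> [k|k i ij|k|]; try by have [] := Hxi k.
  by have [_ h _ _] := Hxi k; exact: h.
have := bern_factors_derive x0 S n f x j => h.
rewrite /partial (@derive_val _ _ _ _ _ _ _ h).
transitivity (\sum_(k : {ffun 'I_N -> 'I_n.+2}) (L^-1 * D * (f (node x0 S (shift_index j k)) -
    f (node x0 S k))) * bern_weight_d x0 S bern j k x); last first.
  by apply: eq_bigr => k _; have [] := Hxi k.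
transitivity (L^-1 * D * (\sum_(k : {ffun 'I_N -> 'I_n.+2}) f (node x0 S k) * bern_weight_d x0 S bern_prev j k x -
    \sum_(k : {ffun 'I_N -> 'I_n.+2}) f (node x0 S k) * bern_weight_d x0 S bern j k x)).
  rewrite -sumrB mulr_sumr; apply: eq_bigr => k _; rewrite -/L -/D; ring.
rewrite (reindex (shift_index j)) /=; last exact: onW_bij (shift_index_bij _ _).
rewrite -sumrB mulr_sumr; apply: eq_bigr => k _; rewrite bern_weight_d_shift; ring.
Qed.

(** Both the polynomial and its partial derivatives are means, of [f] and of [g j],
    under probabilities of variance of order [1 / n] around [x]; nonnegativity of [f] is
    inherited because the weights are nonnegative. *)
Lemma C1_bernstein (x0 : V) (S e : R) (f : V -> R) g : 0 < S -> 0 < e ->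
  C1with setT f g ->
  exists s, [/\ smooth_factors s,
    forall x, cube x0 S x -> `|sum_of_products s x - f x| <= e,
    forall x j, cube x0 S x -> `|partial j (sum_of_products s) x - g j x| <= e &
    (forall x, 0 <= f x) -> forall x, cube x0 S x -> 0 <= sum_of_products s x].
Proof.
move=> S0 e0 fg; have e20 : 0 < e / 2 by rewrite divr_gt0.
have cf : continuous f by move=> x; exact: (C1with_continuous openT fg).
have cg j : continuous (g j) by move=> x; have [] := fg x Logic.I j.
have [Cf Cf0 Hf] := quadratic_modulus x0 S e20 cf.
have /choice[Cg HCg] : forall j, exists C : R, 0 <= C /\ forall x z, cube x0 S x -> cube x0 S z ->
    `|g j z - g j x| <= e / 2 + C * \sum_i (z ord0 i - x ord0 i) ^+ 2.
  by move=> j; have [C C0 H] := quadratic_modulus x0 S e20 (cg j); exists C.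
pose C := Cf + \sum_j Cg j.
have CfC : Cf <= C by rewrite lerDl sumr_ge0// => j _; have [] := HCg j.
have CgC j : Cg j <= C.
  rewrite /C (bigD1 j)//= addrCA lerDl addr_ge0// sumr_ge0// => i _.
  by have [] := HCg i.
have C0 : 0 <= C by exact: le_trans CfC.
pose T := C * (N%:R * (2 * (2 * S) ^+ 2)).
have T0 : 0 <= T by rewrite /T; positivity.
have [n nT] : exists n : nat, T / n.+1%:R <= e / 2.
  exists (Num.bound (T / (e / 2))).
  rewrite ler_pdivrMr ?ltr0n// mulrC -ler_pdivrMr//.
  have := archi_boundP (divr_ge0 T0 (ltW e20)); move/ltW/le_trans; apply.
  by rewrite ler_nat.
have bound (C' : R) : C' <= C -> e / 2 + C' * (N%:R * (2 * (2 * S) ^+ 2 / n.+1%:R)) <= e.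
  move=> C'C; rewrite [leRHS](splitr e) lerD2l (le_trans _ nT)// /T.
  rewrite (_ : C * _ / _ = C * (N%:R * (2 * (2 * S) ^+ 2 / n.+1%:R))).
    by rewrite ler_wpM2r//; positivity.
  have : n.+1%:R != 0 :> R by rewrite pnatr_eq0.
  by move: (n.+1%:R : R) => D D0; field.
exists (bern_factors x0 S n f); split; first exact: bern_factors_smooth.
- move=> x xS; rewrite bern_factorsE; apply: le_trans (bound _ CfC).
  under eq_bigr do rewrite mulrC.
  apply: weighted_mean_approx => //.
  + by move=> k; exact: bern_weight_ge0.
  + exact: bern_weight_sum.
  + by move=> k; apply: Hf => //; exact: node_cube.
  + by move=> i; exact: bern_weight_var.
- move=> x j xS; have [xi [xi0 xi1 xi2 ->]] := bern_derivative_mean n j S0 fg xS.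
  apply: le_trans (bound _ (CgC j)); have [Cj0 Hj] := HCg j.
  apply: weighted_mean_approx => //.
  + by move=> k; exact: bern_weight_d_ge0.
  + exact: bern_weight_d_sum.
  + by move=> k; apply: Hj.
  + by move=> i; exact: bern_weight_d_var.
- move=> f0 x xS; rewrite bern_factorsE sumr_ge0// => k _.
  by rewrite mulr_ge0// bern_weight_ge0.
Qed.

(** A zero of a nonnegative function is a minimum. *)
Lemma is_derive_min (f : V -> R) x v (g : V -> R) :
  (forall y, is_derive y v f (g y)) -> (forall y, 0 <= f y) -> f x = 0 -> g x = 0.
Proof.
move=> fg f0 fx; have dl (t : R) : is_derive t 1 (fun t : R => f (t *: v + x)) (g (t *: v + x)).
  have E : (fun h : R => h^-1 *: (f ((h *: 1 + t) *: v + x) - f (t *: v + x))) =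
     (fun h : R => h^-1 *: (f (h *: v + (t *: v + x)) - f (t *: v + x))).
    by apply/funext => h; rewrite scalerDl /GRing.scale/= mulr1 addrA.
  have [d1 d2] := fg (t *: v + x).
  by split; [rewrite /derivable E|rewrite -d2 /derive E].
have h1 : -1 < 1 :> R by lra.
have h0 : (0 : R) \in `]-1, 1[%R by rewrite in_itv/=; apply/andP; split; lra.
have fmin t : t \in `]-1, 1[%R -> f (0 *: v + x) <= f (t *: v + x).
  by move=> _; rewrite scale0r add0r fx.
have [_ d0] := @derive1_at_min R (fun t : R => f (t *: v + x)) (-1) 1 0 (ltW h1)
  (fun t _ => @ex_derive _ _ _ _ _ _ _ (dl t)) h0 fmin.
by have [_] := dl 0; rewrite d0 scale0r add0r.
Qed.

End test_functions.

(** * Smooth nonnegative test functions are dense *)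

Section density.
Context {R : realType} {N : nat}.
Local Notation V := 'rV[R]_N.
Implicit Types x : V.

Definition open_cube (c : V) (s : R) : set V := [set x | forall i, `|x ord0 i - c ord0 i| < s].

Lemma open_open_cube c s : open (open_cube c s).
Proof.
rewrite openE => x xc.
apply: (@filter_forall _ _ (fun i => [set y : V | `|y ord0 i - c ord0 i| < s]) _ (nbhs_filter x)) => i.
apply: open_nbhs_nbhs; split; last exact: xc.
apply: (@open_comp _ _ (fun x : V => `|x ord0 i - c ord0 i|) [set t | t < s]); last exact: open_lt.
move=> y _; apply: (@continuous_comp _ _ _ (fun x : V => x ord0 i - c ord0 i) (fun t : R => `|t|));
  last exact: norm_continuous.
apply: (@continuousB _ _ _ (fun x : V => x ord0 i) (cst (c ord0 i))); last exact: cst_continuous.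
exact: coord_continuous.
Qed.

Lemma smooth_C1with (f : V -> R) : smooth f -> C1with setT f (fun i => partial i f).
Proof.
move=> sf x _ i; have [_ d] := sf [::] x; have [c _] := sf [:: i] x.
by split => //; exact: DeriveDef (d i) erefl.
Qed.

(** Flat exponentials at both ends of the interval of centre [x0 ord0 i] and
    half-length [S]. *)
Definition bump_factor (x0 : V) (S : R) (i : 'I_N) (t : R) : R :=
  flat_exp 1 (-1 * t + (S + x0 ord0 i)) * flat_exp 1 (1 * t + (S - x0 ord0 i)).

Lemma smooth1_bump_factor x0 S i : smooth1 (bump_factor x0 S i).
Proof.
apply: smooth1M.
  exact: (smooth1_affine (-1) (S + x0 ord0 i) (smooth1_flat_exp 1)).
exact: (smooth1_affine 1 (S - x0 ord0 i) (smooth1_flat_exp 1)).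
Qed.

Lemma flat_exp_ge0 (t : R) : 0 <= flat_exp 1 t.
Proof. by rewrite /flat_exp; case: ifP => // _; rewrite hornerE mul1r expR_ge0. Qed.

Lemma bump_factor_ge0 x0 S i t : 0 <= bump_factor x0 S i t.
Proof. by rewrite mulr_ge0// flat_exp_ge0. Qed.

Lemma bump_factor_gt0 x0 S i t : `|t - x0 ord0 i| < S -> 0 < bump_factor x0 S i t.
Proof.
rewrite ltr_distl => /andP[h1 h2]; rewrite /bump_factor /flat_exp.
rewrite !ifT; try by lra.
by apply: mulr_gt0; rewrite hornerE mul1r; exact: expR_gt0.
Qed.

Lemma bump_factor_eq0 x0 S i t : S <= `|t - x0 ord0 i| -> bump_factor x0 S i t = 0.
Proof.
move=> h; rewrite /bump_factor /flat_exp.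
case: ifP => h1; last by rewrite mul0r.
case: ifP => h2; last by rewrite mulr0.
suff : `|t - x0 ord0 i| < S by rewrite ltNge h.
by rewrite ltr_distl; apply/andP; split; lra.
Qed.

Definition bump (x0 : V) (S : R) x : R := \prod_i bump_factor x0 S i (x ord0 i).

Definition bump_mul (x0 : V) (S : R) (s : seq (R * ('I_N -> R -> R))) :=
  [seq (F.1, fun i t => bump_factor x0 S i t * F.2 i t) | F <- s].

Lemma bump_mulE x0 S s x : sum_of_products (bump_mul x0 S s) x = bump x0 S x * sum_of_products s x.
Proof.
rewrite /sum_of_products big_map mulr_sumr; apply: eq_bigr => F _ /=.
by rewrite big_split /= mulrCA.
Qed.

Lemma bump_mul_smooth x0 S s : smooth_factors s -> smooth_factors (bump_mul x0 S s).
Proof.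
rewrite /bump_mul; elim: s => [|F s IH] //= sF G [<- i /=|]; last first.
  by apply: IH => H Hs; apply: sF; right.
by apply: smooth1M; [exact: smooth1_bump_factor|apply: sF; left].
Qed.

Lemma bump_smooth x0 S : smooth (bump x0 S).
Proof.
rewrite (_ : bump x0 S = sum_of_products [:: (1, bump_factor x0 S)]).
  by apply: sum_of_products_smooth => F [<- i|//]; exact: smooth1_bump_factor.
by apply/funext => x; rewrite /sum_of_products big_seq1 mul1r.
Qed.

Lemma bump_ge0 x0 S x : 0 <= bump x0 S x.
Proof. by apply: prodr_ge0 => i _; exact: bump_factor_ge0. Qed.

Lemma bump_gt0 x0 S x : open_cube x0 S x -> 0 < bump x0 S x.
Proof. by move=> h; apply: prodr_gt0 => i _; apply: bump_factor_gt0. Qed.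

Lemma bump_eq0 x0 S x : ~ open_cube x0 S x -> bump x0 S x = 0.
Proof.
move=> h; have [i hi] : exists i, S <= `|x ord0 i - x0 ord0 i|.
  apply: contrapT => H; apply: h => i; rewrite ltNge; apply/negP => hi.
  by apply: H; exists i.
by rewrite /bump (bigD1 i)//= bump_factor_eq0// mul0r.
Qed.

(** Divide [phi] by a smooth bump [th] that is positive on a neighbourhood of the
    support, approximate the quotient, which is still continuously differentiable, by a
    Bernstein polynomial, and multiply by [th] again. The product is smooth,
    nonnegative, vanishes outside the open cube and is close to [phi] with its
    gradient. *)
Lemma C1_test_approx (x0 : V) (R1 R2 e : R) (phi : V -> R) g :
  R1 < R2 -> 0 < R2 -> 0 < e -> C1with setT phi g -> (forall x, 0 <= phi x) ->
  (forall x, ~ cube x0 R1 x -> phi x = 0) ->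
  (forall x i, ~ cube x0 R1 x -> g i x = 0) ->
  exists psi, [/\ smooth psi, forall x, 0 <= psi x,
    forall x, ~ open_cube x0 R2 x -> psi x = 0,
    forall x, `|psi x - phi x| <= e &
    forall x i, `|partial i psi x - g i x| <= e].
Proof.
move=> R12 R20 e0 phiC phi0 phiK gK.
pose th := bump x0 R2; have sth : smooth th by exact: bump_smooth.
have thC := smooth_C1with sth.
have cth : continuous th by move=> x; exact: (C1with_continuous openT thC).
have cdth i : continuous (partial i th) by move=> x; have [] := thC x Logic.I i.
pose O := open_cube x0 R2; have oO : open O by exact: open_open_cube.
have KO : cube x0 R1 `<=` O by move=> x xK i; exact: le_lt_trans (xK i) R12.
pose f x := phi x * (th x)^-1.
pose gf i x := phi x * (- (th x) ^- 2 * partial i th x) + (th x)^-1 * g i x.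
have fC : C1with setT f gf.
  apply: (C1with_glue oO (@closed_cube R N x0 R1) KO).
  - apply: (C1withM oO); first exact: C1with_sub (@subsetT _ O) phiC.
    apply: (C1with_comp (F := fun t : R => t^-1) (F' := fun t : R => - t ^- 2) oO).
      exact: C1with_sub (@subsetT _ O) thC.
    move=> x Ox; have tn : th x != 0 by rewrite gt_eqF// bump_gt0.
    split.
      have := @is_deriveV R id (th x) 1 1 tn (is_derive_id (th x) 1).
      by rewrite /GRing.scale /= mulr1.
    apply: continuousN; apply: (@continuous_comp _ _ _ (fun t : R => t ^+ 2) (fun t : R => t^-1)).
      exact: exprn_continuous.
    by apply: inv_continuous; rewrite expf_neq0.
  - by move=> x xK; rewrite /f phiK// mul0r.
  - by move=> x i xK; rewrite /gf phiK// gK// mul0r mulr0 addr0.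
have [T0 T00 HT0] := bounded_in_cube (fun x (_ : cube x0 R2 x) => cth x).
have /choice[T1 HT1] : forall i, exists M : R, 0 <= M /\ forall x, cube x0 R2 x -> `|partial i th x| <= M.
  by move=> i; have [M M0 H] := bounded_in_cube (fun x (_ : cube x0 R2 x) => cdth i x); exists M.
pose T := 1 + T0 + \sum_i T1 i.
have T1T i : T1 i <= T.
  rewrite /T (bigD1 i)//= addrCA lerDl !addr_ge0// sumr_ge0// => j _.
  by have [] := HT1 j.
have sT1 : 0 <= \sum_i T1 i by rewrite sumr_ge0// => j _; have [] := HT1 j.
have Tgt0 : 0 < T by rewrite /T; lra.
have T0T : T0 <= T by rewrite /T; lra.
pose e' := e / (2 * T).
have e'0 : 0 < e' by rewrite divr_gt0// mulr_gt0.
have [s [ss sf sg s0]] := C1_bernstein x0 R20 e'0 fC.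
have f0 x : 0 <= f x by rewrite mulr_ge0// invr_ge0 bump_ge0.
pose psi := sum_of_products (bump_mul x0 R2 s).
have psiE x : psi x = th x * sum_of_products s x by exact: bump_mulE.
have spsi : smooth psi by apply: sum_of_products_smooth; exact: bump_mul_smooth.
have OS x : O x -> cube x0 R2 x by move=> Ox i; exact: ltW (Ox i).
have th0 x : ~ O x -> th x = 0 by exact: bump_eq0.
have th_ge0 x : 0 <= th x by exact: bump_ge0.
have psi0 x : 0 <= psi x.
  rewrite psiE; have [Ox|Ox] := pselect (O x); last by rewrite th0// mul0r.
  by rewrite mulr_ge0//; apply: s0 => //; exact: OS.
have psiO x : ~ O x -> psi x = 0 by move=> Ox; rewrite psiE th0// mul0r.
have nOK x : ~ O x -> ~ cube x0 R1 x by move=> h /KO.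
have bnd (a b c d : R) : `|a| <= T -> `|b| <= e' -> `|c| <= T -> `|d| <= e' ->
    `|a * b + c * d| <= e.
  move=> ha hb hc hd; rewrite (le_trans (ler_normD _ _))// !normrM.
  apply: (@le_trans _ _ (T * e' + T * e')); last first.
    by rewrite /e' le_eqVlt; apply/orP; left; apply/eqP; field; rewrite gt_eqF.
  by apply: lerD; apply: ler_pM.
exists psi; split => //.
- move=> x; have [Ox|Ox] := pselect (O x); last first.
    by rewrite psiO// phiK ?subrr ?normr0 ?ltW//; exact: nOK.
  have tn : th x != 0 by rewrite gt_eqF// bump_gt0.
  have := bnd (th x) (sum_of_products s x - f x) 0 0.
  rewrite mul0r addr0 psiE mulrBr {2}/f (mulrC (phi x)) mulrA mulfV// mul1r.
  rewrite normr0; apply => //; try exact: ltW.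
    by rewrite (le_trans (HT0 _ (OS _ Ox))).
  by apply: sf; exact: OS.
- move=> x i; have psiC := smooth_C1with spsi.
  have [Ox|Ox] := pselect (O x); last first.
    rewrite (gK _ _ (nOK _ Ox)) subr0.
    have dpsi y : is_derive y (delta_mx ord0 i) psi (partial i psi y).
      by have [] := psiC y Logic.I i.
    by rewrite (is_derive_min dpsi psi0 (psiO _ Ox)) normr0 ltW.
  have tn : th x != 0 by rewrite gt_eqF// bump_gt0.
  have Ps := smooth_C1with (sum_of_products_smooth ss).
  have psiC' := C1withM openT thC Ps.
  have E : psi = fun x => th x * sum_of_products s x by apply/funext.
  rewrite E (partialE i psiC' Logic.I).
  have -> : g i x = th x * gf i x + f x * partial i th x.
    rewrite /gf /f; field; exact: tn.
  rewrite (_ : _ - _ = th x * (partial i (sum_of_products s) x - gf i x) +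
     partial i th x * (sum_of_products s x - f x)); last by ring.
  have [_ HTi] := HT1 i.
  apply: bnd.
  + by rewrite (le_trans (HT0 _ (OS _ Ox))).
  + by apply: sg; exact: OS.
  + by rewrite (le_trans (HTi _ (OS _ Ox))).
  + by apply: sf; exact: OS.
Qed.

End density.

(** * The weak inequality for continuously differentiable test functions *)

Section weak_C1.
Context {R : realType} {N : nat}.
Local Notation V := 'rV[R]_N.
Local Notation LN := (@lebesgueN R N).
Implicit Types x : V.

Lemma Rintegral_support (A Q : set V) (f : V -> R) : Q `<=` A ->
  (forall x, ~ Q x -> f x = 0) -> \int[LN]_(x in A) f x = \int[LN]_(x in Q) f x.
Proof.
move=> QA f0; rewrite [LHS]Rintegral_mkcond [RHS]Rintegral_mkcond.
congr (Rintegral _ _ _); apply/funext => x; rewrite !patchE.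
case: ifPn => [_|xA]; case: ifPn => [|xQ] //.
  by move/negP: xQ; rewrite inE => /f0.
by rewrite inE => /QA h; move/negP: xA; rewrite inE.
Qed.

(** The integrand of the weak inequality tested with a function [phi] of gradient [g];
    here [b] stands for the difference of the two p-Laplacian fluxes and [w] for [v -
    u]. *)
Definition flux (b : 'I_N -> V -> R) (w : V -> R) (Lambda : R) g phi x : R :=
  \sum_i b i x * g i x - Lambda * (w x * phi x).

Section limit.
Variables (x0 : V) (R1 R2 Lambda M : R) (b : 'I_N -> V -> R) (w : V -> R).
Hypotheses (R12 : R1 < R2) (R20 : 0 < R2).
Let Q := cube x0 R2.
Hypotheses (mb : forall i, measurable_fun Q (b i)) (mw : measurable_fun Q w).
Hypotheses (bM : forall i x, Q x -> `|b i x| <= M) (wM : forall x, Q x -> `|w x| <= M).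

Lemma flux_integrable (phi : V -> R) g : C1with setT phi g ->
  LN.-integrable Q (EFin \o flux b w Lambda g phi).
Proof.
move=> phiC.
have cphi x : {for x, continuous phi} by exact: (C1with_continuous openT phiC).
have cg i x : {for x, continuous (g i)} by have [] := phiC x Logic.I i.
have mphi : measurable_fun Q phi.
  by apply: measurable_funTS; apply: continuous_measurable_rV => //; exact: openT.
have mg i : measurable_fun Q (g i).
  by apply: measurable_funTS; apply: continuous_measurable_rV => //; exact: openT.
have [Mp Mp0 Hp] := @bounded_in_cube R N phi x0 R2 (fun x _ => cphi x).
have /choice[Mg HMg] : forall i, exists M : R, 0 <= M /\ forall x, Q x -> `|g i x| <= M.
  by move=> i; have [M' M0 H] := @bounded_in_cube R N (g i) x0 R2 (fun x _ => cg i x); exists M'.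
apply: (@bounded_integrable_cube _ _ _ _ _ (\sum_i M * Mg i + `|Lambda| * (M * Mp))).
- exact: ltW.
- apply: measurable_funB.
    by apply: measurable_sum => i; apply: measurable_funM.
  by apply: measurable_funM => //; apply: measurable_funM.
- move=> x Qx; rewrite (le_trans (ler_normB _ _))// lerD//.
    rewrite (le_trans (ler_norm_sum _ _ _))//; apply: ler_sum => i _.
    by rewrite normrM ler_pM// ?bM//; have [_ H] := HMg i; exact: H.
  by rewrite !normrM ler_wpM2l// ler_pM ?wM ?Hp.
Qed.

(** The flux is integrated against [phi] and its gradient with bounded coefficients, so
    the inequality passes to the uniform limit of smooth test functions. *)
Lemma weak_limit (phi : V -> R) g :
  (forall psi, smooth psi -> (forall x, 0 <= psi x) ->
     (forall x, ~ open_cube x0 R2 x -> psi x = 0) ->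
     \int[LN]_(x in Q) flux b w Lambda (fun i => partial i psi) psi x <= 0) ->
  C1with setT phi g -> (forall x, 0 <= phi x) ->
  (forall x, ~ cube x0 R1 x -> phi x = 0) ->
  (forall x i, ~ cube x0 R1 x -> g i x = 0) ->
  \int[LN]_(x in Q) flux b w Lambda g phi x <= 0.
Proof.
move=> weak phiC phi0 phiK gK; apply/ler_addgt0Pr => e e0; rewrite add0r.
have M0 : 0 <= M.
  have /bM : Q x0 by move=> i; rewrite subrr normr0 ltW.
  have /wM : Q x0 by move=> i; rewrite subrr normr0 ltW.
  by move/(le_trans _) => h _; apply: h.
pose V0 : R := (2 * R2) ^+ N.
have V00 : 0 < V0 by rewrite exprn_gt0// mulr_gt0.
pose T := (N%:R * M + `|Lambda| * M + 1) * V0.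
have T0 : 0 < T.
  by rewrite mulr_gt0// ltr_wpDl// addr_ge0// mulr_ge0.
have d0 : 0 < e / T by rewrite divr_gt0.
have [psi [spsi psi0 psiO psiphi psig]] := C1_test_approx R12 R20 d0 phiC phi0 phiK gK.
have psiC := smooth_C1with spsi.
have iphi := flux_integrable phiC; have ipsi := flux_integrable psiC.
have mQ : measurable Q by exact: measurable_cube.
have := weak psi spsi psi0 psiO.
suff : \int[LN]_(x in Q) flux b w Lambda g phi x -
  \int[LN]_(x in Q) flux b w Lambda (fun i => partial i psi) psi x <= e by lra.
rewrite -RintegralB//.
have ic : LN.-integrable Q (EFin \o cst (e / V0)).
  by apply: (@bounded_integrable_cube _ _ _ _ _ `|e / V0|) => //; exact: ltW.
have -> : e = \int[LN]_(x in Q) (e / V0).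
  rewrite Rintegral_cst// (_ : fine _ = V0); last first.
    by rewrite [X in fine X](lebesgueN_cube x0 (ltW R20)).
  by rewrite divfK// gt_eqF.
apply: le_Rintegral => //; first exact: (integrableB mQ iphi ipsi).
move=> x Qx /=; apply: (le_trans (ler_norm _)).
have -> : flux b w Lambda g phi x - flux b w Lambda (fun i => partial i psi) psi x =
   \sum_i b i x * (g i x - partial i psi x) - Lambda * (w x * (phi x - psi x)).
  rewrite /flux.
  have -> : \sum_i b i x * (g i x - partial i psi x) =
     \sum_i b i x * g i x - \sum_i b i x * partial i psi x.
    by rewrite -sumrB; apply: eq_bigr => i _; ring.
  ring.
rewrite (le_trans (ler_normB _ _))//.
apply: (@le_trans _ _ (N%:R * M * (e / T) + `|Lambda| * M * (e / T))).
  apply: lerD.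
    rewrite (le_trans (ler_norm_sum _ _ _))//.
    apply: (@le_trans _ _ (\sum_(i < N) M * (e / T))).
      by apply: ler_sum => i _; rewrite normrM ler_pM ?bM// distrC.
    by rewrite sumr_const card_ord -mulrA mulr_natl.
  rewrite !normrM -mulrA ler_wpM2l// ler_pM// ?wM//.
  by rewrite distrC.
rewrite -mulrDl /T.
have -> : e / V0 = (N%:R * M + `|Lambda| * M + 1) * (e / ((N%:R * M + `|Lambda| * M + 1) * V0)).
  have h : N%:R * M + `|Lambda| * M + 1 != 0.
    by rewrite gt_eqF// ltr_wpDl// addr_ge0// mulr_ge0.
  by field; rewrite h gt_eqF.
by rewrite ler_wpM2r ?(ltW d0)// lerDl.
Qed.

End limit.

Lemma test_fun_cube (Omega : set V) x0 R2 psi : cube x0 R2 `<=` Omega -> smooth psi ->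
  (forall x, ~ open_cube x0 R2 x -> psi x = 0) -> test_fun Omega psi.
Proof.
move=> QO spsi psiO.
have sub : [set x | psi x != 0] `<=` cube x0 R2.
  move=> x /= /eqP px; have [Ox|Ox] := pselect (open_cube x0 R2 x).
    by move=> i; exact: ltW (Ox i).
  by exfalso; apply: px; exact: psiO.
have csub : closure [set x | psi x != 0] `<=` cube x0 R2.
  move=> y /(closure_subset sub); rewrite -(iffLR (closure_id _)) //.
  exact: closed_cube.
split => //; last exact: subset_trans csub QO.
apply: (subclosed_compact _ (@compact_cube _ _ x0 R2) csub).
exact: closed_closure.
Qed.

End weak_C1.

(** * Euclidean norm and power inequalities *)

Section vector_inequalities.
Context {R : realType} {N : nat}.
Local Notation V := 'rV[R]_N.
Implicit Types x y : V.

Lemma dotv_ge0 x : 0 <= dotv x x.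
Proof. by apply: sumr_ge0 => i _; rewrite -expr2 sqr_ge0. Qed.

Lemma sqr_enorm x : enorm x ^+ 2 = dotv x x.
Proof. by rewrite sqr_sqrtr// dotv_ge0. Qed.

Lemma enorm_ge0 x : 0 <= enorm x. Proof. exact: sqrtr_ge0. Qed.

Lemma enorm0_eq0 x : enorm x = 0 -> x = 0.
Proof.
move=> x0; have /psumr_eq0P H : dotv x x = 0 by rewrite -sqr_enorm x0 expr0n.
apply/rowP => i; rewrite mxE; apply/eqP; rewrite -sqrf_eq0 expr2; apply/eqP; apply: H => // j _.
by rewrite -expr2 sqr_ge0.
Qed.

Lemma dotv_comb (a b : R) x y :
  dotv (a *: x + b *: y) (a *: x + b *: y) =
  a ^+ 2 * dotv x x + 2 * a * b * dotv x y + b ^+ 2 * dotv y y.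
Proof.
rewrite /dotv !mulr_sumr -!big_split /=; apply: eq_bigr => i _; rewrite !mxE; ring.
Qed.

Lemma dotv_le_enorm x y : dotv x y <= enorm x * enorm y.
Proof.
have [y0|yn] := eqVneq (enorm y) 0.
  rewrite y0 mulr0 (enorm0_eq0 y0) /dotv big1// => i _; by rewrite mxE mulr0.
have [x0|xn] := eqVneq (enorm x) 0.
  rewrite x0 mul0r (enorm0_eq0 x0) /dotv big1// => i _; by rewrite mxE mul0r.
have xp : 0 < enorm x by rewrite lt_def xn enorm_ge0.
have yp : 0 < enorm y by rewrite lt_def yn enorm_ge0.
have := dotv_ge0 (enorm y *: x + (- enorm x) *: y).
rewrite dotv_comb -!sqr_enorm; set s := enorm x in xp *; set t := enorm y in yp *.
have -> : t ^+ 2 * s ^+ 2 + 2 * t * - s * dotv x y + (- s) ^+ 2 * t ^+ 2 =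
   (2 * (s * t)) * (s * t - dotv x y) by ring.
by rewrite pmulr_rge0 ?subr_ge0// !mulr_gt0.
Qed.

Lemma norm_dotv_le x y : `|dotv x y| <= enorm x * enorm y.
Proof.
rewrite ler_norml dotv_le_enorm andbT lerNl.
have -> : - dotv x y = dotv (- x) y.
  by rewrite /dotv -sumrN; apply: eq_bigr => i _; rewrite mxE mulNr.
rewrite (le_trans (dotv_le_enorm _ _))// (_ : enorm (- x) = enorm x)//.
by congr Num.sqrt; apply: eq_bigr => i _; rewrite !mxE mulrNN.
Qed.

Lemma enormD x y : enorm (x + y) <= enorm x + enorm y.
Proof.
rewrite -(@ler_pXn2r _ 2) ?nnegrE ?addr_ge0 ?enorm_ge0//.
rewrite sqr_enorm -[x]scale1r -[y]scale1r dotv_comb !scale1r -!sqr_enorm sqrrD.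
have := dotv_le_enorm x y; lra.
Qed.

Lemma enormZ a x : enorm (a *: x) = `|a| * enorm x.
Proof.
rewrite /enorm (_ : dotv _ _ = a ^+ 2 * dotv x x).
  by rewrite sqrtrM ?sqr_ge0// sqrtr_sqr.
by rewrite /dotv mulr_sumr; apply: eq_bigr => i _; rewrite !mxE; ring.
Qed.

Lemma enormB_sym x y : enorm (x - y) = enorm (y - x).
Proof. by rewrite -opprB -scaleN1r enormZ normrN1 mul1r. Qed.

Lemma coord_le_enorm x i : `|x ord0 i| <= enorm x.
Proof.
rewrite -(sqrtr_sqr (x ord0 i)) ler_wsqrtr// /dotv (bigD1 i)//= -expr2 lerDl.
by apply: sumr_ge0 => j _; rewrite -expr2 sqr_ge0.
Qed.

Lemma enorm_le_coord x (s : R) : 0 <= s -> (forall i, `|x ord0 i| <= s) -> enorm x <= N%:R * s.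
Proof.
move=> s0 xs; rewrite -(@ler_pXn2r _ 2) ?nnegrE ?enorm_ge0 ?mulr_ge0// sqr_enorm.
apply: (@le_trans _ _ (N%:R * s ^+ 2)).
  rewrite /dotv mulr_natl -[in leRHS](card_ord N) -sumr_const; apply: ler_sum => i _.
  by rewrite -expr2 -real_normK ?num_real// lerXn2r ?nnegrE.
rewrite exprMn ler_wpM2r ?sqr_ge0// expr2 -natrM ler_nat; nia.
Qed.

(** Bernoulli's inequality; with a large natural exponent it replaces the mean value
    theorem for real powers below. *)
Lemma bernoulli_nat (t : R) k : 0 <= t -> t <= 1 -> 1 - t ^+ k <= k%:R * (1 - t).
Proof.
move=> t0 t1; elim: k => [|k IH]; first by rewrite expr0 subrr mul0r.
rewrite exprS -natr1; have : t ^+ k <= 1 by rewrite exprn_ile1.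
nra.
Qed.

Lemma powR_le_exp (t m : R) k : 0 < t -> t <= 1 -> m <= k%:R -> t ^+ k <= t `^ m.
Proof.
move=> t0 t1 mk; rewrite -powR_mulrn ?(ltW t0)//.
by apply: ger_powR => //; rewrite t0 t1.
Qed.

(** By homogeneity one may take [s = 1]: the claim is then that [`|1 - t `^ q| * t] is
    at most a constant times [1 - t]. For [t `^ q >= 1] this holds because [t `^ (q + 1)
    <= 1], otherwise by Bernoulli's inequality. *)
Lemma powR_diff_le (q s t : R) k : -1 < q -> q <= k%:R -> 0 < s -> 0 <= t -> t <= s ->
  `|s `^ q - t `^ q| * t <= (k%:R + 1) * s `^ q * (s - t).
Proof.
move=> q1 qk s0 t0 ts; have A0 : 0 < s `^ q by rewrite powR_gt0.
have [->|tn] := eqVneq t 0.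
  by rewrite mulr0 subr0 !mulr_ge0// ltW.
have tp : 0 < t by rewrite lt_def tn.
pose tau := t / s; have tE : t = s * tau by rewrite /tau mulrC divfK// gt_eqF.
have tau0 : 0 < tau by rewrite divr_gt0.
have tau1 : tau <= 1 by rewrite ler_pdivrMr// mul1r.
rewrite tE powRM ?(ltW s0) ?(ltW tau0)//.
have -> : s `^ q - s `^ q * tau `^ q = s `^ q * (1 - tau `^ q) by ring.
rewrite normrM (gtr0_norm A0).
have -> : s - s * tau = s * (1 - tau) by ring.
rewrite (_ : _ * (s * tau) = (s `^ q * s) * (`|1 - tau `^ q| * tau)); last by ring.
rewrite (_ : _ * (s * (1 - tau)) = (s `^ q * s) * ((k%:R + 1) * (1 - tau))); last by ring.
rewrite ler_wpM2l ?mulr_ge0 ?(ltW s0) ?(ltW A0)//.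
have k0 : 0 <= k%:R :> R by [].
have [h|h] := leP 1 (tau `^ q).
  rewrite ler0_norm ?subr_le0// opprB mulrBl mul1r mulrC.
  have : tau * tau `^ q <= 1.
    have := mulr_powRB1 (ltW tau0) (_ : 0 < q + 1).
    rewrite addrK => ->; last by lra.
    by rewrite -[leRHS](powRr0 tau) ger_powR ?tau0//; lra.
  nra.
rewrite gtr0_norm ?subr_gt0//.
have := powR_le_exp tau0 tau1 qk; have := bernoulli_nat k (ltW tau0) tau1.
have := powR_ge0 tau q; nra.
Qed.

(** The right side is the scalar product of [|x|^q x - |y|^q y] with [x - y], expressed
    by the norms [s] and [t] and by [d = |x - y|^2]. If [t `^ q <= s `^ q], both terms
    are nonnegative and the first one suffices; otherwise the second term is negative,
    but is controlled by the monotonicity of [r |-> r `^ (q + 1)]. *)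
Lemma powR_mono_ge (q s t d : R) k : -1 < q -> 1 <= k%:R * (q + 1) -> 0 < s -> 0 <= t -> t <= s ->
  (s - t) ^+ 2 <= d ->
  (2 * k%:R)^-1 * s `^ q * d <=
  2^-1 * (s `^ q + t `^ q) * d + 2^-1 * (s `^ q - t `^ q) * (s ^+ 2 - t ^+ 2).
Proof.
move=> q1 qk s0 t0 ts hd; have A0 : 0 < s `^ q by rewrite powR_gt0.
have T0 : 0 <= t `^ q by exact: powR_ge0.
have kp : 0 < k%:R :> R.
  by rewrite ltr0n lt0n; apply/eqP => k0; move: qk; rewrite k0 mul0r ler10.
have k1 : 1 <= k%:R :> R by rewrite ler1n -(ltr0n R k).
have d0 : 0 <= d by rewrite (le_trans _ hd)// sqr_ge0.
have c1 : (0 < (2 * k%:R)^-1 :> R) && ((2 * k%:R)^-1 <= 2^-1 :> R).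
  rewrite invr_gt0 mulr_gt0//= lef_pV2 ?posrE ?mulr_gt0//; lra.
have [TA|TA] := leP (t `^ q) (s `^ q).
  have h : 0 <= (s `^ q - t `^ q) * (s ^+ 2 - t ^+ 2).
    by rewrite mulr_ge0 ?subr_ge0// lerXn2r ?nnegrE// ltW.
  have h1 : (2 * k%:R)^-1 * (s `^ q * d) <= 2^-1 * (s `^ q * d).
    by rewrite ler_wpM2r ?mulr_ge0 ?(ltW A0)//; case/andP: c1.
  have := mulr_ge0 T0 d0; nra.
have tn : t != 0.
  apply/eqP => t00; move: TA; rewrite t00; have [->|qn] := eqVneq q 0.
    by rewrite !powRr0 ltxx.
  by rewrite (powR0 qn) ltNge (ltW A0).
have tp : 0 < t by rewrite lt_def tn.
pose tau := t / s; have tE : t = s * tau by rewrite /tau mulrC divfK// gt_eqF.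
have tau0 : 0 < tau by rewrite divr_gt0.
have tau1 : tau <= 1 by rewrite ler_pdivrMr// mul1r.
clearbody tau; set m := q + 1 in qk; have m0 : 0 < m by rewrite /m; lra.
have key : 1 - tau <= k%:R * (1 - tau `^ m).
  have h1 : tau `^ m <= 1 by rewrite -[leRHS](powRr0 tau) ger_powR ?tau0// ltW.
  have := bernoulli_nat k (powR_ge0 tau m) h1.
  apply: le_trans; rewrite lerD2l lerN2 -powR_mulrn ?powR_ge0// -powRrM.
  by rewrite -[leRHS]powRr1 ?(ltW tau0)// ger_powR ?tau0// mulrC.
have E1 : s `^ q * s = s `^ m.
  by rewrite -(mulr_powRB1 (ltW s0) m0) /m addrK mulrC.
have E2 : t `^ q * t = s `^ m * tau `^ m.
  by rewrite -powRM ?ltW// -tE -(mulr_powRB1 (ltW tp) m0) /m addrK mulrC.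
have main : k%:R^-1 * s `^ q * (s - t) <= s `^ q * s - t `^ q * t.
  rewrite E1 E2 (_ : s `^ m - _ = s `^ m * (1 - tau `^ m)); last by ring.
  have E3 : s `^ q * (s - t) = s `^ m * (1 - tau) by rewrite -E1 [in LHS]tE; ring.
  by rewrite -mulrA E3 mulrCA ler_wpM2l ?powR_ge0// ler_pdivrMl.
move: main E1 E2; set A := s `^ q in A0 TA *; set T := t `^ q in T0 TA * => main _ _.
have -> : (2 * k%:R)^-1 = 2^-1 * k%:R^-1 :> R by rewrite invfM.
set c := k%:R^-1 in main *; have cb : 0 < c <= 1 by rewrite /c invr_gt0 kp invf_le1.
have [c0 c1'] := andP cb.
have h : (T - A) * ((s - t) * (s + t)) <= (A + T - c * A) * (s - t) ^+ 2.
  rewrite (_ : _ * (_ * _) = (T - A) * (s + t) * (s - t)); last by ring.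
  rewrite (_ : _ * (s - t) ^+ 2 = (A + T - c * A) * (s - t) * (s - t)); last by ring.
  rewrite ler_wpM2r ?subr_ge0//.
  have : 0 <= c * A * (s - t) by rewrite !mulr_ge0 ?subr_ge0// ltW.
  lra.
have h2 : (A + T - c * A) * (s - t) ^+ 2 <= (A + T - c * A) * d.
  rewrite ler_wpM2l// -addrA addrC -addrA addr_ge0// addrC subr_ge0.
  by rewrite ler_piMl// ltW.
have -> : s ^+ 2 - t ^+ 2 = (s - t) * (s + t) by ring.
have := le_trans h h2; lra.
Qed.

End vector_inequalities.

(** * Monotonicity and growth of the p-Laplacian flux *)

Section pflux_bounds.
Context {R : realType} {N : nat}.
Local Notation V := 'rV[R]_N.
Implicit Types x y : V.

(** When [t <= s], the sum [s + t] lies between [s] and [2 * s]. *)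
Lemma powR_sum_comparable (q s t : R) : 0 < s -> 0 <= t -> t <= s ->
  (s + t) `^ q <= 2 `^ `|q| * s `^ q /\ s `^ q <= 2 `^ `|q| * (s + t) `^ q.
Proof.
move=> s0 t0 ts.
pose r := (s + t) / s.
have r1 : 1 <= r by rewrite ler_pdivlMr// mul1r lerDl.
have r2 : r <= 2 by rewrite ler_pdivrMr//; lra.
have r0 : 0 < r by rewrite (lt_le_trans ltr01).
have E : s + t = s * r by rewrite /r mulrC divfK// gt_eqF.
rewrite E powRM ?(ltW s0) ?(ltW r0)//.
have b1 : r `^ q <= 2 `^ `|q|.
  apply: (@le_trans _ _ (r `^ `|q|)); first by rewrite ler_powR// ler_norm.
  by apply: ge0_ler_powR; rewrite ?nnegrE ?(ltW r0).
have b2 : r `^ (- q) <= 2 `^ `|q|.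
  apply: (@le_trans _ _ (r `^ `|q|)); first by rewrite ler_powR// -normrN ler_norm.
  by apply: ge0_ler_powR; rewrite ?nnegrE ?(ltW r0).
split; first by rewrite mulrC ler_wpM2r ?powR_ge0.
rewrite mulrCA ler_peMr ?powR_ge0//.
have rq : 0 < r `^ q by rewrite powR_gt0.
by rewrite -ler_pdivrMr// mul1r -powRN.
Qed.

(** Polarisation: the scalar product depends on [x] and [y] through their norms and
    their distance only. *)
Lemma dotvBB x y (A B : R) :
  let d := enorm (x - y) ^+ 2 in
  dotv (A *: x - B *: y) (x - y) =
  2^-1 * (A + B) * d + 2^-1 * (A - B) * (enorm x ^+ 2 - enorm y ^+ 2).
Proof.
move=> /=; rewrite !sqr_enorm.
have -> : dotv (x - y) (x - y) = dotv x x - 2 * dotv x y + dotv y y.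
  by have := dotv_comb 1 (-1) x y; rewrite !scale1r !scaleN1r => ->; ring.
have -> : dotv (A *: x - B *: y) (x - y) = A * dotv x x - (A + B) * dotv x y + B * dotv y y.
  rewrite /dotv !mulr_sumr -sumrB -big_split /=; apply: eq_bigr => i _; rewrite !mxE; ring.
by field.
Qed.

Lemma enorm_dist x y : (enorm x - enorm y) ^+ 2 <= enorm (x - y) ^+ 2.
Proof.
rewrite -[leLHS]real_normK ?num_real// lerXn2r ?nnegrE ?enorm_ge0//.
rewrite ler_norml; apply/andP; split.
  have := enormD (y - x) x; rewrite subrK enormB_sym; lra.
have := enormD (x - y) y; rewrite subrK; lra.
Qed.

(** The two structural inequalities of the p-Laplacian. By symmetry [enorm y <= enorm
    x], and then the weight is comparable with [enorm x `^ (p - 2)], which reduces both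
    claims to the scalar inequalities [powR_mono_ge] and [powR_diff_le]. *)
Lemma pflux_bounds (p : R) : 1 < p -> exists c1 c2 : R, [/\ 0 < c1, 0 < c2 &
  forall x y, let rho := (enorm x + enorm y) `^ (p - 2) in
   c1 * rho * enorm (x - y) ^+ 2 <= dotv (pflux p x - pflux p y) (x - y) /\
   enorm (pflux p x - pflux p y) <= c2 * rho * enorm (x - y)].
Proof.
move=> p1; set q := p - 2; have q1 : -1 < q by rewrite /q; lra.
(* Natural numbers that dominate [q] and the inverse of [q + 1]. *)
pose k1 := Num.bound `|q|; pose k2 := Num.bound (`|p - 1|^-1).
have k1q : q <= k1%:R.
  by rewrite (le_trans (ler_norm _))// ltW// archi_boundP.
have qp0 : 0 < q + 1 by rewrite /q; lra.
have k2q : 1 <= k2%:R * (q + 1).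
  rewrite -ler_pdivrMr// mul1r.
  have -> : q + 1 = `|p - 1| by rewrite ger0_norm /q; lra.
  by rewrite ltW// archi_boundP// invr_ge0.
pose K : R := 2 `^ `|q|; have K0 : 0 < K by rewrite powR_gt0.
have k20 : 0 < k2%:R :> R.
  by rewrite ltr0n lt0n; apply/eqP => k0; move: k2q; rewrite k0 mul0r ler10.
pose c1 := (2 * k2%:R)^-1 / K; pose c2 := (k1%:R + 2) * K.
have c10 : 0 < c1 by rewrite divr_gt0// invr_gt0 mulr_gt0.
have c20 : 0 < c2 by rewrite mulr_gt0// ltr_wpDl.
exists c1, c2; split=> //.
suff H x y : enorm y <= enorm x ->
   c1 * (enorm x + enorm y) `^ q * enorm (x - y) ^+ 2 <= dotv (pflux p x - pflux p y) (x - y) /\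
   enorm (pflux p x - pflux p y) <= c2 * (enorm x + enorm y) `^ q * enorm (x - y).
  move=> x y /=; case: (leP (enorm y) (enorm x)) => [|/ltW] xy; first exact: H.
  have [h1 h2] := H y x xy; rewrite (addrC (enorm x)) (enormB_sym x) (enormB_sym (pflux p x)).
  split => //; rewrite (le_trans h1)// le_eqVlt; apply/orP; left; apply/eqP.
  rewrite /dotv; apply: eq_bigr => i _; rewrite !mxE; ring.
move=> yx; have y0 := enorm_ge0 y.
have [x0|xn] := eqVneq (enorm x) 0.
  have y00 : enorm y = 0 by apply/eqP; rewrite eq_le y0 -x0 yx.
  rewrite (enorm0_eq0 x0) (enorm0_eq0 y00) /pflux !scaler0 !subr0.
  have e0 : enorm (0 : V) = 0 by rewrite -(enorm0_eq0 x0).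
  rewrite e0 expr0n /= !mulr0; split => //.
  by rewrite /dotv sumr_ge0// => i _; rewrite mxE mul0r.
have x0 : 0 < enorm x by rewrite lt_def xn enorm_ge0.
have [S1 S2] := powR_sum_comparable q x0 y0 yx; rewrite -/K in S1 S2.
have d0 : 0 <= enorm (x - y) ^+ 2 by exact: sqr_ge0.
split.
  rewrite /pflux -/q dotvBB; apply: le_trans (powR_mono_ge q1 k2q x0 y0 yx (enorm_dist x y)).
  rewrite ler_wpM2r// /c1 -mulrA ler_wpM2l ?invr_ge0 ?mulr_ge0 ?(ltW k20)//.
  by rewrite ler_pdivrMl.
have E : pflux p x - pflux p y = (enorm x `^ q) *: (x - y) + (enorm x `^ q - enorm y `^ q) *: y.
  by rewrite /pflux -/q scalerBr scalerBl addrA subrK.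
rewrite E (le_trans (enormD _ _))// !enormZ [X in X * _ + _]ger0_norm ?powR_ge0//.
have h := powR_diff_le q1 k1q x0 y0 yx.
have xyd : enorm x - enorm y <= enorm (x - y).
  have := enormD (x - y) y; rewrite subrK; lra.
have A0 : 0 < enorm x `^ q by rewrite powR_gt0.
apply: (@le_trans _ _ ((k1%:R + 2) * (enorm x `^ q) * enorm (x - y))); last first.
  rewrite ler_wpM2r ?enorm_ge0// /c2 -mulrA ler_wpM2l// addr_ge0//.
have : (k1%:R + 1) * enorm x `^ q * (enorm x - enorm y) <= (k1%:R + 1) * enorm x `^ q * enorm (x - y).
  by rewrite ler_wpM2l// mulr_ge0 ?(ltW A0)// addr_ge0.
move=> h2; have := le_trans h h2; lra.
Qed.

Lemma measurable_enorm (D : set V) (F : V -> V) :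
  (forall i, measurable_fun D (fun z => F z ord0 i)) ->
  measurable_fun D (fun z => enorm (F z)).
Proof.
move=> mF; rewrite (_ : (fun z => _) = (fun t : R => t `^ 2^-1) \o (fun z => dotv (F z) (F z))).
  apply: measurableT_comp; first exact: measurable_powR.
  by apply: measurable_sum => i; apply: measurable_funM.
by apply/funext => z /=; rewrite powR12_sqrt// dotv_ge0.
Qed.

Lemma measurable_pflux (p : R) (D : set V) (F : V -> V) i :
  (forall i, measurable_fun D (fun z => F z ord0 i)) ->
  measurable_fun D (fun z => pflux p (F z) ord0 i).
Proof.
move=> mF; rewrite (_ : (fun z => _) = fun z => enorm (F z) `^ (p - 2) * F z ord0 i).
  apply: measurable_funM => //.
  apply: (measurableT_comp (@measurable_powR R (p - 2))); exact: measurable_enorm.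
by apply/funext => z; rewrite mxE.
Qed.

Lemma pflux_coord_le (p M : R) x i : 1 < p -> enorm x <= M -> `|pflux p x ord0 i| <= M `^ (p - 1).
Proof.
move=> p1 xM; rewrite mxE normrM ger0_norm ?powR_ge0//.
apply: (@le_trans _ _ (enorm x `^ (p - 1))); last first.
  by apply: ge0_ler_powR; rewrite ?nnegrE ?enorm_ge0 ?(le_trans _ xM) ?enorm_ge0//; lra.
have p10 : 0 < p - 1 by lra.
rewrite -(mulr_powRB1 (enorm_ge0 x) p10) mulrC (_ : p - 1 - 1 = p - 2); last by ring.
by rewrite ler_wpM2r ?powR_ge0// coord_le_enorm.
Qed.

End pflux_bounds.

(** * The logarithmic energy inequality *)

Section energy.
Context {R : realType} {N : nat}.
Local Notation V := 'rV[R]_N.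
Local Notation LN := (@lebesgueN R N).
Implicit Types x : V.

Definition sqgrad (g : 'I_N -> V -> R) x : R := \sum_i g i x ^+ 2.

Lemma sqgrad_ge0 g x : 0 <= sqgrad g x.
Proof. by apply: sumr_ge0 => i _; exact: sqr_ge0. Qed.

Lemma C1with_measurable (A Q : set V) f g : open A -> Q `<=` A -> C1with A f g -> measurable Q ->
  measurable_fun Q f /\ forall i, measurable_fun Q (g i).
Proof.
move=> oA QA fA mQ; have mA := open_rV_measurable oA; split.
  apply: (measurable_funS mA QA); apply: continuous_measurable_rV => // x Ax.
  exact: (C1with_continuous oA fA Ax).
move=> i; apply: (measurable_funS mA QA); apply: continuous_measurable_rV => // x Ax.
by have [] := fA x Ax i.
Qed.

Lemma measurable_sqgrad (Q : set V) g : (forall i, measurable_fun Q (g i)) ->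
  measurable_fun Q (sqgrad g).
Proof. by move=> mg; apply: measurable_sum => i; exact: measurable_funX. Qed.

Definition log_potential (w : V -> R) (e : R) x : R := - ln (w x + e).
Definition log_gradient (w : V -> R) (gw : 'I_N -> V -> R) (e : R) (i : 'I_N) x : R :=
  - (w x + e)^-1 * gw i x.

Lemma C1with_log (A : set V) (w : V -> R) gw (e : R) : open A -> 0 < e ->
  (forall x, A x -> 0 <= w x) -> C1with A w gw ->
  C1with A (log_potential w e) (log_gradient w gw e).
Proof.
move=> oA e0 w0 wA.
apply: (C1with_comp (F := fun s : R => - ln (s + e)) (F' := fun s : R => - (s + e)^-1) oA wA).
move=> x Ax; have we : 0 < w x + e by rewrite ltr_wpDl// w0.
split.
  have d1 : is_derive (w x) 1 (fun s : R => s + e) 1.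
    have h := is_derive_affine 1 e (w x).
    by rewrite (_ : (fun s => s + e) = (fun t => 1 * t + e))//; apply/funext => s; rewrite mul1r.
  have d2 := @is_derive1_comp _ (@ln R) (fun s : R => s + e) (w x) _ _ (is_derive1_ln we) d1.
  by apply: (is_derive_eq (is_deriveN d2)); rewrite mulr1.
apply: continuousN; apply: (@continuous_comp _ _ _ (fun s : R => s + e) (fun t : R => t^-1)).
  by apply: continuousD; [exact: cvg_id|exact: cst_continuous].
by apply: inv_continuous; rewrite gt_eqF.
Qed.

Lemma C1with_inv (A : set V) (w : V -> R) gw (e : R) : open A -> 0 < e ->
  (forall x, A x -> 0 <= w x) -> C1with A w gw ->
  C1with A (fun x => (w x + e)^-1) (fun i x => - (w x + e) ^- 2 * gw i x).
Proof.
move=> oA e0 w0 wA.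
apply: (C1with_comp (F := fun s : R => (s + e)^-1) (F' := fun s : R => - (s + e) ^- 2) oA wA).
move=> x Ax; have we : w x + e != 0 by rewrite gt_eqF// ltr_wpDl// w0.
split.
  have d1 : is_derive (w x) 1 (fun s : R => s + e) 1.
    have h := is_derive_affine 1 e (w x).
    by rewrite (_ : (fun s => s + e) = (fun t => 1 * t + e))//; apply/funext => s; rewrite mul1r.
  have := @is_deriveV R (fun s : R => s + e) (w x) 1 1 we d1.
  by rewrite /GRing.scale /= mulr1.
apply: continuousN; apply: (@continuous_comp _ _ _ (fun s : R => (s + e) ^+ 2) (fun t : R => t^-1)).
  apply: (@continuous_comp _ _ _ (fun s : R => s + e) (fun t : R => t ^+ 2)).
    by apply: continuousD; [exact: cvg_id|exact: cst_continuous].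
  exact: exprn_continuous.
by apply: inv_continuous; rewrite expf_neq0.
Qed.

(** The integrand of the energy inequality. Testing with [eta^2 H / W], where [H = h
    (z)] and [z = - ln W], produces the good term [eta^2 (H + H') |Dw|^2 / W^2], since
    differentiating [h (z) / W] in [w] gives [- (H + H') / W^2]. The cross term with the
    gradient of [eta] is absorbed by Young's inequality, and the term in [Lam] is
    harmless because [w <= W]. *)
Lemma flux_pointwise (rho eta H H' D2 E2 W w Bw Be c1 c2 Lam : R) :
  0 <= rho -> 0 <= H -> 0 <= H' -> 0 <= D2 -> 0 <= E2 -> 0 < W -> 0 <= w -> w <= W ->
  0 < c1 -> 0 < c2 -> Bw <= - (c1 * rho * D2) ->
  `|Be| <= c2 * rho * (Num.sqrt D2 * Num.sqrt E2) ->
  c1 / 2 * (rho * eta ^+ 2 * (H + H') * (D2 / W ^+ 2)) <=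
  (eta ^+ 2 * (H * (- W ^- 2) + W^-1 * (H' * - W^-1)) * Bw + (H * W^-1) * (2 * eta) * Be
    - Lam * (w * (eta ^+ 2 * (H * W^-1)))) +
  (2 * c2 ^+ 2 / c1 * (rho * E2 * H) + `|Lam| * (eta ^+ 2 * H)).
Proof.
move=> rho0 H0 H'0 D0 E0 W0 w0 wW c10 c20 hw he.
have Wn : W != 0 by rewrite gt_eqF.
pose v := Num.sqrt D2 / W; pose y := Num.sqrt E2.
have v0 : 0 <= v by rewrite divr_ge0 ?sqrtr_ge0// ltW.
have y0 : 0 <= y by exact: sqrtr_ge0.
have v2 : D2 / W ^+ 2 = v ^+ 2 by rewrite /v exprMn sqr_sqrtr// exprVn.
have y2 : E2 = y ^+ 2 by rewrite /y sqr_sqrtr.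
have t1 : c1 * (rho * eta ^+ 2 * (H + H') * v ^+ 2) <=
    eta ^+ 2 * (H * (- W ^- 2) + W^-1 * (H' * - W^-1)) * Bw.
  have -> : eta ^+ 2 * (H * (- W ^- 2) + W^-1 * (H' * - W^-1)) * Bw =
     (eta ^+ 2 * (H + H') / W ^+ 2) * (- Bw) by field.
  apply: (@le_trans _ _ ((eta ^+ 2 * (H + H') / W ^+ 2) * (c1 * rho * D2))).
    by rewrite -v2 le_eqVlt; apply/orP; left; apply/eqP; ring.
  apply: ler_wpM2l; last by rewrite lerNr.
  by apply: mulr_ge0; [rewrite mulr_ge0 ?sqr_ge0 ?addr_ge0|rewrite invr_ge0 sqr_ge0].
have t2 : - (2 * c2 * (rho * `|eta| * H * (v * y))) <= (H * W^-1) * (2 * eta) * Be.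
  rewrite lerNl; apply: (le_trans (ler_norm _)); rewrite normrN !normrM (ger0_norm H0).
  have Wi : 0 <= W^-1 by rewrite invr_ge0 ltW.
  have two0 : 0 <= 2 :> R by [].
  rewrite (ger0_norm Wi) (ger0_norm two0).
  apply: (@le_trans _ _ (H * W^-1 * (2 * `|eta|) * (c2 * rho * (Num.sqrt D2 * Num.sqrt E2)))).
    by rewrite ler_wpM2l// !mulr_ge0 ?invr_ge0// ltW.
  by rewrite /v /y le_eqVlt; apply/orP; left; apply/eqP; ring.
have t3 : - (`|Lam| * (eta ^+ 2 * H)) <= - (Lam * (w * (eta ^+ 2 * (H * W^-1)))).
  rewrite lerN2; apply: (le_trans (ler_norm _)); rewrite normrM ler_wpM2l//.
  have E : w * (eta ^+ 2 * (H * W^-1)) = (w / W) * (eta ^+ 2 * H) by ring.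
  have h0 : 0 <= eta ^+ 2 * H by rewrite mulr_ge0// sqr_ge0.
  have wW0 : 0 <= w / W by rewrite divr_ge0// ltW.
  rewrite E ger0_norm; last exact: mulr_ge0.
  by rewrite ler_piMl// ler_pdivrMr// mul1r.
(* Young's inequality, as a completed square. *)
have t4 : 2 * c2 * (rho * `|eta| * H * (v * y)) <=
    c1 / 2 * (rho * eta ^+ 2 * H * v ^+ 2) + 2 * c2 ^+ 2 / c1 * (rho * y ^+ 2 * H).
  rewrite -subr_ge0.
  have -> : c1 / 2 * (rho * eta ^+ 2 * H * v ^+ 2) + 2 * c2 ^+ 2 / c1 * (rho * y ^+ 2 * H) -
      2 * c2 * (rho * `|eta| * H * (v * y)) =
     (rho * H) * ((2 * c1)^-1 * (c1 * `|eta| * v - 2 * c2 * y) ^+ 2).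
    by rewrite -(real_normK (num_real eta)); field; rewrite gt_eqF.
  apply: mulr_ge0; first exact: mulr_ge0.
  by apply: mulr_ge0; [rewrite invr_ge0 mulr_ge0// ltW|exact: sqr_ge0].
have t5 : 0 <= c1 / 2 * (rho * eta ^+ 2 * H' * v ^+ 2).
  by apply: mulr_ge0; [rewrite divr_ge0// ltW|positivity].
rewrite v2 y2; rewrite !mulrDr ?mulrDl in t1 *; lra.
Qed.

End energy.

Section energy_integral.
Context {R : realType} {N : nat}.
Local Notation V := 'rV[R]_N.
Local Notation LN := (@lebesgueN R N).
Implicit Types x : V.

Lemma ge0_integralZl_EFinD d (T : measurableType d) (mu : {measure set T -> \bar R})
    (D : set T) (g : T -> R) (k : R) :
  measurable D -> measurable_fun D g -> (forall y, 0 <= g y) -> 0 <= k ->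
  (\int[mu]_(y in D) (k * g y)%:E = k%:E * \int[mu]_(y in D) (g y)%:E)%E.
Proof.
move=> mD mg g0 k0; under eq_integral do rewrite EFinM.
apply: ge0_integralZl => //; first exact/measurable_EFinP.
by move=> x _; rewrite lee_fin.
Qed.

Lemma sum_flux (b : 'I_N -> R) (G1 G2 : 'I_N -> R) (p q : R) :
  \sum_i b i * (p * G1 i + q * G2 i) = p * (\sum_i b i * G1 i) + q * (\sum_i b i * G2 i).
Proof. by rewrite !mulr_sumr -big_split /=; apply: eq_bigr => i _; ring. Qed.

(** The test function [eta^2 h (z) / (w + e)] is admissible in the weak inequality since
    it is continuously differentiable and supported in the smaller cube. The constant
    depends on neither [e] nor [h]: this is what makes the estimates uniform as [e]
    tends to 0 and lets [h] be a truncation. *)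
Lemma energy_inequality (c1 c2 lam0 Lam : R) : 0 < c1 -> 0 < c2 -> 0 < lam0 ->
  exists2 C : R, 0 < C &
  forall (x0 : V) (R1 R2 M e : R) (A : set V) (rho w eta : V -> R) (b gw ge : 'I_N -> V -> R)
    (h h' : R -> R),
  R1 < R2 -> 0 < R2 -> 0 < e -> open A -> cube x0 R2 `<=` A ->
  measurable_fun setT rho -> (forall x, 0 <= rho x) ->
  {ae LN, forall x, cube x0 R2 x -> lam0 <= rho x} ->
  C1with A w gw -> (forall x, A x -> 0 <= w x) ->
  (forall i, measurable_fun (cube x0 R2) (b i)) ->
  (forall i x, cube x0 R2 x -> `|b i x| <= M) -> (forall x, cube x0 R2 x -> `|w x| <= M) ->
  (forall x, cube x0 R2 x -> \sum_i b i x * gw i x <= - (c1 * rho x * sqgrad gw x)) ->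
  (forall x (g : 'I_N -> V -> R), cube x0 R2 x -> `|\sum_i b i x * g i x| <=
      c2 * rho x * (Num.sqrt (sqgrad gw x) * Num.sqrt (sqgrad g x))) ->
  (forall (phi : V -> R) g, C1with setT phi g -> (forall x, 0 <= phi x) ->
     (forall x, ~ cube x0 R1 x -> phi x = 0) -> (forall x i, ~ cube x0 R1 x -> g i x = 0) ->
     \int[LN]_(x in cube x0 R2) flux b w Lam g phi x <= 0) ->
  C1with setT eta ge -> (forall x, ~ cube x0 R1 x -> eta x = 0) ->
  (forall x i, ~ cube x0 R1 x -> ge i x = 0) ->
  (forall t : R, is_derive t 1 h (h' t)) -> continuous h' ->
  (forall t, 0 <= h t) -> (forall t, 0 <= h' t) ->
  (\int[LN]_(x in cube x0 R2) (rho x * eta x ^+ 2 *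
      (h (log_potential w e x) + h' (log_potential w e x)) *
      sqgrad (log_gradient w gw e) x)%:E <=
   C%:E * \int[LN]_(x in cube x0 R2) (rho x * (sqgrad ge x + eta x ^+ 2) *
      h (log_potential w e x))%:E)%E.
Proof.
move=> c10 c20 lam00.
pose C1 := 2 * c2 ^+ 2 / c1 + `|Lam| / lam0.
have C10 : 0 < C1.
  by rewrite ltr_pwDl ?divr_ge0 ?(ltW lam00)// divr_gt0// mulr_gt0// exprn_gt0.
exists (2 / c1 * C1); first by rewrite mulr_gt0// divr_gt0.
move=> x0 R1 R2 M e A rho w eta b gw ge h h' R12 R20 e0 oA QA mrho rho0 rholam wA w0 mb bM wM.
move=> bw bg weak etaC etaK geK dh ch' h0 h'0.
set z := log_potential w e; set gz := log_gradient w gw e.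
set Q := cube x0 R2 in QA mb rholam bM wM bw bg weak *.
have mQ : measurable Q by exact: measurable_cube.
have zA : C1with A z gz by exact: C1with_log.
have ch : continuous h.
  by move=> t; apply/differentiable_continuous/derivable1_diffP; have [] := dh t.
have hzA := C1with_comp (F := h) (F' := h') oA zA (fun x _ => conj (dh (z x)) (ch' (z x))).
have iA := C1with_inv oA e0 w0 wA.
have KA : cube x0 R1 `<=` A.
  by move=> x xK; apply: QA => i; exact: le_trans (xK i) (ltW R12).
have etaA : C1with A eta ge by exact: C1with_sub (@subsetT _ A) etaC.
pose phi x := (eta x * eta x) * (h (z x) * (w x + e)^-1).
pose gphi i x := (eta x * eta x) * (h (z x) * (- (w x + e) ^- 2 * gw i x) +
    (w x + e)^-1 * (h' (z x) * gz i x)) +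
  (h (z x) * (w x + e)^-1) * (eta x * ge i x + eta x * ge i x).
have phiA : C1with A phi gphi.
  exact: C1withM oA (C1withM oA etaA etaA) (C1withM oA hzA iA).
have phiK x : ~ cube x0 R1 x -> phi x = 0.
  by move=> xK; rewrite /phi etaK// !mul0r.
have gphiK x i : ~ cube x0 R1 x -> gphi i x = 0.
  by move=> xK; rewrite /gphi etaK// !mul0r addr0 mulr0 addr0.
have phiC : C1with setT phi gphi.
  exact: (C1with_glue oA (@closed_cube _ _ x0 R1) KA phiA phiK gphiK).
have W0 x : A x -> 0 < w x + e by move=> Ax; rewrite ltr_wpDl// w0.
have phi0 x : 0 <= phi x.
  have [xK|xK] := pselect (cube x0 R1 x); last by rewrite phiK.
  by rewrite /phi mulr_ge0 -?expr2 ?sqr_ge0// mulr_ge0// invr_ge0 ltW// W0//; exact: KA.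
have := weak phi gphi phiC phi0 phiK gphiK.
pose F x := flux b w Lam gphi phi x.
rewrite -/(F _) => intF.
have mw : measurable_fun Q w by have [] := C1with_measurable oA QA wA mQ.
have iF : LN.-integrable Q (EFin \o F) by exact: (flux_integrable Lam R20 mb mw bM wM phiC).
have mF : measurable_fun Q (EFin \o F) by have /integrableP[] := iF.
have mz : measurable_fun Q z by have [] := C1with_measurable oA QA zA mQ.
have mgz i : measurable_fun Q (gz i).
  by have [_] := C1with_measurable oA QA zA mQ; exact.
have mgw i : measurable_fun Q (gw i).
  by have [_] := C1with_measurable oA QA wA mQ; exact.
have meta : measurable_fun Q eta by have [] := C1with_measurable openT (@subsetT _ Q) etaC mQ.
have mge i : measurable_fun Q (ge i).
  by have [_] := C1with_measurable openT (@subsetT _ Q) etaC mQ; exact.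
have mh : measurable_fun setT h by exact: continuous_measurable_fun.
have mh' : measurable_fun setT h' by exact: continuous_measurable_fun.
have mhz : measurable_fun Q (fun x => h (z x)) by exact: measurableT_comp.
have mh'z : measurable_fun Q (fun x => h' (z x)) by exact: measurableT_comp.
have mrhoQ : measurable_fun Q rho by exact: measurable_funTS.
pose P1 x := rho x * eta x ^+ 2 * (h (z x) + h' (z x)) * sqgrad gz x.
pose P2 x := 2 * c2 ^+ 2 / c1 * (rho x * sqgrad ge x * h (z x)) + `|Lam| * (eta x ^+ 2 * h (z x)).
pose P3 x := rho x * (sqgrad ge x + eta x ^+ 2) * h (z x).
have P10 x : 0 <= P1 x.
  rewrite /P1; apply: mulr_ge0; last exact: sqgrad_ge0.
  by apply: mulr_ge0; [apply: mulr_ge0 => //; exact: sqr_ge0|exact: addr_ge0].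
have k0 : 0 <= 2 * c2 ^+ 2 / c1.
  by apply: divr_ge0; [apply: mulr_ge0 => //; exact: sqr_ge0|exact: ltW].
have P20 x : 0 <= P2 x.
  apply: addr_ge0; apply: mulr_ge0 => //.
    by apply: mulr_ge0 => //; apply: mulr_ge0 => //; exact: sqgrad_ge0.
  by apply: mulr_ge0 => //; exact: sqr_ge0.
have P30 x : 0 <= P3 x.
  apply: mulr_ge0 => //; apply: mulr_ge0 => //.
  by apply: addr_ge0; [exact: sqgrad_ge0|exact: sqr_ge0].
have mP1 : measurable_fun Q P1.
  apply: measurable_funM; last exact: measurable_sqgrad.
  apply: measurable_funM; last exact: measurable_funD.
  by apply: measurable_funM => //; exact: measurable_funX.
have mP2 : measurable_fun Q P2.
  apply: measurable_funD; apply: measurable_funM => //; apply: measurable_funM => //.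
    by apply: measurable_funM => //; exact: measurable_sqgrad.
  exact: measurable_funX.
have mP3 : measurable_fun Q P3.
  apply: measurable_funM => //; apply: measurable_funM => //.
  by apply: measurable_funD; [exact: measurable_sqgrad|exact: measurable_funX].
have pw x : Q x -> c1 / 2 * P1 x <= F x + P2 x.
  move=> Qx; have Ax := QA _ Qx.
  have -> : F x = (eta x ^+ 2 * (h (z x) * (- (w x + e) ^- 2) +
        (w x + e)^-1 * (h' (z x) * - (w x + e)^-1)) * (\sum_i b i x * gw i x) +
      (h (z x) * (w x + e)^-1) * (2 * eta x) * (\sum_i b i x * ge i x)
    - Lam * (w x * (eta x ^+ 2 * (h (z x) * (w x + e)^-1)))).
    rewrite /F /flux -sum_flux /phi -expr2; congr (_ - _).
    apply: eq_bigr => i _; congr (_ * _); rewrite /gphi /gz /log_gradient; ring.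
  have gzE : sqgrad gz x = sqgrad gw x / (w x + e) ^+ 2.
    rewrite /sqgrad mulr_suml; apply: eq_bigr => i _; rewrite /gz /log_gradient exprMn sqrrN exprVn; ring.
  rewrite /P1 gzE; apply: flux_pointwise => //.
  - exact: sqgrad_ge0.
  - exact: sqgrad_ge0.
  - exact: W0.
  - exact: w0.
  - by rewrite lerDl ltW.
  - exact: bw.
  - exact: bg.
have cc0 : 0 < c1 / 2 by rewrite divr_gt0.
have E1 : ((c1 / 2)%:E * \int[LN]_(x in Q) (P1 x)%:E <= \int[LN]_(x in Q) (P2 x)%:E)%E.
  have I20 : (0 <= \int[LN]_(x in Q) (P2 x)%:E)%E.
    by apply: integral_ge0 => x _; rewrite lee_fin.
  (* If the integral of [P2] is finite, the weak inequality can be used by linearity. *)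
  have [Ioo|Ifin] := eqVneq (\int[LN]_(x in Q) (P2 x)%:E)%E +oo%E.
    by rewrite Ioo leey.
  have iP2 : LN.-integrable Q (EFin \o P2).
    apply/integrableP; split; first exact/measurable_EFinP.
    under eq_integral => x _ do rewrite /= ger0_norm//.
    by rewrite ltey.
  have mFP : measurable_fun Q (fun x => (F x + P2 x)%:E).
    by apply/measurable_EFinP; apply: measurable_funD => //; exact/measurable_EFinP.
  apply: (@le_trans _ _ (\int[LN]_(x in Q) (F x + P2 x)%:E)%E).
    rewrite -(ge0_integralZl_EFinD _ mQ mP1 P10 (ltW cc0)).
    apply: ge0_le_integral => //.
    - by move=> x _; rewrite lee_fin mulr_ge0// ltW.
    - by apply/measurable_EFinP; exact: measurable_funM.
  under eq_integral do rewrite EFinD.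
  rewrite integralD//= -[leRHS]add0e leeD2r//.
  have Ffin := integrable_fin_num mQ iF.
  by rewrite -(fineK Ffin) lee_fin.
have E2 : (\int[LN]_(x in Q) (P2 x)%:E <= C1%:E * \int[LN]_(x in Q) (P3 x)%:E)%E.
  rewrite -(ge0_integralZl_EFinD _ mQ mP3 P30 (ltW C10)).
  apply: ae_ge0_le_integral => //.
  - by move=> x _; rewrite lee_fin.
  - exact/measurable_EFinP.
  - by move=> x _; rewrite lee_fin mulr_ge0// ltW.
  - by apply/measurable_EFinP; exact: measurable_funM.
  apply: filterS rholam => x hx Qx; rewrite lee_fin /P2 /P3 /C1.
  have hxl := hx Qx; set E := sqgrad ge x; have Ege0 : 0 <= E by exact: sqgrad_ge0.
  set H := h (z x); have H0 : 0 <= H by exact: h0.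
  have et0 : 0 <= eta x ^+ 2 by exact: sqr_ge0.
  have u1 : `|Lam| * (eta x ^+ 2 * H) <= `|Lam| / lam0 * (rho x * eta x ^+ 2 * H).
    rewrite -[leRHS]mulrA ler_wpM2l// ler_pdivlMl// mulrA.
    by rewrite ler_wpM2r// ler_wpM2r.
  have u2 : 0 <= 2 * c2 ^+ 2 / c1 * (rho x * eta x ^+ 2 * H).
    by rewrite mulr_ge0// mulr_ge0// mulr_ge0.
  have u3 : 0 <= `|Lam| / lam0 * (rho x * E * H).
    by rewrite mulr_ge0 ?divr_ge0 ?(ltW lam00)// mulr_ge0// mulr_ge0.
  move: u1 u2 u3; set k := 2 * c2 ^+ 2 / c1; set l := `|Lam| / lam0 => u1 u2 u3.
  rewrite (_ : (k + l) * _ = k * (rho x * E * H) + k * (rho x * eta x ^+ 2 * H) +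
    (l * (rho x * E * H) + l * (rho x * eta x ^+ 2 * H))); last by ring.
  lra.
have := le_trans E1 E2; rewrite muleC -lee_pdivlMr// => h1; apply: (le_trans h1).
rewrite muleC muleA -EFinM; apply: lee_wpmul2r; first by apply: integral_ge0 => x _; rewrite lee_fin.
by rewrite lee_fin invf_div.
Qed.

End energy_integral.

(** * Truncations, cutoffs and fast decay *)

Section truncation.
Context {R : realType}.
Implicit Types t : R.

Definition pos_part t : R := Num.max t 0.
Definition sqp t : R := pos_part t ^+ 2.

Lemma pos_part_ge0 t : 0 <= pos_part t.
Proof. by rewrite /pos_part le_max lexx orbT. Qed.

Lemma pos_part_id t : 0 <= t -> pos_part t = t.
Proof. by move=> t0; apply/max_idPl. Qed.

Lemma pos_part0 t : t <= 0 -> pos_part t = 0.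
Proof. by move=> t0; apply/max_idPr. Qed.

Lemma continuous_pos_part : continuous pos_part.
Proof.
move=> t; rewrite (_ : pos_part = fun s => 2^-1 * (s + `|s|)).
  apply: (@continuousM R R (cst 2^-1) (fun s : R => s + `|s|)); first exact: cst_continuous.
  by apply: (@continuousD R R R id (fun s : R => `|s|)); [exact: cvg_id|exact: norm_continuous].
apply/funext => s; case: (leP 0 s) => h.
  by rewrite pos_part_id// ger0_norm//; field.
by rewrite pos_part0 ?ltW// ltr0_norm//; ring.
Qed.

(** At 0 the function is bounded by [t ^+ 2], on either side. *)
Lemma sqp_derive t : is_derive t 1 sqp (2 * pos_part t).
Proof.
have [t0|t0|t0] := ltgtP t 0.
- rewrite pos_part0 ?(ltW t0)// mulr0.
  have h := is_derive_cst (0 : R) t (1 : R); apply: (near_eq_is_derive _ h).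
  near=> s; rewrite /sqp pos_part0 ?expr0n//.
  by apply: ltW; near: s; exact: lt_nbhsl.
- rewrite pos_part_id ?(ltW t0)//.
  have h := is_deriveX 2 (is_derive_id t (1 : R)).
  apply: (near_eq_is_derive (f := (id : R -> R) ^+ 2)).
    near=> s; rewrite /sqp pos_part_id//.
    by apply: ltW; near: s; exact: lt_nbhsr.
  by apply: (is_derive_eq h); rewrite /GRing.scale /= expr1 mulr1.
- rewrite t0 pos_part0// mulr0.
  have cv : h^-1 *: (sqp (h *: (1 : R) + 0) - sqp 0) @[h --> (0 : R)^'] --> (0 : R).
    apply/cvgrPdist_le => e e0; near=> h.
    rewrite sub0r normrN /GRing.scale /= mulr1 addr0 {2}/sqp pos_part0// expr0n subr0.
    have hn0 : h != 0 by near: h; exact: nbhs_dnbhs_neq.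
    have h1 : `|h| <= e by near: h; exact: dnbhs0_le.
    rewrite normrM normfV ler_pdivrMl ?normr_gt0//.
    have ph : pos_part h <= `|h| by rewrite /pos_part ge_max normr_ge0 ler_norm.
    rewrite /sqp ger0_norm ?sqr_ge0//.
    apply: (@le_trans _ _ (`|h| ^+ 2)); first by rewrite lerXn2r ?nnegrE ?pos_part_ge0.
    by rewrite expr2 ler_wpM2l.
  split; first by apply/cvg_ex; exists 0.
  exact/cvg_lim.
Unshelve. all: end_near. Qed.

(** A truncation that is continuously differentiable, bounded by 1 and of bounded slope;
    it vanishes exactly on the nonpositive numbers. *)
Definition sat t : R := sqp t / (1 + sqp t).
Definition sat' t : R := 2 * pos_part t / (1 + sqp t) ^+ 2.

Lemma sqp_ge0 t : 0 <= sqp t. Proof. exact: sqr_ge0. Qed.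

Lemma sqp1_gt0 t : 0 < 1 + sqp t. Proof. by rewrite ltr_pwDl// sqp_ge0. Qed.

Lemma sat_derive t : is_derive t 1 sat (sat' t).
Proof.
have h1 := sqp_derive t.
have h2 := is_deriveD (is_derive_cst (1 : R) t (1 : R)) h1.
have n0 : 1 + sqp t != 0 by rewrite gt_eqF// sqp1_gt0.
have h3 := @is_deriveV R (cst 1 + sqp) t _ _ n0 h2.
have h := is_deriveM h1 h3.
apply: (is_derive_eq h); rewrite /GRing.scale /= /sat' add0r.
have -> : (cst 1 + sqp) t = 1 + sqp t by [].
by field.
Qed.

Lemma sat_ge0 t : 0 <= sat t.
Proof. by rewrite divr_ge0 ?sqp_ge0// ltW// sqp1_gt0. Qed.

Lemma sat_le1 t : sat t <= 1.
Proof. by rewrite ler_pdivrMr ?sqp1_gt0// mul1r lerDr. Qed.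

Lemma sat'_ge0 t : 0 <= sat' t.
Proof. by rewrite divr_ge0 ?sqr_ge0// mulr_ge0// pos_part_ge0. Qed.

Lemma sat'_le1 t : sat' t <= 1.
Proof.
rewrite ler_pdivrMr ?exprn_gt0 ?sqp1_gt0// mul1r /sqp.
move: (pos_part t) => y; have := sqr_ge0 (y - 2^-1); have := sqr_ge0 (y ^+ 2); nra.
Qed.

Lemma sat_eq0 t : t <= 0 -> sat t = 0.
Proof. by move=> t0; rewrite /sat /sqp pos_part0// expr0n mul0r. Qed.

Lemma continuous_sat' : continuous sat'.
Proof.
move=> t; apply: (@continuousM R R (fun s => 2 * pos_part s) (fun s => ((1 + sqp s) ^+ 2)^-1)).
  apply: (@continuousM R R (cst 2) pos_part); first exact: cst_continuous.
  exact: continuous_pos_part.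
apply: (@continuous_comp _ _ _ (fun s => (1 + sqp s) ^+ 2) (fun y : R => y^-1)).
  apply: (@continuous_comp _ _ _ (fun s => 1 + sqp s) (fun y : R => y ^+ 2)); last exact: exprn_continuous.
  apply: (@continuousD R R R (cst 1) sqp); first exact: cst_continuous.
  apply: (@continuous_comp _ _ _ pos_part (fun y : R => y ^+ 2)); last exact: exprn_continuous.
  exact: continuous_pos_part.
by apply: inv_continuous; rewrite expf_neq0// gt_eqF// sqp1_gt0.
Qed.

Lemma sat_mono s t : s <= t -> sat s <= sat t.
Proof.
move=> st; rewrite /sat; have : sqp s <= sqp t.
  rewrite lerXn2r ?nnegrE ?pos_part_ge0// /pos_part ge_max le_max st /=.
  by rewrite le_max lexx orbT.
move=> h; rewrite ler_pdivrMr ?sqp1_gt0// mulrAC ler_pdivlMr ?sqp1_gt0//.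
have := sqp_ge0 s; nra.
Qed.

Lemma sat_lower t : 0 < t -> t <= 1 -> t ^+ 2 / 2 <= sat t.
Proof.
move=> t0 t1; rewrite /sat /sqp pos_part_id ?(ltW t0)//.
rewrite ler_wpM2l ?sqr_ge0// lef_pV2 ?posrE//; last by rewrite ltr_pwDl// sqr_ge0.
by rewrite (_ : 2 = 1 + 1)// lerD2l exprn_ile1// ltW.
Qed.

Lemma sat_gt0 t : 0 < t -> 0 < sat t.
Proof. by move=> t0; rewrite /sat divr_gt0 ?sqp1_gt0// /sqp pos_part_id ?(ltW t0)// exprn_gt0. Qed.

Lemma powR_exprn (a th : R) j : 0 <= a -> (a ^+ j) `^ th = (a `^ th) ^+ j.
Proof. by move=> a0; rewrite -!powR_mulrn ?powR_ge0// powRAC. Qed.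

(** The classical lemma of De Giorgi on superlinear recursions: the ansatz [Y j <= delta
    * sg ^+ j] reproduces itself when [sg `^ th] cancels [B] and [delta `^ th] cancels
    the constant. *)
Lemma fast_decay (C B th : R) : 0 < C -> 1 < B -> 0 < th ->
  exists2 delta : R, 0 < delta &
  forall Y : nat -> R, (forall j, 0 <= Y j) -> Y 0%N <= delta ->
  (forall j, Y j.+1 <= C * B ^+ j * Y j `^ (1 + th)) ->
  forall e, 0 < e -> exists j, Y j <= e.
Proof.
move=> C0 B1 th0; have B0 : 0 < B by rewrite (lt_trans _ B1).
pose sg := B `^ (- th^-1).
have sg0 : 0 < sg by rewrite powR_gt0.
have sg1 : sg < 1.
  rewrite /sg powRN invf_lt1 ?powR_gt0//.
  have <- : (1 : R) `^ th^-1 = 1 by rewrite powR1.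
  by rewrite gt0_ltr_powR ?nnegrE ?invr_gt0// ltW.
pose d := (sg / C) `^ th^-1; have d0 : 0 < d by rewrite powR_gt0// divr_gt0.
have dth : C * d `^ th = sg.
  rewrite /d -powRrM mulVf ?gt_eqF// powRr1 ?divr_ge0 ?ltW//.
  by field; rewrite gt_eqF.
have Bsg : B * sg `^ th = 1.
  rewrite /sg -powRrM mulNr mulVf ?gt_eqF// powR_inv1 ?ltW// mulfV// gt_eqF//.
exists d => // Y Y0 Yd Yrec.
have key j : Y j <= d * sg ^+ j.
  elim: j => [|j IH]; first by rewrite expr0 mulr1.
  rewrite (le_trans (Yrec j))//.
  have dj0 : 0 <= d * sg ^+ j by rewrite mulr_ge0 ?exprn_ge0// ltW.
  apply: (@le_trans _ _ (C * B ^+ j * (d * sg ^+ j) `^ (1 + th))).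
    rewrite ler_wpM2l ?mulr_ge0 ?exprn_ge0 ?(ltW C0) ?(ltW B0)//.
    by apply: ge0_ler_powR; rewrite ?nnegrE ?Y0// addr_ge0// ltW.
  have E : (d * sg ^+ j) `^ (1 + th) = d * sg ^+ j * (d `^ th * (sg `^ th) ^+ j).
    rewrite powRD; last by rewrite gt_eqF// addr_gt0.
    rewrite powRr1// powRM ?exprn_ge0 ?ltW//; congr (_ * (_ * _)).
    by rewrite powR_exprn// ltW.
  rewrite E exprS (_ : _ * _ = (C * d `^ th) * (B * sg `^ th) ^+ j * (d * sg ^+ j)).
    by rewrite dth Bsg expr1n mulr1 mulrCA.
  by rewrite exprMn; ring.
move=> e e0.
have : (fun j => d * sg ^+ j) @ \oo --> d * 0.
  by apply: cvgMr; apply: cvg_expr; rewrite gtr0_norm.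
rewrite mulr0 => /cvgrPdist_le/(_ _ e0)[j _ /(_ j (leqnn _))].
rewrite sub0r normrN => h; exists j; rewrite (le_trans (key j))// (le_trans _ h)//.
exact: ler_norm.
Qed.

End truncation.

Section cutoff.
Context {R : realType} {n : nat}.
Local Notation V := 'rV[R]_n.
Implicit Types x : V.

Definition sqdist (x0 x : V) : R := \sum_i (x ord0 i - x0 ord0 i) ^+ 2.

Lemma sqdist_ge0 x0 x : 0 <= sqdist x0 x.
Proof. by apply: sumr_ge0 => i _; exact: sqr_ge0. Qed.

Lemma sqdist_coord x0 x i : (x ord0 i - x0 ord0 i) ^+ 2 <= sqdist x0 x.
Proof. by rewrite /sqdist (bigD1 i)//= lerDl; apply: sumr_ge0 => j _; exact: sqr_ge0. Qed.

Lemma sqdist_cube x0 x s : 0 <= s -> sqdist x0 x < s ^+ 2 -> cube x0 s x.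
Proof.
move=> s0 h i; have h1 := le_lt_trans (sqdist_coord x0 x i) h.
rewrite -(@ler_pXn2r _ 2) ?nnegrE// real_normK ?num_real//; exact: ltW.
Qed.

Lemma sqdist_cube_le x0 x s : cube x0 s x -> sqdist x0 x <= n%:R * s ^+ 2.
Proof.
move=> xs; rewrite mulr_natl -[in leRHS](card_ord n) -sumr_const.
apply: ler_sum => i _; rewrite -real_normK ?num_real// lerXn2r ?nnegrE//.
by rewrite (le_trans _ (xs i)).
Qed.

Lemma C1with_sqdist x0 (c : R) : C1with setT (fun x => c - sqdist x0 x)
  (fun i x => - 2 * (x ord0 i - x0 ord0 i)).
Proof.
move=> x _ i; split; last first.
  apply: (@continuousM _ _ (cst (- 2)) (fun y : V => y ord0 i - x0 ord0 i)).
    exact: cst_continuous.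
  apply: (@continuousB _ _ _ (fun y : V => y ord0 i) (cst (x0 ord0 i))); last exact: cst_continuous.
  exact: coord_continuous.
apply/is_derive_lineE.
pose c' := c - \sum_(j | j != i) (x ord0 j - x0 ord0 j) ^+ 2.
have -> : (fun t : R => c - sqdist x0 (t *: delta_mx ord0 i + x)) =
   (fun t : R => c' - (1 * t + (x ord0 i - x0 ord0 i)) ^+ 2).
  apply/funext => t; rewrite /sqdist (bigD1 i)//= !mxE !eqxx /= mulr1 mul1r.
  rewrite (eq_bigr (fun j => (x ord0 j - x0 ord0 j) ^+ 2)).
    by rewrite /c'; ring.
  by move=> j ji; rewrite !mxE (negbTE ji) andbF mulr0 add0r.
have h := is_deriveX 2 (is_derive_affine 1 (x ord0 i - x0 ord0 i) 0).
have h2 := is_deriveB (is_derive_cst c' (0 : R) (1 : R)) h.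
apply: (is_derive_eq h2); rewrite /GRing.scale /= mulr0 add0r; ring.
Qed.

(** A continuously differentiable cutoff of the Euclidean ball of squared radius [s];
    squared distances avoid the singularity of the norm at the centre. *)
Definition cut x0 s x : R := sqp (s - sqdist x0 x).
Definition cut' x0 s (i : 'I_n) x : R :=
  2 * pos_part (s - sqdist x0 x) * (- 2 * (x ord0 i - x0 ord0 i)).

Lemma C1with_cut x0 s : C1with setT (cut x0 s) (cut' x0 s).
Proof.
apply: (C1with_comp (F := sqp) (F' := fun t => 2 * pos_part t) openT (C1with_sqdist x0 s)).
move=> x _; split; first exact: sqp_derive.
apply: (@continuousM R R (cst 2) pos_part); first exact: cst_continuous.
exact: continuous_pos_part.
Qed.

Lemma cut_eq0 x0 s x : s <= sqdist x0 x -> cut x0 s x = 0.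
Proof. by move=> h; rewrite /cut /sqp pos_part0 ?subr_le0// expr0n. Qed.

Lemma cut'_eq0 x0 s x i : s <= sqdist x0 x -> cut' x0 s i x = 0.
Proof. by move=> h; rewrite /cut' pos_part0 ?subr_le0// mulr0 mul0r. Qed.

Lemma cut_bound x0 (s : R) x : 0 <= s ->
  sqgrad (cut' x0 s) x + cut x0 s x ^+ 2 <= 16 * s ^+ 3 + s ^+ 4.
Proof.
move=> s0; have q0 := sqdist_ge0 x0 x.
have [h|h] := leP s (sqdist x0 x).
  rewrite cut_eq0// /sqgrad big1; last by move=> i _; rewrite cut'_eq0// expr0n.
  by rewrite expr0n addr0 addr_ge0 ?mulr_ge0 ?exprn_ge0.
have p0 : 0 <= s - sqdist x0 x by rewrite subr_ge0 ltW.
have ps : s - sqdist x0 x <= s by lra.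
rewrite /cut /sqp pos_part_id//; apply: lerD; last first.
  by rewrite -exprM; apply: (@lerXn2r R 4); rewrite ?nnegrE.
rewrite /sqgrad (eq_bigr (fun i => 16 * (s - sqdist x0 x) ^+ 2 * (x ord0 i - x0 ord0 i) ^+ 2)).
  rewrite -mulr_sumr -/(sqdist x0 x) -mulrA ler_wpM2l// (exprSr s 2).
  by apply: ler_pM; rewrite ?sqr_ge0 ?(ltW h)//; apply: lerXn2r; rewrite ?nnegrE.
by move=> i _; rewrite /cut' pos_part_id//; ring.
Qed.

Lemma cut_lower x0 (s t : R) x : t <= s -> sqdist x0 x <= t -> (s - t) ^+ 2 <= cut x0 s x.
Proof.
move=> ts xt; rewrite /cut /sqp pos_part_id; last by lra.
by rewrite lerXn2r ?nnegrE; lra.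
Qed.

End cutoff.

(** * The trace inequality for continuously differentiable functions *)

Section trace_for_C1.
Context {R : realType} {m : nat}.
Local Notation n := m.+2.
Local Notation V := 'rV[R]_n.
Local Notation LN := (@lebesgueN R n).

Lemma average_local (f g : V -> R) c s :
  (forall x, cube c s x -> f x = g x) -> average f c s = average g c s.
Proof.
move=> fg; rewrite /average; congr (_ / _); apply: eq_Rintegral => x.
by rewrite inE => /fg.
Qed.

(** An upper bound of the average by way of [dist_average]: all values of [f] lie within
    [(a + M) / 2] of [(a - M) / 2]. *)
Lemma average_le (f : V -> R) c (s M a : R) : 0 < s -> measurable_fun setT f ->
  (forall x, cube c s x -> `|f x| <= M) -> (forall x, cube c s x -> f x <= a) ->
  average f c s <= a.
Proof.
move=> s0 mf fM fa.
pose k := (a - M) / 2; pose L := (a + M) / 2.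
have h := dist_average k s0 mf fM.
have V0 : 0 < (2 * s) ^+ n by rewrite exprn_gt0// mulr_gt0.
have h2 : (\int[LN]_(x in cube c s) `|f x - k|%:E <= (L * (2 * s) ^+ n)%:E)%E.
  rewrite EFinM -[X in (_ <= _ * X)%E](lebesgueN_cube c (ltW s0)).
  rewrite -integral_cst; last exact: measurable_cube.
  apply: ge0_le_integral => //=.
  - exact: measurable_cube.
  - apply/measurable_EFinP; apply: measurableT_comp => //.
    by apply: measurable_funTS; apply: measurable_funB.
  - move=> x xc; rewrite lee_fin ler_norml.
    have := fM x xc; rewrite ler_norml => /andP[f1 f2]; have := fa x xc.
    by rewrite /L /k => f3; apply/andP; split; lra.
have := le_trans h h2; rewrite lee_fin (ler_pM2r V0) ler_norml => /andP[_].
by rewrite /L /k; lra.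
Qed.

(** The trace inequality, with the gradient itself as majorant; [f] and its gradient are
    extended by 0 off the large cube, where they are not defined. *)
Lemma trace_C1 (r sh beta Lam : R) :
  0 < r -> 0 < sh -> m%:R < beta -> 0 < Lam -> exists C th : R,
  [/\ 0 < C, 0 < th & forall (x0 h : V) (rho : V -> R) (A : set V)
      (f : V -> R) (g : 'I_n -> V -> R) (mu : R) (E : set V),
    measurable_fun setT rho -> (forall x, 0 <= rho x) ->
    (forall (y : V) (s : R), 0 < s ->
      (\int[LN]_(x in cube y s) (rho x)%:E <= (Lam * s `^ beta)%:E)%E) ->
    open A -> cube x0 (3 * r) `<=` A -> C1with A f g ->
    cube h sh `<=` cube x0 r -> measurable E -> E `<=` cube x0 r -> 0 <= mu ->
    (\int[LN]_(x in E) (rho x)%:E <= mu%:E)%E ->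
    (\int[LN]_(x in E) (rho x * (f x - average f h sh) ^+ 2)%:E <=
      (C * mu `^ th)%:E * \int[LN]_(y in cube x0 (3 * r)) (sqgrad g y)%:E)%E].
Proof.
move=> r0 sh0 mb L0.
have [C [th [C0 th0 T]]] := @trace_inequality R m r sh beta Lam r0 sh0 mb L0.
exists C, th; split => // x0 h rho A f g mu E mrho rho0 growth oA DA fg hE mE Er mu0 Emu.
set D := cube x0 (3 * r) in DA *.
have rD : cube x0 r `<=` D.
  by move=> x xr i; rewrite (le_trans (xr i))//; lra.
have mD : measurable D by exact: measurable_cube.
have [mf mg] := C1with_measurable oA DA fg mD.
pose F := f \_ D; pose G := (fun x => Num.sqrt (sqgrad g x)) \_ D.
have FE x : D x -> F x = f x by move=> Dx; rewrite /F patchE mem_set.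
have GE x : D x -> G x = Num.sqrt (sqgrad g x) by move=> Dx; rewrite /G patchE mem_set.
have [M M0 fM] : exists2 M : R, 0 <= M & forall x, D x -> `|f x| <= M.
  apply: bounded_in_cube => x /DA Ax; exact: C1with_continuous fg Ax.
have G0 y : 0 <= G y by rewrite /G patchE; case: ifP => _; rewrite ?sqrtr_ge0.
have mF : measurable_fun setT F by apply/(measurable_restrictT _ mD).
have mG : measurable_fun setT G.
  apply/(measurable_restrictT _ mD).
  apply: measurableT_comp; last exact: measurable_sqgrad.
  exact: (continuous_measurable_fun (@sqrt_continuous R)).
have FM y : D y -> `|F y| <= M by move=> Dy; rewrite FE// fM.
have Fcont x : cube x0 r x -> {for x, continuous F}.
  move=> xr; have Ax := DA _ (rD _ xr).
  have cf : {for x, continuous f} by exact: C1with_continuous fg Ax.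
  have near_D : \forall y \near x, F y = f y.
    have : nbhs x (open_cube x0 (3 * r)).
      apply: open_nbhs_nbhs; split; first exact: open_open_cube.
      by move=> i; rewrite (le_lt_trans (xr i))//; lra.
    by apply: (@filterS _ _ (nbhs_filter x)) => y yx; rewrite FE// => i; exact: ltW.
  rewrite /prop_for /continuous_at FE; last exact: rD.
  by apply: cvg_trans cf; apply: (@near_eq_cvg _ _ _ (nbhs_filter x)); move: near_D; apply: (@filterS _ _ (nbhs_filter x)) => y ->.
have Fline : line_bound D F G.
  move=> c s s0 cD i x t t' xc ct ct'.
  have sc (a : R) : `|a - c ord0 i| <= s -> cube c s (set_coord x i a).
    by move=> ac; exact: cube_set_coord.
  rewrite !FE; [|by apply: cD; exact: sc|by apply: cD; exact: sc].
  apply: (line_bound_cube fg _ mG _ xc ct ct'); first exact: subset_trans cD DA.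
  move=> y /cD Dy; rewrite GE// -sqrtr_sqr ler_wsqrtr// /sqgrad (bigD1 i)//= lerDl.
  by apply: sumr_ge0 => j _; exact: sqr_ge0.
have := T x0 h rho F G M mu E mrho rho0 growth mF mG G0 FM Fcont Fline hE mE Er mu0 Emu.
rewrite (@average_local F f); last by move=> x /hE /rD /FE.
rewrite (eq_integral (fun x => (rho x * (f x - average f h sh) ^+ 2)%:E)); last first.
  by move=> x; rewrite inE => /Er /rD /FE ->.
move=> /le_trans; apply; rewrite lee_wpmul2l ?lee_fin ?mulr_ge0 ?powR_ge0 ?(ltW C0)//.
rewrite le_eqVlt; apply/orP; left; apply/eqP; apply: eq_integral => y.
by rewrite inE => Dy; rewrite GE// sqr_sqrtr// sqgrad_ge0.
Qed.

End trace_for_C1.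

(** * De Giorgi iteration for the logarithmic potential *)

Section integral_comparison.
Context {d : measure_display} {T : measurableType d} {R : realType}.
Variable mu : {measure set T -> \bar R}.
Implicit Types (D U : set T) (f g : T -> R).

Lemma le_integral_EFin D f g : measurable D -> measurable_fun D f -> measurable_fun D g ->
  (forall x, D x -> 0 <= f x) -> (forall x, D x -> f x <= g x) ->
  (\int[mu]_(x in D) (f x)%:E <= \int[mu]_(x in D) (g x)%:E)%E.
Proof.
move=> mD mf mg f0 fg; by apply: ge0_le_integral => //; exact/measurable_EFinP.
Qed.

Lemma le_integral_support D U f g : measurable D -> measurable U -> U `<=` D ->
  measurable_fun D f -> measurable_fun U g -> (forall x, D x -> 0 <= f x) ->
  (forall x, D x -> ~ U x -> f x = 0) -> (forall x, U x -> f x <= g x) ->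
  (\int[mu]_(x in D) (f x)%:E <= \int[mu]_(x in U) (g x)%:E)%E.
Proof.
move=> mD mU UD mf mg f0 fU fg.
have UDD : U `|` (D `\` U) = D by exact: setDUK.
have mDU : measurable (D `\` U) by exact: measurableD.
rewrite -{1}UDD ge0_integral_setU//.
- rewrite [X in (_ + X)%E]integral0_eq ?adde0; last by move=> x [Dx /fU->].
  apply: le_integral_EFin => //; first exact: measurable_funS mf.
  by move=> x /UD; exact: f0.
- by rewrite UDD; exact/measurable_EFinP.
- by rewrite UDD => x Dx; rewrite lee_fin f0.
- by apply/disj_setPS => x [Ux [_ /(_ Ux)]].
Qed.

Lemma integral_subset_EFin D U f : measurable D -> measurable U -> U `<=` D ->
  measurable_fun D f -> (forall x, D x -> 0 <= f x) ->
  (\int[mu]_(x in U) (f x)%:E <= \int[mu]_(x in D) (f x)%:E)%E.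
Proof.
move=> mD mU UD mf f0; by apply: ge0_subset_integral => //; exact/measurable_EFinP.
Qed.

End integral_comparison.

Section shifted_sat.
Context {R : realType}.

Lemma sat_shift_derive (k t : R) : is_derive t 1 (fun s => sat (s - k)) (sat' (t - k)).
Proof.
have h := is_deriveB (is_derive_id t (1 : R)) (is_derive_cst k t (1 : R)).
have h2 := @is_derive1_comp _ (@sat R) (fun s : R => s - k) t _ _ (sat_derive (t - k)) h.
by apply: (is_derive_eq h2); rewrite subr0 mulr1.
Qed.

Lemma continuous_sat_shift' (k : R) : continuous (fun t => sat' (t - k)).
Proof.
move=> t; apply: (@continuous_comp _ _ _ (fun s : R => s - k) (@sat' R)).
  by apply: (@continuousB R R R id (cst k)); [exact: cvg_id|exact: cst_continuous].
exact: continuous_sat'.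
Qed.

Lemma continuous_sat : continuous (@sat R).
Proof.
by move=> t; apply/differentiable_continuous/derivable1_diffP; have [] := sat_derive t.
Qed.

End shifted_sat.

Section local_estimates.
Context {R : realType} {m : nat}.
Local Notation n := m.+2.
Local Notation V := 'rV[R]_n.
Local Notation LN := (@lebesgueN R n).
Implicit Types x : V.

Variables (rho : V -> R) (A : set V) (w : V -> R) (gw : 'I_n -> V -> R) (x0 : V).
Variables R1 R2 lam0 Lam beta C0 : R.
Hypotheses (R10 : 0 < R1) (R12 : R1 < R2) (oA : open A) (QA : cube x0 R2 `<=` A).
Hypotheses (mrho : measurable_fun setT rho) (rho0 : forall x, 0 <= rho x).
Hypotheses (beta_gt : m%:R < beta) (Lam0 : 0 < Lam).
Hypothesis growth : forall y (s : R), 0 < s ->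
  (\int[LN]_(x in cube y s) (rho x)%:E <= (Lam * s `^ beta)%:E)%E.
Hypotheses (lam00 : 0 < lam0) (lam0_le : {ae LN, forall x, cube x0 R2 x -> lam0 <= rho x}).
Hypotheses (wA : C1with A w gw) (w0 : forall x, A x -> 0 <= w x) (C00 : 0 < C0).

Local Notation z := (log_potential w).
Local Notation gz := (log_gradient w gw).

Hypothesis energy : forall (e : R) eta ge (h h' : R -> R), 0 < e -> C1with setT eta ge ->
  (forall x, ~ cube x0 R1 x -> eta x = 0) -> (forall x i, ~ cube x0 R1 x -> ge i x = 0) ->
  (forall t : R, is_derive t 1 h (h' t)) -> continuous h' ->
  (forall t, 0 <= h t) -> (forall t, 0 <= h' t) ->
  (\int[LN]_(x in cube x0 R2)
     (rho x * eta x ^+ 2 * (h (z e x) + h' (z e x)) * sqgrad (gz e) x)%:E <=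
   C0%:E * \int[LN]_(x in cube x0 R2)
     (rho x * (sqgrad ge x + eta x ^+ 2) * h (z e x))%:E)%E.

(** Small enough that the cube of half-side [3 * core_radius] lies well inside the
    Euclidean ball of radius [R1], on which the cutoff of [log_energy] is bounded from
    below. *)
Definition core_radius : R := R1 / (6 * n%:R).
Local Notation r := core_radius.
Local Notation Q := (cube x0 R2).
Local Notation D := (cube x0 (3 * r)).

Lemma core_radius_gt0 : 0 < r.
Proof. by rewrite divr_gt0 ?mulr_gt0. Qed.
Local Notation r0 := core_radius_gt0.

Lemma core_radius3 : 3 * r = R1 / (2 * n%:R).
Proof.
have : n%:R != 0 :> R by rewrite pnatr_eq0.
by rewrite /core_radius; move: (n%:R : R) => k k0; field.
Qed.

Lemma core_radius_le : 3 * r <= R1 / 4.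
Proof.
rewrite core_radius3 ler_wpM2l ?(ltW R10)// lef_pV2 ?posrE ?mulr_gt0//.
by rewrite (_ : 4 = 2 * 2%:R) ?ler_wpM2l ?ler_nat//; ring.
Qed.

Lemma cubeS (c : V) (s t : R) : s <= t -> cube c s `<=` cube c t.
Proof. by move=> st x xs i; exact: le_trans st. Qed.

Lemma core_sub : D `<=` Q.
Proof. by apply: cubeS; have := core_radius_le; move: R10 R12; lra. Qed.

Let mQ : measurable Q. Proof. exact: measurable_cube. Qed.
Let mD : measurable D. Proof. exact: measurable_cube. Qed.
Let mrhoD (B : set V) : measurable_fun B rho. Proof. exact: measurable_funTS. Qed.

Lemma zA e : 0 < e -> C1with A (z e) (gz e).
Proof. by move=> e0; exact: C1with_log. Qed.

Lemma mass_finite : (\int[LN]_(x in Q) (rho x)%:E <= (Lam * R2 `^ beta)%:E)%E.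
Proof. by apply: growth; move: R10 R12; lra. Qed.

Lemma weight_lower (B : set V) (F : V -> R) : measurable B -> B `<=` Q ->
  measurable_fun B F -> (forall x, 0 <= F x) ->
  (lam0%:E * \int[LN]_(x in B) (F x)%:E <= \int[LN]_(x in B) (rho x * F x)%:E)%E.
Proof.
move=> mB BQ mF F0; rewrite -ge0_integralZl_EFinD ?(ltW lam00)//.
apply: ae_ge0_le_integral => //.
- by move=> x _; rewrite lee_fin mulr_ge0// ltW.
- by apply/measurable_EFinP; exact: measurable_funM.
- by move=> x _; rewrite lee_fin mulr_ge0.
- by apply/measurable_EFinP; exact: measurable_funM.
- apply: filterS lam0_le => x h Bx; rewrite lee_fin ler_wpM2r// h//.
  exact: BQ.
Qed.

(** The energy inequality with [h = 1]: the Dirichlet energy of the potential is bounded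
    uniformly in [e]. *)
Lemma log_energy : exists2 T : R, 0 <= T & forall e, 0 < e ->
  (\int[LN]_(x in D) (sqgrad (gz e) x)%:E <= T%:E)%E.
Proof.
pose b := 16 * (R1 ^+ 2) ^+ 3 + (R1 ^+ 2) ^+ 4.
pose q := ((R1 ^+ 2 / 2) ^+ 2) ^+ 2.
have q0 : 0 < q by rewrite !exprn_gt0// divr_gt0// exprn_gt0.
have b0 : 0 <= b by rewrite addr_ge0 ?mulr_ge0 ?exprn_ge0 ?(ltW R10).
have T0 : 0 <= C0 * (b * (Lam * R2 `^ beta)).
  by rewrite !mulr_ge0 ?powR_ge0 ?(ltW C00) ?(ltW Lam0).
exists (q^-1 * (lam0^-1 * (C0 * (b * (Lam * R2 `^ beta))))).
  by rewrite !mulr_ge0 ?invr_ge0 ?(ltW q0) ?(ltW lam00) ?powR_ge0 ?(ltW C00) ?(ltW Lam0).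
move=> e e0.
pose eta := cut x0 (R1 ^+ 2).
have off x : ~ cube x0 R1 x -> R1 ^+ 2 <= sqdist x0 x.
  by move=> xK; rewrite leNgt; apply/negP => h; apply/xK/sqdist_cube; rewrite ?(ltW R10).
have := @energy e eta (cut' x0 (R1 ^+ 2)) (cst 1) (cst 0) e0 (C1with_cut _ _).
move=> /(_ (fun x xK => cut_eq0 (off x xK)) (fun x i xK => cut'_eq0 i (off x xK))).
move=> /(_ (fun t => is_derive_cst _ _ _)).
have c0 : continuous (cst (0 : R) : R -> R) by move=> t; exact: cst_continuous.
move=> /(_ c0 (fun=> ler01) (fun=> lexx 0)) E.
have [mz mgz] := C1with_measurable oA QA (zA e0) mQ.
have msg : measurable_fun Q (sqgrad (gz e)) by exact: measurable_sqgrad.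
have [mc mc'] := C1with_measurable openT (@subsetT _ Q) (C1with_cut x0 (R1 ^+ 2)) mQ.
have msc : measurable_fun Q (sqgrad (cut' x0 (R1 ^+ 2))) by exact: measurable_sqgrad.
have upper : (\int[LN]_(x in Q)
     (rho x * (sqgrad (cut' x0 (R1 ^+ 2)) x + eta x ^+ 2) * cst 1 (z e x))%:E <=
     (b * (Lam * R2 `^ beta))%:E)%E.
  apply: (@le_trans _ _ (\int[LN]_(x in Q) (b * rho x)%:E)%E).
    apply: le_integral_EFin => //.
    - apply: measurable_funM => //; apply: measurable_funM => //.
      by apply: measurable_funD => //; exact: measurable_funX.
    - by apply: measurable_funM.
    - by move=> x _; rewrite mulr1 mulr_ge0// addr_ge0 ?sqgrad_ge0 ?sqr_ge0.
    - by move=> x _; rewrite mulr1 mulrC ler_wpM2r// cut_bound// exprn_ge0// ltW.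
  rewrite ge0_integralZl_EFinD// EFinM lee_wpmul2l ?lee_fin//; exact: mass_finite.
have lower : (q%:E * \int[LN]_(x in D) (rho x * sqgrad (gz e) x)%:E <= \int[LN]_(x in Q)
     (rho x * eta x ^+ 2 * (cst 1 (z e x) + cst 0 (z e x)) * sqgrad (gz e) x)%:E)%E.
  have mDs : measurable_fun D (fun x => rho x * sqgrad (gz e) x).
    by apply: measurable_funM => //; apply: measurable_funS msg => //; exact: core_sub.
  have pos x : 0 <= rho x * sqgrad (gz e) x by rewrite mulr_ge0 ?sqgrad_ge0.
  have mI : measurable_fun Q (fun x =>
      rho x * eta x ^+ 2 * (cst 1 (z e x) + cst 0 (z e x)) * sqgrad (gz e) x).
    apply: measurable_funM => //; apply: measurable_funM => //.
      by apply: measurable_funM => //; exact: measurable_funX.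
    exact: (@measurable_cst _ _ V R Q (1 + 0 : R)).
  rewrite -(ge0_integralZl_EFinD LN mD mDs pos (ltW q0)).
  apply: (@le_trans _ _ (\int[LN]_(x in D)
     (rho x * eta x ^+ 2 * (cst 1 (z e x) + cst 0 (z e x)) * sqgrad (gz e) x)%:E)%E).
    apply: le_integral_EFin => //; first exact: measurable_funM.
    - by apply: measurable_funS mI => //; exact: core_sub.
    - by move=> x _; rewrite mulr_ge0 ?(ltW q0).
    - move=> x xD; rewrite addr0 mulr1 mulrCA -mulrA ler_wpM2l// ler_wpM2r ?sqgrad_ge0//.
      apply: lerXn2r; rewrite ?nnegrE ?sqr_ge0//.
      have xR : sqdist x0 x <= R1 ^+ 2 / 2.
        apply: (le_trans (sqdist_cube_le xD)); rewrite core_radius3.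
        have n2 : 2 <= n%:R :> R by rewrite ler_nat.
        have -> : n%:R * (R1 / (2 * n%:R)) ^+ 2 = R1 ^+ 2 * (4 * n%:R)^-1.
          have : n%:R != 0 :> R by rewrite pnatr_eq0.
          by move: (n%:R : R) => k k0; field.
        by rewrite ler_wpM2l ?sqr_ge0// lef_pV2 ?posrE ?mulr_gt0//; lra.
      have -> : R1 ^+ 2 / 2 = R1 ^+ 2 - R1 ^+ 2 / 2 by field.
      by apply: cut_lower => //; rewrite ler_pdivrMr// ler_peMr ?sqr_ge0//; lra.
  apply: integral_subset_EFin => //; first exact: core_sub.
  move=> x _; rewrite addr0 mulr1 mulr_ge0 ?sqgrad_ge0// mulr_ge0 ?rho0//.
  exact: sqr_ge0.
have lowerD : (lam0%:E * \int[LN]_(x in D) (sqgrad (gz e) x)%:E <=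
    \int[LN]_(x in D) (rho x * sqgrad (gz e) x)%:E)%E.
  apply: weight_lower => //; first exact: core_sub.
    by apply: measurable_funS msg => //; exact: core_sub.
  by move=> x; exact: sqgrad_ge0.
have upperD : (\int[LN]_(x in D) (rho x * sqgrad (gz e) x)%:E <=
    (q^-1)%:E * (C0 * (b * (Lam * R2 `^ beta)))%:E)%E.
  rewrite lee_pdivlMl//; apply: (le_trans lower); apply: (le_trans E).
  by rewrite (EFinM C0) lee_wpmul2l ?lee_fin ?(ltW C00).
have := le_trans lowerD upperD; rewrite -lee_pdivlMl// => /le_trans; apply.
by rewrite -!EFinM lee_fin mulrCA.
Qed.

Definition sqball (s : R) : set V := [set x | sqdist x0 x < s].

(** The quantity of the iteration: the weight of the region where the potential exceeds
    [k], counted with the truncation. *)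
Definition level_mass e s k : \bar R :=
  (\int[LN]_(x in sqball s) (rho x * sat (z e x - k))%:E)%E.

Definition truncation e s k x := cut x0 s x * sat (z e x - k).
Definition truncation_grad e s k (i : 'I_n) x :=
  cut x0 s x * (sat' (z e x - k) * gz e i x) + sat (z e x - k) * cut' x0 s i x.

Local Notation s0 := ((r / 2) ^+ 2).
Local Notation cut_sup := (16 * s0 ^+ 3 + s0 ^+ 4).

Lemma truncation_C1 e s k : 0 < e -> C1with A (truncation e s k) (truncation_grad e s k).
Proof.
move=> e0; apply: (C1withM oA).
  exact: (C1with_sub (@subsetT _ A) (C1with_cut x0 s)).
apply: (C1with_comp (F := fun t => sat (t - k)) (F' := fun t => sat' (t - k)) oA (zA e0)).
by move=> x _; split; [exact: sat_shift_derive|exact: continuous_sat_shift'].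
Qed.

Lemma sqball_core s : s <= s0 -> sqball s `<=` cube x0 (r / 2).
Proof.
move=> ss x xs; apply: sqdist_cube; first by rewrite divr_ge0// ltW// r0.
exact: lt_le_trans xs ss.
Qed.

Lemma sqball_coreR s : s <= s0 -> sqball s `<=` cube x0 r.
Proof.
by move=> /sqball_core h x /h; apply: cubeS; have := r0; lra.
Qed.

Lemma coreRQ : cube x0 r `<=` Q.
Proof. by apply: subset_trans core_sub; apply: cubeS; have := r0; lra. Qed.

Lemma measurable_sqball s : measurable (sqball s).
Proof.
have mq : measurable_fun setT (sqdist x0).
  rewrite (_ : sqdist x0 = fun x => 0 - (0 - sqdist x0 x)); last first.
    by apply/funext => x; rewrite !sub0r opprK.
  apply: measurable_funB => //.
  apply: (continuous_measurable_rV openT) => x _.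
  exact: (C1with_continuous openT (C1with_sqdist x0 0)).
have := mq measurableT `]-oo, s[%classic (measurable_itv _); rewrite setTI.
by congr measurable; apply/seteqP; split => x /=; rewrite in_itv.
Qed.

Lemma measurable_log_potential e : 0 < e -> measurable_fun Q (z e).
Proof. by move=> e0; have [] := C1with_measurable oA QA (zA e0) mQ. Qed.

Lemma measurable_level e (k : R) : 0 < e ->
  measurable_fun Q (fun x => rho x * sat (z e x - k)).
Proof.
move=> e0; apply: measurable_funM => //.
apply: measurableT_comp; first exact: (continuous_measurable_fun (@continuous_sat R)).
by apply: measurable_funB => //; exact: measurable_log_potential.
Qed.

Lemma level_ge0 e k x : 0 <= rho x * sat (z e x - k).
Proof. by rewrite mulr_ge0// sat_ge0. Qed.

Lemma sqballQ s : s <= s0 -> sqball s `<=` Q.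
Proof. by move=> ss; exact: subset_trans (sqball_coreR ss) coreRQ. Qed.

Definition superlevel e s k : set V := sqball s `&` z e @^-1` `]k, +oo[.

Lemma superlevel_gt e s k x : superlevel e s k x -> k < z e x.
Proof. by move=> [_] /=; rewrite in_itv/= andbT. Qed.

Lemma superlevel_sub e s k : superlevel e s k `<=` sqball s.
Proof. by move=> x []. Qed.

Lemma measurable_superlevel e s k : 0 < e -> s <= s0 -> measurable (superlevel e s k).
Proof.
move=> e0 ss; have mU := measurable_sqball s; have UQ := sqballQ ss.
have mz : measurable_fun (sqball s) (z e).
  by apply: measurable_funS (measurable_log_potential e0).
exact: (mz mU `]k, +oo[%classic (measurable_itv _)).
Qed.

Lemma level_mass_superlevel e s k : 0 < e -> s <= s0 ->
  (level_mass e s k <= \int[LN]_(x in superlevel e s k) (rho x)%:E)%E.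
Proof.
move=> e0 ss; have mE := measurable_superlevel k e0 ss.
have mU := measurable_sqball s; have UQ := sqballQ ss.
apply: le_integral_support => //.
- exact: superlevel_sub.
- by apply: measurable_funS (measurable_level k e0).
- by move=> x _; exact: level_ge0.
- move=> x xU xE; rewrite sat_eq0 ?mulr0// subr_le0 leNgt; apply/negP => h.
  by apply: xE; split => //=; rewrite in_itv/= h.
- by move=> x _; rewrite ler_piMr// sat_le1.
Qed.

Lemma cut_sup_le s x : 0 < s -> s <= s0 ->
  sqgrad (cut' x0 s) x + cut x0 s x ^+ 2 <= cut_sup.
Proof.
move=> sp ss; apply: (le_trans (cut_bound _ _ (ltW sp))).
apply: lerD; last by apply: lerXn2r; rewrite ?nnegrE// ltW// (lt_le_trans sp).
by rewrite ler_wpM2l//; apply: lerXn2r; rewrite ?nnegrE// ltW// (lt_le_trans sp).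
Qed.

Lemma sqgrad_truncation e s k x : sqgrad (truncation_grad e s k) x <=
  2 * (cut x0 s x ^+ 2 * (sat (z e x - k) + sat' (z e x - k)) * sqgrad (gz e) x) +
  2 * (sqgrad (cut' x0 s) x * sat (z e x - k)).
Proof.
set h := sat _; set h' := sat' _; set c := cut x0 s x.
apply: (@le_trans _ _ (2 * (c ^+ 2 * h' ^+ 2 * sqgrad (gz e) x) +
    2 * (sqgrad (cut' x0 s) x * h ^+ 2))).
  rewrite /sqgrad mulr_suml !mulr_sumr -big_split /=; apply: ler_sum => i _.
  rewrite /truncation_grad -/h -/h' -/c.
  by have := sqr_ge0 (c * (h' * gz e i x) - h * cut' x0 s i x); nra.
have hh : h ^+ 2 <= h by rewrite expr2 ler_piMr// ?sat_ge0 ?sat_le1.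
have hh' : h' ^+ 2 <= h + h'.
  apply: (@le_trans _ _ h'); last by rewrite lerDr sat_ge0.
  by rewrite expr2 ler_piMr// ?sat'_ge0 ?sat'_le1.
apply: lerD; rewrite ler_wpM2l//; last by rewrite ler_wpM2l// sqgrad_ge0.
by rewrite ler_wpM2r ?sqgrad_ge0// ler_wpM2l ?sqr_ge0.
Qed.

(** The energy inequality with the truncation at level [k]. Since it is bounded by 1
    together with its slope, its square and the square of its slope are dominated by [h
    + h']. *)
Lemma truncation_energy e s k : 0 < e -> 0 < s -> s <= s0 ->
  (\int[LN]_(x in D) (sqgrad (truncation_grad e s k) x)%:E <=
   (lam0^-1 * ((2 * C0 + 2) * cut_sup))%:E * level_mass e s k)%E.
Proof.
move=> e0 sp ss.
have offU x : ~ sqball s x -> s <= sqdist x0 x.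
  by move=> xU; rewrite leNgt; exact/negP.
have R1U : sqball s `<=` cube x0 R1.
  apply: subset_trans (sqball_coreR ss) _; apply: cubeS.
  by have := core_radius_le; have := r0; lra.
have UQ := sqballQ ss.
have off x : ~ cube x0 R1 x -> s <= sqdist x0 x by move=> xK; apply: offU => /R1U.
have := @energy e (cut x0 s) (cut' x0 s) (fun t => sat (t - k)) (fun t => sat' (t - k))
  e0 (C1with_cut _ _) (fun x xK => cut_eq0 (off x xK)) (fun x i xK => cut'_eq0 i (off x xK))
  (sat_shift_derive k) (@continuous_sat_shift' R k) (fun t => sat_ge0 _) (fun t => sat'_ge0 _).
have [mz mgz] := C1with_measurable oA QA (zA e0) mQ.
have msg : measurable_fun Q (sqgrad (gz e)) by exact: measurable_sqgrad.
have [mc mc'] := C1with_measurable openT (@subsetT _ Q) (C1with_cut x0 s) mQ.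
have msc : measurable_fun Q (sqgrad (cut' x0 s)) by exact: measurable_sqgrad.
have mh : measurable_fun Q (fun x => sat (z e x - k)).
  apply: measurableT_comp; first exact: (continuous_measurable_fun (@continuous_sat R)).
  exact: measurable_funB.
have mh' : measurable_fun Q (fun x => sat' (z e x - k)).
  apply: measurableT_comp; first exact: (continuous_measurable_fun (@continuous_sat' R)).
  exact: measurable_funB.
have [mt mtg] := C1with_measurable oA QA (truncation_C1 s k e0) mQ.
have mst : measurable_fun Q (sqgrad (truncation_grad e s k)) by exact: measurable_sqgrad.
set F1 := (fun x => rho x * cut x0 s x ^+ 2 * (sat (z e x - k) + sat' (z e x - k))
  * sqgrad (gz e) x).
set F2 := (fun x => rho x * (sqgrad (cut' x0 s) x + cut x0 s x ^+ 2) * sat (z e x - k)).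
move=> E.
have mF1 : measurable_fun Q F1.
  apply: measurable_funM => //; apply: measurable_funM => //; last exact: measurable_funD.
  by apply: measurable_funM => //; exact: measurable_funX.
have mF2 : measurable_fun Q F2.
  apply: measurable_funM => //; apply: measurable_funM => //.
  by apply: measurable_funD => //; exact: measurable_funX.
have F10 x : 0 <= F1 x.
  rewrite mulr_ge0 ?sqgrad_ge0// mulr_ge0 ?addr_ge0 ?sat_ge0 ?sat'_ge0//.
  by rewrite mulr_ge0// sqr_ge0.
have F20 x : 0 <= F2 x.
  by rewrite mulr_ge0 ?sat_ge0// mulr_ge0// addr_ge0 ?sqgrad_ge0 ?sqr_ge0.
have mU := measurable_sqball s.
have s00 : 0 <= s0 by exact: sqr_ge0.
have cs0 : 0 <= cut_sup.
  by apply: addr_ge0; [apply: mulr_ge0 => //|]; apply: exprn_ge0.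
have mrh : measurable_fun (sqball s) (fun x => rho x * sat (z e x - k)).
  by apply: measurable_funM => //; exact: measurable_funS mh.
have rh0 x : 0 <= rho x * sat (z e x - k) by rewrite mulr_ge0// sat_ge0.
have F2le : (\int[LN]_(x in Q) (F2 x)%:E <= cut_sup%:E * level_mass e s k)%E.
  rewrite -(ge0_integralZl_EFinD LN mU mrh rh0 cs0).
  apply: le_integral_support => //; first exact: measurable_funM.
    move=> x _ /offU h; rewrite /F2 cut_eq0// /sqgrad big1 ?expr0n ?addr0 ?mulr0 ?mul0r//.
    by move=> i _; rewrite cut'_eq0// expr0n.
  move=> x _; rewrite /F2 -mulrA mulrCA ler_wpM2r ?rh0//.
  exact: cut_sup_le.
have sg0 x : 0 <= sqgrad (truncation_grad e s k) x by exact: sqgrad_ge0.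
have up : (\int[LN]_(x in Q) (rho x * sqgrad (truncation_grad e s k) x)%:E <=
   \int[LN]_(x in Q) (2 * F1 x + 2 * F2 x)%:E)%E.
  apply: le_integral_EFin => //.
  - exact: measurable_funM.
  - by apply: measurable_funD; apply: measurable_funM.
  - by move=> x _; rewrite mulr_ge0.
  - move=> x _; apply: (le_trans (ler_wpM2l (rho0 x) (sqgrad_truncation e s k x))).
    rewrite /F1 /F2; have := mulr_ge0 (rho0 x) (mulr_ge0 (sqr_ge0 (cut x0 s x)) (sat_ge0 (z e x - k))).
    move: (rho x) (cut x0 s x) (sat _) (sat' _) (sqgrad (gz e) x) (sqgrad (cut' x0 s) x).
    by move=> a c h h' g g'; lra.
have split2 : (\int[LN]_(x in Q) (2 * F1 x + 2 * F2 x)%:E =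
    2%:E * \int[LN]_(x in Q) (F1 x)%:E + 2%:E * \int[LN]_(x in Q) (F2 x)%:E)%E.
  rewrite -!ge0_integralZl_EFinD// -ge0_integralD//.
  - by move=> x _; rewrite lee_fin mulr_ge0.
  - by apply/measurable_EFinP; apply: measurable_funM.
  - by move=> x _; rewrite lee_fin mulr_ge0.
  - by apply/measurable_EFinP; apply: measurable_funM.
have all : (lam0%:E * \int[LN]_(x in D) (sqgrad (truncation_grad e s k) x)%:E <=
    ((2 * C0 + 2) * cut_sup)%:E * level_mass e s k)%E.
  apply: (@le_trans _ _ (\int[LN]_(x in D) (rho x * sqgrad (truncation_grad e s k) x)%:E)%E).
    by apply: weight_lower => //; [exact: core_sub|apply: measurable_funS mst => //; exact: core_sub].
  apply: (@le_trans _ _ (\int[LN]_(x in Q) (rho x * sqgrad (truncation_grad e s k) x)%:E)%E).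
    apply: integral_subset_EFin => //; first exact: core_sub.
      exact: measurable_funM.
    by move=> x _; rewrite mulr_ge0.
  apply: (le_trans up); rewrite split2.
  apply: (@le_trans _ _ ((2 * C0 + 2)%:E * \int[LN]_(x in Q) (F2 x)%:E)%E).
    rewrite (EFinD (2 * C0)) ge0_muleDl ?lee_fin ?mulr_ge0 ?(ltW C00)//.
    by apply: leeD2r; rewrite EFinM -muleA lee_wpmul2l// lee_fin.
  rewrite (EFinM (2 * C0 + 2)) -muleA lee_wpmul2l// lee_fin; move: C00; lra.
by rewrite EFinM -muleA lee_pdivlMl.
Qed.

(** On the superlevel set at the higher level the truncated function is at least [(s -
    s') ^+ 2 * sat (k' - k)], so the mass of that set is controlled by the trace
    inequality applied to the truncated function. The factor [mu `^ th] of the trace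
    inequality, with [mu] bounded by the mass of the previous level, makes the estimate
    superlinear. *)
Lemma level_mass_step : exists K th : R, [/\ 0 < K, 0 < th &
  forall e s s' k k' y : R, 0 < e -> 0 < s' -> s' < s -> s <= s0 -> k < k' -> 0 <= y ->
  (level_mass e s k <= y%:E)%E ->
  (level_mass e s' k' <=
    ((((s - s') ^+ 2 * sat (k' - k)) ^+ 2)^-1 * (K * (y / sat (k' - k)) `^ th * y))%:E)%E].
Proof.
have r8 : 0 < r / 8 by rewrite divr_gt0// r0.
have [C [th [C1 th0 trace]]] := trace_C1 r0 r8 beta_gt Lam0.
have s00 : 0 < s0 by rewrite exprn_gt0// divr_gt0// r0.
have cs0 : 0 < cut_sup by rewrite addr_gt0// ?mulr_gt0// exprn_gt0.
pose B := lam0^-1 * ((2 * C0 + 2) * cut_sup).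
have B0 : 0 < B.
  by rewrite mulr_gt0 ?invr_gt0// mulr_gt0// addr_gt0// mulr_gt0.
exists (C * B), th; split; [exact: mulr_gt0|by []|].
move=> e s s' k k' y e0 s'0 ss's ss kk y0 my.
have sp : 0 < s by exact: lt_trans ss's.
set d := sat (k' - k); have d0 : 0 < d by apply: sat_gt0; rewrite subr_gt0.
set a := (s - s') ^+ 2 * d.
have a0 : 0 < a by rewrite mulr_gt0// exprn_gt0// subr_gt0.
have mU := measurable_sqball s; have UQ := sqballQ ss.
have UU : sqball s' `<=` sqball s by move=> x h; exact: lt_trans h ss's.
have msat (j : R) := measurable_level j e0; have rs0 := level_ge0 e.
have ss' : s' <= s0 by exact: le_trans (ltW ss's) ss.
pose E := superlevel e s' k'.
have mE : measurable E by exact: measurable_superlevel.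
have EU : E `<=` sqball s by exact: subset_trans (@superlevel_sub _ _ _) UU.
have EQ : E `<=` Q by exact: subset_trans EU UQ.
have Ek x : E x -> k' < z e x by exact: superlevel_gt.
have step1 := level_mass_superlevel k' e0 ss'.
have massE : (\int[LN]_(x in E) (rho x)%:E <= (y / d)%:E)%E.
  rewrite mulrC EFinM lee_pdivlMl// -ge0_integralZl_EFinD ?(ltW d0)//.
  apply: le_trans my; rewrite /level_mass.
  apply: (@le_trans _ _ (\int[LN]_(x in E) (rho x * sat (z e x - k))%:E)%E).
    apply: le_integral_EFin => //; first exact: measurable_funM.
    - by apply: measurable_funS (msat k).
    - by move=> x _; rewrite mulr_ge0// ltW.
    - by move=> x /Ek h; rewrite mulrC ler_wpM2l// sat_mono// lerD2r ltW.
  by apply: integral_subset_EFin => //; apply: measurable_funS (msat k).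
(* A cube inside the cube of half-side [r] but outside the ball of the cutoff: the
   truncated function vanishes there, so its average is 0. *)
pose h0 : V := \row_i (x0 ord0 i + 3 * r / 4).
have h0r : cube h0 (r / 8) `<=` cube x0 r.
  move=> x xh i; have := xh i; rewrite !mxE !ler_distl => /andP[h1 h2].
  by have rp := r0; apply/andP; split; lra.
have h0s x : cube h0 (r / 8) x -> truncation e s k x = 0.
  move=> xh; rewrite /truncation cut_eq0 ?mul0r//; apply: (le_trans ss).
  apply: (le_trans _ (sqdist_coord x0 x ord0)).
  have := xh ord0; rewrite !mxE ler_distl => /andP[h1 h2].
  by have rp := r0; apply: lerXn2r; rewrite ?nnegrE; lra.
have avg0 : average (truncation e s k) h0 (r / 8) = 0.
  by rewrite (average_local h0s) /average Rintegral_cst ?mul0r//; exact: measurable_cube.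
have ER : E `<=` cube x0 r by exact: subset_trans EU (sqball_coreR ss).
have yd0 : 0 <= y / d by rewrite divr_ge0// ltW.
have := trace x0 h0 rho A _ _ (y / d) E mrho rho0 growth oA (subset_trans core_sub QA)
  (truncation_C1 s k e0) h0r mE ER yd0 massE.
rewrite avg0 => tr.
have low : ((a ^+ 2)%:E * \int[LN]_(x in E) (rho x)%:E <=
    \int[LN]_(x in E) (rho x * (truncation e s k x - 0) ^+ 2)%:E)%E.
  rewrite -ge0_integralZl_EFinD ?sqr_ge0//.
  have [mt _] := C1with_measurable oA QA (truncation_C1 s k e0) mQ.
  have mtE : measurable_fun E (truncation e s k) by exact: measurable_funS mt.
  apply: le_integral_EFin => //; first exact: measurable_funM.
  - apply: measurable_funM => //; apply: measurable_funX.
    exact: measurable_funB.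
  - by move=> x _; rewrite mulr_ge0// sqr_ge0.
  - move=> x Ex; rewrite subr0 mulrC ler_wpM2l//.
    have a1 : a <= truncation e s k x.
      rewrite /a /truncation ler_pM ?sqr_ge0 ?(ltW d0)//.
        by apply: cut_lower; apply: ltW => //; exact: superlevel_sub Ex.
      by rewrite sat_mono// lerD2r ltW// Ek.
    by apply: lerXn2r; rewrite ?nnegrE ?(ltW a0)// (le_trans (ltW a0)).
rewrite EFinM lee_pdivlMl ?exprn_gt0//.
apply: (le_trans (lee_wpmul2l _ step1)); first by rewrite lee_fin sqr_ge0.
apply: (le_trans low); apply: (le_trans tr).
have := truncation_energy k e0 sp ss; rewrite -/B => te.
apply: (@le_trans _ _ ((C * (y / d) `^ th)%:E * (B%:E * y%:E))%E).
  rewrite lee_wpmul2l ?lee_fin ?mulr_ge0 ?powR_ge0 ?(ltW C1)//.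
  by apply: (le_trans te); rewrite lee_wpmul2l// lee_fin ltW.
rewrite -!EFinM lee_fin le_eqVlt; apply/orP; left; apply/eqP; ring.
Qed.

Lemma level_mass_mono e s s' k k' : 0 < e -> s' <= s -> s <= s0 -> k <= k' ->
  (level_mass e s' k' <= level_mass e s k)%E.
Proof.
move=> e0 ss' ss kk; have UQ := sqballQ ss.
have UU : sqball s' `<=` sqball s by move=> x h; exact: lt_le_trans h ss'.
have mU := measurable_sqball s; have mU' := measurable_sqball s'.
apply: (@le_trans _ _ (\int[LN]_(x in sqball s') (rho x * sat (z e x - k))%:E)%E).
  apply: le_integral_EFin => //.
  - by apply: measurable_funS (measurable_level k' e0) => //; exact: subset_trans UU UQ.
  - by apply: measurable_funS (measurable_level k e0) => //; exact: subset_trans UU UQ.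
  - by move=> x _; exact: level_ge0.
  - by move=> x _; rewrite ler_wpM2l// sat_mono// lerD2l lerN2.
apply: integral_subset_EFin => //.
- by apply: measurable_funS (measurable_level k e0).
- by move=> x _; exact: level_ge0.
Qed.

Lemma level_mass_fin e s k : 0 < e -> s <= s0 -> level_mass e s k \is a fin_num.
Proof.
move=> e0 ss; have UQ := sqballQ ss; have mU := measurable_sqball s.
rewrite ge0_fin_numE; last by apply: integral_ge0 => x _; rewrite lee_fin level_ge0.
apply: (@le_lt_trans _ _ (Lam * R2 `^ beta)%:E); last exact: ltry.
apply: le_trans mass_finite; apply: (@le_trans _ _ (\int[LN]_(x in sqball s) (rho x)%:E)%E).
  apply: le_integral_EFin => //.
  - by apply: measurable_funS (measurable_level k e0).
  - by move=> x _; exact: level_ge0.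
  - by move=> x _; rewrite ler_piMr// sat_le1.
exact: integral_subset_EFin.
Qed.

Lemma nbhs_gt (f : V -> R) x a : {for x, continuous f} -> a < f x -> nbhs x [set y | a < f y].
Proof.
by move=> cf ax; apply: (cf [set t | a < t]); exact: (lt_nbhsr ax).
Qed.

(** Near a point [x1] with [w x1 > 0] the potential is bounded above independently of
    [e], hence so is its average over a small cube there. The trace inequality and
    [log_energy] then bound the mean square deviation from this average, and Chebyshev's
    inequality makes the mass above a high level small. *)
Lemma level_mass_initial x1 delta : open_cube x0 r x1 -> 0 < w x1 -> 0 < delta ->
  exists k : R, forall e, 0 < e -> (level_mass e s0 k <= delta%:E)%E.
Proof.
move=> x1r wx1 delta0.
have x1A : A x1 by apply/QA/coreRQ => i; exact: ltW.
have [h h0 hsub] : exists2 h, 0 < h & cube x1 h `<=` open_cube x0 r `&` [set y | w x1 / 2 < w y].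
  apply: nbhs_cube; apply: (@filterI _ _ (nbhs_filter x1)).
    by apply: open_nbhs_nbhs; split => //; exact: open_open_cube.
  apply: nbhs_gt; first exact: C1with_continuous wA x1A.
  by rewrite ltr_pdivrMr// ltr_pMr// ltr1n.
have hr : cube x1 h `<=` cube x0 r by move=> x /hsub[xr _] i; exact: ltW.
have [C [th [C1 th0 trace]]] := trace_C1 r0 h0 beta_gt Lam0.
have [T T0 logT] := log_energy.
pose M := Lam * r `^ beta; have M0 : 0 <= M by rewrite mulr_ge0 ?powR_ge0// ltW.
pose T2 := C * M `^ th * T.
have T20 : 0 <= T2 by rewrite !mulr_ge0 ?powR_ge0 ?(ltW C1).
pose a1 := - ln (w x1 / 2).
(* Since [k >= 2 * a1], the potential differs from its average by at least [k / 2]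
   where it exceeds [k]; since [k >= 1], the bound by [k ^+ 2] improves one by [k]. *)
pose k := Num.max 1 (Num.max (2 * a1) (4 * T2 / delta)).
have k1 : 1 <= k by rewrite le_max lexx.
have ka1 : 2 * a1 <= k by rewrite !le_max lexx orbT.
have kT2 : 4 * T2 / delta <= k by rewrite !le_max lexx !orbT.
exists k => e e0.
have mU := measurable_sqball s0; have UQ := sqballQ (lexx s0).
have mz := measurable_log_potential e0.
pose E := superlevel e s0 k.
have mE : measurable E by exact: measurable_superlevel.
have EU : E `<=` sqball s0 by exact: superlevel_sub.
have EQ : E `<=` Q by exact: subset_trans EU UQ.
have Ek x : E x -> k < z e x by exact: superlevel_gt.
have ER : E `<=` cube x0 r by exact: subset_trans EU (sqball_coreR (lexx s0)).
have step1 := level_mass_superlevel k e0 (lexx s0).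
have massE : (\int[LN]_(x in E) (rho x)%:E <= M%:E)%E.
  apply: le_trans (growth x0 r0); apply: integral_subset_EFin => //.
  exact: measurable_cube.
have avg : average (z e) x1 h <= a1.
  have zQ x : cube x1 h x -> z e x = (z e \_ Q) x.
    by move=> /hr /coreRQ Qx; rewrite patchE mem_set.
  rewrite (average_local zQ).
  have [Mz Mz0 zM] : exists2 M : R, 0 <= M & forall x, cube x1 h x -> `|z e x| <= M.
    apply: bounded_in_cube => x /hr /coreRQ /QA Ax.
    exact: C1with_continuous (zA e0) Ax.
  apply: (@average_le _ _ _ _ _ Mz) => //.
  - exact/(measurable_restrictT _ mQ).
  - by move=> x xh; rewrite -zQ// zM.
  - move=> x xh; rewrite -zQ// /log_potential lerN2 ler_ln ?posrE ?divr_gt0//.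
      by have [_ /= h1] := hsub x xh; lra.
    by rewrite ltr_wpDl// w0//; apply/QA/coreRQ/hr.
have := trace x0 x1 rho A _ _ M E mrho rho0 growth oA (subset_trans core_sub QA)
  (zA e0) hr mE ER M0 massE.
set a := average _ _ _ in avg * => tr.
have low : (((k / 2) ^+ 2)%:E * \int[LN]_(x in E) (rho x)%:E <=
    \int[LN]_(x in E) (rho x * (z e x - a) ^+ 2)%:E)%E.
  rewrite -ge0_integralZl_EFinD ?sqr_ge0//.
  have mzE : measurable_fun E (z e) by exact: measurable_funS mz.
  apply: le_integral_EFin => //; first exact: measurable_funM.
  - apply: measurable_funM => //; apply: measurable_funX.
    exact: measurable_funB.
  - by move=> x _; rewrite mulr_ge0// sqr_ge0.
  - move=> x /Ek kz; rewrite mulrC ler_wpM2l//.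
    by apply: lerXn2r; rewrite ?nnegrE; lra.
apply: (le_trans step1).
have k20 : 0 < (k / 2) ^+ 2 by rewrite exprn_gt0//; lra.
have : (((k / 2) ^+ 2)%:E * \int[LN]_(x in E) (rho x)%:E <= T2%:E)%E.
  apply: (le_trans low); apply: (le_trans tr).
  by rewrite (EFinM (C * _)) lee_wpmul2l ?logT// lee_fin mulr_ge0 ?powR_ge0 ?(ltW C1).
rewrite -lee_pdivlMl// => /le_trans; apply.
rewrite -EFinM lee_fin ler_pdivrMl//.
have : 4 * T2 <= k * delta by rewrite -ler_pdivrMr.
have : delta * k <= delta * k ^+ 2.
  by rewrite ler_wpM2l ?(ltW delta0)// expr2 ler_peMl//; lra.
by rewrite exprMn exprVn; lra.
Qed.

Lemma open_sqball s x : sqball s x -> nbhs x (sqball s).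
Proof.
move=> xs; have cq : {for x, continuous (fun y => s - sqdist x0 y)}.
  exact: (C1with_continuous openT (C1with_sqdist x0 s)).
have : nbhs x [set y | 0 < s - sqdist x0 y] by apply: nbhs_gt; rewrite // subr_gt0.
by apply: (@filterS _ _ (nbhs_filter x)) => y /=; rewrite subr_gt0.
Qed.

(** A continuous function that exceeds [k] at the centre does so on a cube, where the
    weight is bounded from below. *)
Lemma level_mass_gt0 e s k : 0 < e -> 0 < s -> s <= s0 -> k < z e x0 ->
  exists2 c : R, 0 < c & (c%:E <= level_mass e s k)%E.
Proof.
move=> e0 sp ss kz.
have x0s : sqball s x0 by rewrite /sqball /= /sqdist big1// => i _; rewrite subrr expr0n.
pose k' := (k + z e x0) / 2.
have [h h0 hsub] : exists2 h, 0 < h & cube x0 h `<=` sqball s `&` [set y | k' < z e y].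
  apply: nbhs_cube; apply: (@filterI _ _ (nbhs_filter x0)); first exact: open_sqball.
  apply: nbhs_gt; last by rewrite /k'; lra.
  by apply: C1with_continuous (zA e0) _ => //; apply/QA/(sqballQ ss).
have hU : cube x0 h `<=` sqball s by move=> x /hsub[].
have hQ : cube x0 h `<=` Q by exact: subset_trans hU (sqballQ ss).
have kk' : 0 < k' - k by rewrite /k'; lra.
exists (lam0 * (sat (k' - k) * (2 * h) ^+ n)).
  by rewrite mulr_gt0// mulr_gt0 ?sat_gt0// exprn_gt0// mulr_gt0.
apply: (@le_trans _ _ (\int[LN]_(x in cube x0 h) (rho x * sat (z e x - k))%:E)%E); last first.
  apply: integral_subset_EFin => //.
  - exact: measurable_sqball.
  - exact: measurable_cube.
  - by apply: measurable_funS (measurable_level k e0) => //; exact: sqballQ.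
  - by move=> x _; exact: level_ge0.
have mh : measurable (cube x0 h) by exact: measurable_cube.
have msat : measurable_fun (cube x0 h) (fun x => sat (z e x - k)).
  apply: measurableT_comp; first exact: (continuous_measurable_fun (@continuous_sat R)).
  apply: measurable_funB => //.
  by apply: measurable_funS (measurable_log_potential e0).
apply: le_trans (weight_lower mh hQ msat _); last by move=> x; exact: sat_ge0.
rewrite EFinM lee_wpmul2l ?lee_fin ?(ltW lam00)//.
rewrite EFinM -[X in (_ * X <= _)%E](lebesgueN_cube x0 (ltW h0)) -integral_cst//.
apply: le_integral_EFin => //.
- by move=> x _; exact: sat_ge0.
- by move=> x /hsub[_ /= h1]; rewrite sat_mono// lerD2r ltW.
Qed.

(** Suppose [w x1 > 0]. The iteration bounds the potential at the centre by [k + 1],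
    with [k] independent of [e]; but at a zero of [w] the potential is [- ln e], which
    is larger for [e = expR (- (k + 2))]. *)
Lemma local_vanishing : w x0 = 0 -> forall x, open_cube x0 r x -> w x = 0.
Proof.
move=> wx0 x1 x1r; apply/eqP; rewrite eq_le; apply/andP; split; last first.
  by apply/w0/QA/coreRQ => i; exact: ltW.
rewrite leNgt; apply/negP => wx1.
have [K [th [K0 th0 step]]] := level_mass_step.
have s00 : 0 < s0 by rewrite exprn_gt0// divr_gt0// r0.
pose c := (s0 / 2) ^+ 2 / 2.
have c0 : 0 < c by rewrite divr_gt0// exprn_gt0// divr_gt0.
pose B := 256 * 4 `^ th.
have B1 : 1 < B.
  have : 1 <= (4 : R) `^ th.
    have h4 : 1 <= (4 : R) by rewrite ler1n.
    by rewrite -[leLHS](powRr0 (4 : R)); apply: (ler_powR h4); exact: ltW.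
  by rewrite /B; lra.
pose C := (c ^+ 2)^-1 * K * 2 `^ th * B.
have C1 : 0 < C.
  have p2 : 0 < (2 : R) `^ th by rewrite powR_gt0.
  have ci : 0 < (c ^+ 2)^-1 by rewrite invr_gt0 exprn_gt0.
  have B0 := lt_trans ltr01 B1.
  exact: mulr_gt0 (mulr_gt0 (mulr_gt0 ci K0) p2) B0.
have [delta delta0 decay] := fast_decay C1 B1 th0.
have [k initial] := level_mass_initial x1r wx1 delta0.
pose e := expR (- (k + 2)); have e0 : 0 < e by exact: expR_gt0.
have zx0 : z e x0 = k + 2 by rewrite /log_potential wx0 add0r /e expRK opprK.
pose q (j : nat) : R := 2^-1 ^+ j.
have q0 j : 0 < q j by rewrite exprn_gt0.
have q1 j : q j <= 1 by rewrite exprn_ile1// invf_le1// ler1n.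
have qS j : q j = 2 * q j.+1 by rewrite /q exprS mulrA mulfV// mul1r.
(* Squared radii decrease to [s0 / 2] and levels increase to [k + 1] in geometric steps. *)
pose s j := s0 / 2 * (1 + q j); pose l j := k + 1 - q j.
have ss j : s j <= s0 by rewrite /s; have := q1 j; move: s00; nra.
have sp j : s0 / 2 <= s j by rewrite /s ler_peMr ?(ltW (divr_gt0 s00 _))// lerDl ltW.
pose Y j := fine (level_mass e (s j) (l j)).
have YE j : (Y j)%:E = level_mass e (s j) (l j) by rewrite /Y fineK// level_mass_fin.
have Y0 j : 0 <= Y j.
  by rewrite fine_ge0//; apply: integral_ge0 => x _; rewrite lee_fin level_ge0.
have Yd : Y 0%N <= delta.
  have s0E : s 0%N = s0 by rewrite /s /q expr0; move: (s0) => a; field.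
  have l0E : l 0%N = k by rewrite /l /q expr0 addrK.
  by rewrite -lee_fin YE s0E l0E; exact: initial.
have rec j : Y j.+1 <= C * B ^+ j * Y j `^ (1 + th).
  have qd := q0 j.+1; have qq := qS j; have qj1 := q1 j.+1.
  have := step e (s j) (s j.+1) (l j) (l j.+1) (Y j) e0.
  have -> : s j - s j.+1 = s0 / 2 * q j.+1 by rewrite /s qq; ring.
  have -> : l j.+1 - l j = q j.+1 by rewrite /l qq; ring.
  have sp1 : 0 < s j.+1 by rewrite (lt_le_trans _ (sp _))// divr_gt0.
  have sps : s j.+1 < s j.
    by rewrite -subr_gt0 (_ : _ - _ = s0 / 2 * q j.+1) ?mulr_gt0 ?divr_gt0// /s qq; ring.
  have lll : l j < l j.+1 by rewrite /l; lra.
  move=> /(_ sp1 sps (ss j) lll (Y0 j)); rewrite -!YE => /(_ (lexx _)).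
  rewrite lee_fin => /le_trans; apply.
  have satq := sat_lower qd qj1.
  set t := q j.+1 in qd qq qj1 satq *; set st := sat t in satq *.
  have st0 : 0 < st by rewrite (lt_le_trans _ satq)// divr_gt0// exprn_gt0.
  clearbody st.
  have f1 : (((s0 / 2 * t) ^+ 2 * st) ^+ 2)^-1 <= (c ^+ 2)^-1 * (t ^+ 8)^-1.
    rewrite -invfM lef_pV2 ?posrE ?mulr_gt0 ?exprn_gt0 ?mulr_gt0 ?exprn_gt0 ?mulr_gt0 ?divr_gt0//.
    have -> : c ^+ 2 * t ^+ 8 = ((s0 / 2 * t) ^+ 2 * (t ^+ 2 / 2)) ^+ 2 by rewrite /c; field.
    have p2 : 0 <= (s0 / 2 * t) ^+ 2 by exact: sqr_ge0.
    apply: lerXn2r; [|by rewrite nnegrE (mulr_ge0 p2)// ltW|exact: ler_wpM2l].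
    by rewrite nnegrE (mulr_ge0 p2)// divr_ge0// sqr_ge0.
  have tE : t ^-1 = 2 ^+ j.+1 by rewrite /t /q exprVn invrK.
  have f2 : (Y j / st) `^ th <= Y j `^ th * (2 `^ th * (4 `^ th) ^+ j.+1).
    have -> : 2 `^ th * (4 `^ th) ^+ j.+1 = (2 * 4 ^+ j.+1) `^ th :> R.
      have h4 : 0 <= (4 : R) by [].
      by rewrite powRM ?(exprn_ge0 _ h4)// powR_exprn.
    rewrite -powRM ?mulr_ge0 ?exprn_ge0//.
    have p4 : 0 < 2 * 4 ^+ j.+1 :> R by rewrite mulr_gt0// exprn_gt0.
    have le4 : Y j / st <= Y j * (2 * 4 ^+ j.+1).
      apply: ler_wpM2l => //; rewrite -[leRHS]invrK lef_pV2 ?posrE ?invr_gt0//.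
      apply: le_trans satq; rewrite le_eqVlt; apply/orP; left; apply/eqP.
      have -> : 4 ^+ j.+1 = (t ^-1) ^+ 2 :> R.
        by rewrite tE -exprM mulnC exprM; congr (_ ^+ _); ring.
      by field; rewrite gt_eqF.
    apply: (ge0_ler_powR (ltW th0) _ _ le4); rewrite nnegrE; first exact: divr_ge0 (Y0 j) (ltW st0).
    exact: mulr_ge0 (Y0 j) (ltW p4).
  have f3 : (t ^+ 8)^-1 = 256 ^+ j.+1.
    by rewrite -exprVn tE -exprM mulnC exprM; congr (_ ^+ _); ring.
  have E : (Y j) `^ (1 + th) = Y j * Y j `^ th.
    by rewrite powRD ?powRr1// gt_eqF// addr_gt0.
  rewrite E (_ : C * _ * _ = ((c ^+ 2)^-1 * 256 ^+ j.+1) *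
    (K * (Y j `^ th * (2 `^ th * (4 `^ th) ^+ j.+1)) * Y j)); last first.
    have BE : B * B ^+ j = 256 ^+ j.+1 * (4 `^ th) ^+ j.+1 by rewrite -exprS /B exprMn.
    transitivity ((c ^+ 2)^-1 * K * 2 `^ th * (B * B ^+ j) * (Y j * Y j `^ th)).
      by rewrite /C; ring.
    by rewrite BE; ring.
  apply: ler_pM.
  - by rewrite invr_ge0 sqr_ge0.
  - by rewrite !mulr_ge0 ?powR_ge0// ltW.
  - by rewrite -f3.
  - by rewrite ler_wpM2r// ler_wpM2l// ltW.
have [a a0 la] : exists2 a : R, 0 < a & (a%:E <= level_mass e (s0 / 2) (k + 1))%E.
  apply: level_mass_gt0 => //; first by rewrite divr_gt0.
    by rewrite ler_pdivrMr//; move: s00; lra.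
  by rewrite zx0 ltrD2l; lra.
have [|j Yj] := decay Y Y0 Yd rec (a / 2); first by rewrite divr_gt0.
have : (a%:E <= (Y j)%:E)%E.
  rewrite YE (le_trans la)//; apply: level_mass_mono => //.
  by rewrite /l; have := q0 j; lra.
by rewrite lee_fin; lra.
Qed.

End local_estimates.

(** * Strong comparison and the Harnack inequality *)

Section comparison.
Context {R : realType} {m : nat}.
Local Notation n := m.+2.
Local Notation V := 'rV[R]_n.
Local Notation LN := (@lebesgueN R n).
Implicit Types x : V.

Variables (Omega Omega' : set V) (p Lambda kappa : R) (u v : V -> R).
Hypotheses (oO : open Omega) (oO' : open Omega') (subO : Omega' `<=` Omega).
Hypotheses (p1 : 1 < p) (kappa0 : 0 < kappa).
Hypotheses (uC : C1_on Omega u) (vC : C1_on Omega v).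
Hypothesis uv : forall x, Omega x -> u x <= v x.
Hypothesis weak : weak_plap_le p Lambda Omega u v.
Hypothesis condrho : condM kappa Omega' (plap_weight p u v).

(** The weight with its infinite values, taken for [p < 2] where both gradients vanish,
    replaced by 0, and extended by 0. The structural inequalities of the flux hold
    everywhere with this version, both sides being 0 at such points, and it agrees with
    the original almost everywhere, because that one has finite mass on balls. *)
Definition finite_weight x : R :=
  if x \in Omega' then (enorm (grad u x) + enorm (grad v x)) `^ (p - 2) else 0.
Local Notation rho := finite_weight.

Let mO' : measurable Omega'. Proof. exact: open_rV_measurable. Qed.

Lemma finite_weightE x : Omega' x ->
  rho x = (enorm (grad u x) + enorm (grad v x)) `^ (p - 2).
Proof. by move=> Ox; rewrite /rho mem_set. Qed.

Lemma finite_weight_ge0 x : 0 <= rho x.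
Proof. by rewrite /rho; case: ifP => // _; exact: powR_ge0. Qed.

Lemma finite_weight_le x : Omega' x -> ((rho x)%:E <= plap_weight p u v x)%E.
Proof.
by move=> Ox; rewrite finite_weightE// /plap_weight /epowR; case: ifP => // _; rewrite leey.
Qed.

Lemma finite_weight_fin x : Omega' x -> plap_weight p u v x \is a fin_num ->
  plap_weight p u v x = (rho x)%:E.
Proof. by move=> Ox; rewrite finite_weightE// /plap_weight /epowR; case: ifP. Qed.

Lemma plap_weight_ge0 x : (0 <= plap_weight p u v x)%E.
Proof. by rewrite /plap_weight /epowR; case: ifP => // _; rewrite lee_fin powR_ge0. Qed.

Lemma measurable_finite_weight : measurable_fun setT rho.
Proof.
have [_ mu] := C1with_measurable oO subO (C1with_partial uC) mO'.
have [_ mv] := C1with_measurable oO subO (C1with_partial vC) mO'.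
have -> : rho = (fun x => (enorm (grad u x) + enorm (grad v x)) `^ (p - 2)) \_ Omega'.
  by apply/funext => x; rewrite patchE.
apply/(measurable_restrictT _ mO').
apply: (@measurableT_comp _ _ _ _ _ _ (fun t : R => t `^ (p - 2))).
  exact: measurable_powR.
apply: measurable_funD; apply: measurable_enorm => i.
  by apply: eq_measurable_fun (mu i) => x _; rewrite mxE.
by apply: eq_measurable_fun (mv i) => x _; rewrite mxE.
Qed.

Lemma measurable_eball x r : measurable (eball x r : set V).
Proof.
have me : measurable_fun setT (fun y : V => enorm (y - x)).
  apply: (@measurable_enorm _ _ setT (fun y : V => y - x)) => i.
  have := measurable_funB (@measurable_rV_coord R n i) (@measurable_cst _ _ V R setT (x ord0 i)).
  by apply: eq_measurable_fun => y _; rewrite !mxE.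
have := me measurableT `]-oo, r[%classic (measurable_itv _); rewrite setTI.
by congr measurable; apply/seteqP; split => y /=; rewrite in_itv.
Qed.

Lemma cube_eball x (s : R) : 0 < s -> cube x s `<=` (eball x (n.+1%:R * s) : set V).
Proof.
move=> s0 y xs; rewrite /eball /=.
apply: (@le_lt_trans _ _ (n%:R * s)); last by rewrite ltr_pM2r// ltr_nat.
by apply: enorm_le_coord => [|i]; [exact: ltW|rewrite !mxE].
Qed.

Let mplap : measurable_fun Omega' (plap_weight p u v). Proof. by case: condrho. Qed.

(** A cube of half-side [s] lies in the Euclidean ball of radius [n.+1%:R * s], so the
    growth condition on balls gives one on cubes. *)
Lemma finite_weight_growth : exists2 Lam : R, 0 < Lam & forall y (s : R), 0 < s ->
  (\int[LN]_(x in cube y s) (rho x)%:E <= (Lam * s `^ (n%:R - 2 + kappa))%:E)%E.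
Proof.
have [_ _ [lam0 [Lam0 [_ L0 _ growth]]]] := condrho.
exists (Lam0 * n.+1%:R `^ (n%:R - 2 + kappa)); first by rewrite mulr_gt0// powR_gt0.
move=> y s s0; have mrho := measurable_finite_weight.
have mC : measurable (cube y s) by exact: measurable_cube.
have mB := @measurable_eball y (n.+1%:R * s).
have mCO : measurable (cube y s `&` Omega') by exact: measurableI.
have sN : 0 < n.+1%:R * s by rewrite mulr_gt0.
have := growth y _ sN; rewrite powRM ?(ltW s0)// mulrA; apply: le_trans.
apply: (@le_trans _ _ (\int[LN]_(x in cube y s `&` Omega') (rho x)%:E)%E).
  apply: le_integral_support => //.
  - exact: measurable_funTS.
  - exact: measurable_funTS.
  - by move=> x _; exact: finite_weight_ge0.
  - by move=> x Cx CO; rewrite /rho memNset// => Ox; apply: CO.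
apply: (@le_trans _ _ (\int[LN]_(x in cube y s `&` Omega') plap_weight p u v x)%E).
  apply: ge0_le_integral => //.
  - by move=> x _; rewrite lee_fin finite_weight_ge0.
  - by apply/measurable_EFinP; exact: measurable_funTS.
  - by apply: (measurable_funS mO' _ mplap).
  - by move=> x [_ Ox]; exact: finite_weight_le.
rewrite /weighted_measure; apply: ge0_subset_integral => //.
- exact: measurableI.
- by apply: (measurable_funS mO' _ mplap).
- by move=> x _; exact: plap_weight_ge0.
- by apply: setSI; exact: cube_eball.
Qed.

(** An integrable weight is finite almost everywhere, and where it is finite it equals
    [finite_weight]. *)
Lemma finite_weight_lower : exists2 lam : R, 0 < lam &
  forall x0 (r : R), 0 < r -> cube x0 r `<=` Omega' ->
    {ae LN, forall x, cube x0 r x -> lam <= rho x}.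
Proof.
have [_ _ [lam [Lam0 [l0 L0 lower growth]]]] := condrho.
exists lam => // x0 r r0 rO.
have mC : measurable (cube x0 r) by exact: measurable_cube.
have mB := @measurable_eball x0 (n.+1%:R * r).
have fin : {ae LN, forall x, cube x0 r x -> plap_weight p u v x \is a fin_num}.
  apply: integrable_ae => //; apply/integrableP; split; first by apply: (measurable_funS mO' _ mplap).
  under eq_integral do rewrite gee0_abs ?plap_weight_ge0//.
  have rN : 0 < n.+1%:R * r by rewrite mulr_gt0.
  apply: le_lt_trans (le_lt_trans (growth x0 _ rN) (ltry _)).
  apply: ge0_subset_integral => //.
  - exact: measurableI.
  - by apply: (measurable_funS mO' _ mplap).
  - by move=> x _; exact: plap_weight_ge0.
  - by move=> x xr; split; [exact: cube_eball|exact: rO].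
apply: filterS2 fin lower => x xfin xlow xr; have Ox := rO x xr.
by have := xlow Ox; rewrite (finite_weight_fin Ox (xfin xr)) lee_fin.
Qed.

Definition flux_diff (i : 'I_n) x := (pflux p (grad u x) - pflux p (grad v x)) ord0 i.
Definition grad_diff (i : 'I_n) x := partial i v x - partial i u x.
Local Notation b := flux_diff.
Local Notation gw := grad_diff.

Lemma diff_C1 : C1with Omega (fun x => v x - u x) gw.
Proof. exact: (C1withB (C1with_partial vC) (C1with_partial uC)). Qed.

Lemma sqgrad_grad_diff x : sqgrad gw x = enorm (grad u x - grad v x) ^+ 2.
Proof.
by rewrite enormB_sym sqr_enorm; apply: eq_bigr => i _; rewrite !mxE expr2.
Qed.

Lemma flux_diff_bounds : exists c1 c2 : R, [/\ 0 < c1, 0 < c2 &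
  forall x, Omega' x ->
    \sum_i b i x * gw i x <= - (c1 * rho x * sqgrad gw x) /\
    forall g : 'I_n -> V -> R, `|\sum_i b i x * g i x| <=
      c2 * rho x * (Num.sqrt (sqgrad gw x) * Num.sqrt (sqgrad g x))].
Proof.
have [c1 [c2 [c10 c20 bounds]]] := @pflux_bounds R n p p1.
exists c1, c2; split => // x Ox; have := bounds (grad u x) (grad v x).
rewrite /= -finite_weightE// => -[lo up]; split.
  rewrite sqgrad_grad_diff lerNr; apply: (le_trans lo).
  rewrite le_eqVlt; apply/orP; left; apply/eqP.
  rewrite /dotv -sumrN; apply: eq_bigr => i _; rewrite -mulrN; congr (_ * _).
  by rewrite /gw !mxE opprB.
move=> g; have -> : \sum_i b i x * g i x =
    dotv (pflux p (grad u x) - pflux p (grad v x)) (\row_i g i x).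
  by apply: eq_bigr => i _; rewrite /b [(\row__ _) _ _]mxE.
apply: (le_trans (norm_dotv_le _ _)).
have -> : enorm (\row_i g i x) = Num.sqrt (sqgrad g x).
  by rewrite /enorm /dotv /sqgrad; congr Num.sqrt; apply: eq_bigr => i _; rewrite mxE expr2.
by rewrite mulrA ler_wpM2r ?sqrtr_ge0// sqgrad_grad_diff sqrtr_sqr ger0_norm ?enorm_ge0.
Qed.

Lemma measurable_flux_diff (B : set V) i : measurable B -> B `<=` Omega ->
  measurable_fun B (b i).
Proof.
move=> mB BO.
have [_ mu] := C1with_measurable oO BO (C1with_partial uC) mB.
have [_ mv] := C1with_measurable oO BO (C1with_partial vC) mB.
have mpu : measurable_fun B (fun x => pflux p (grad u x) ord0 i).
  apply: measurable_pflux => j.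
  by apply: eq_measurable_fun (mu j) => x _; rewrite mxE.
have mpv : measurable_fun B (fun x => pflux p (grad v x) ord0 i).
  apply: measurable_pflux => j.
  by apply: eq_measurable_fun (mv j) => x _; rewrite mxE.
apply: eq_measurable_fun (measurable_funB mpu mpv) => x _.
by rewrite /flux_diff [RHS]mxE [X in _ = _ + X]mxE.
Qed.

Lemma grad_bounded (f : V -> R) x0 (r : R) : C1_on Omega f -> 0 < r -> cube x0 r `<=` Omega ->
  exists2 M : R, 0 <= M & forall x, cube x0 r x -> enorm (grad f x) <= M.
Proof.
move=> fC r0 rO.
have /choice[M HM] : forall i : 'I_n, exists M : R, 0 <= M /\
    forall x, cube x0 r x -> `|partial i f x| <= M.
  move=> i; have [|M M0 fM] := @bounded_in_cube _ _ (partial i f) x0 r.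
    by move=> x /rO /fC /(_ i)[].
  by exists M.
have S0 : 0 <= \sum_i M i by apply: sumr_ge0 => i _; have [] := HM i.
exists (n%:R * \sum_i M i); first by rewrite mulr_ge0.
move=> x xr; apply: enorm_le_coord => // i; rewrite mxE.
have [_ /(_ x xr)/le_trans] := HM i; apply.
by rewrite (bigD1 i)//= lerDl; apply: sumr_ge0 => j _; have [] := HM j.
Qed.

Lemma flux_diff_bounded x0 (r : R) : 0 < r -> cube x0 r `<=` Omega ->
  exists M : R, forall x, cube x0 r x ->
    (forall i, `|b i x| <= M) /\ `|v x - u x| <= M.
Proof.
move=> r0 rO.
have [Mu Mu0 uM] := grad_bounded uC r0 rO; have [Mv Mv0 vM] := grad_bounded vC r0 rO.
have [Mw Mw0 wM] : exists2 M : R, 0 <= M & forall x, cube x0 r x -> `|v x - u x| <= M.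
  by apply: bounded_in_cube => x /rO Ox; exact: C1with_continuous diff_C1 Ox.
exists (Mu `^ (p - 1) + Mv `^ (p - 1) + Mw) => x xr; split; last first.
  by rewrite (le_trans (wM x xr))// lerDr addr_ge0 ?powR_ge0.
move=> i; rewrite /flux_diff mxE [X in _ + X]mxE (le_trans (ler_normB _ _))//.
have h1 := pflux_coord_le i p1 (uM x xr); have h2 := pflux_coord_le i p1 (vM x xr).
lra.
Qed.

(** The weak inequality, rewritten as an integral over a cube that contains the support
    of the test function; its gradient vanishes off the support since a zero of a
    nonnegative function is critical. *)
Lemma weak_flux x0 (r : R) (psi : V -> R) : 0 < r -> cube x0 r `<=` Omega -> smooth psi ->
  (forall x, 0 <= psi x) -> (forall x, ~ open_cube x0 r x -> psi x = 0) ->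
  \int[LN]_(x in cube x0 r) flux b (fun x => v x - u x) Lambda (fun i => partial i psi) psi x <= 0.
Proof.
move=> r0 rO psiS psi0 psiK.
have off x : ~ cube x0 r x -> psi x = 0.
  by move=> xr; apply: psiK => xo; apply: xr => i; exact: ltW.
have offD i x : ~ cube x0 r x -> partial i psi x = 0.
  have dpsi y : is_derive y (delta_mx ord0 i : V) psi (partial i psi y).
    by have [] := smooth_C1with psiS (Logic.I : setT y) i.
  by move=> /off; exact: (is_derive_min dpsi psi0).
have := weak (test_fun_cube rO psiS psiK) psi0.
rewrite (Rintegral_support rO); last first.
  by move=> x /offD h; rewrite /dotv big1// => i _; rewrite [(grad _ _) _ _]mxE h mulr0.
rewrite (Rintegral_support rO); last by move=> x /off ->; rewrite mulr0.
have [M HM] := flux_diff_bounded r0 rO.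
have mC : measurable (cube x0 r) by exact: measurable_cube.
have mb i : measurable_fun (cube x0 r) (b i) by exact: measurable_flux_diff.
have [mw _] := C1with_measurable oO rO diff_C1 mC.
have bM i x : cube x0 r x -> `|b i x| <= M by move=> /HM[].
have wM x : cube x0 r x -> `|v x - u x| <= M by move=> /HM[].
have I0 := flux_integrable 0 r0 mb mw bM wM (smooth_C1with psiS).
have I1 := flux_integrable 1 r0 mb mw bM wM (smooth_C1with psiS).
have Iw : LN.-integrable (cube x0 r) (EFin \o (fun x => (v x - u x) * psi x)).
  have := integrableB mC I0 I1; apply: eq_integrable => // x _.
  by rewrite /= -EFinB /flux; congr EFin; ring.
rewrite -RintegralZl// => wk.
have -> : \int[LN]_(x in cube x0 r) flux b (fun x => v x - u x) Lambda
      (fun i => partial i psi) psi x =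
    \int[LN]_(x in cube x0 r) (flux b (fun x => v x - u x) 0 (fun i => partial i psi) psi x
      - Lambda * ((v x - u x) * psi x)).
  by apply: eq_Rintegral => x _; rewrite /flux mul0r subr0.
rewrite RintegralB//; last first.
  have := integrableZl mC Lambda Iw; apply: eq_integrable => // x _.
rewrite subr_le0; apply: le_trans wk; rewrite le_eqVlt; apply/orP; left; apply/eqP.
apply: eq_Rintegral => x _; rewrite /flux mul0r subr0.
by apply: eq_bigr => i _; rewrite [(grad _ _) _ _]mxE.
Qed.

Lemma diff_vanishing_nbhs x0 : Omega' x0 -> v x0 - u x0 = 0 ->
  nbhs x0 [set x | v x - u x = 0].
Proof.
move=> Ox0 w0.
have [r r0 rO'] : exists2 r, 0 < r & cube x0 r `<=` Omega'.
  by apply: nbhs_cube; exact: open_nbhs_nbhs.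
have rO : cube x0 r `<=` Omega by exact: subset_trans rO' subO.
pose r1 := r / 2; have r10 : 0 < r1 by rewrite divr_gt0.
have r1r : r1 < r by rewrite /r1; lra.
have mC : measurable (cube x0 r) by exact: measurable_cube.
have [M HM] := flux_diff_bounded r0 rO.
have mb i : measurable_fun (cube x0 r) (b i) by exact: measurable_flux_diff.
have [mw _] := C1with_measurable oO rO diff_C1 mC.
have bM i x : cube x0 r x -> `|b i x| <= M by move=> /HM[].
have wM x : cube x0 r x -> `|v x - u x| <= M by move=> /HM[].
have w_ge0 x : Omega x -> 0 <= v x - u x by move=> /uv; rewrite subr_ge0.
have weakC phi g := weak_limit (phi := phi) (g := g) r1r r0 mb mw bM wM
  (fun psi => @weak_flux x0 r psi r0 rO).
have [Lam Lam0 growth] := finite_weight_growth.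
have [lam lam0 lower] := finite_weight_lower.
have [c1 [c2 [c10 c20 bounds]]] := flux_diff_bounds.
have [C C0 energy] := @energy_inequality R n c1 c2 lam Lambda c10 c20 lam0.
have beta_gt : m%:R < n%:R - 2 + kappa.
  by rewrite -addn2 natrD addrK ltrDl.
have bw x : cube x0 r x -> \sum_i b i x * gw i x <= - (c1 * rho x * sqgrad gw x).
  by move=> /rO' /bounds[].
have bg x (g : 'I_n -> V -> R) : cube x0 r x -> `|\sum_i b i x * g i x| <=
      c2 * rho x * (Num.sqrt (sqgrad gw x) * Num.sqrt (sqgrad g x)).
  by move=> /rO' /bounds[].
apply: (@filterS _ _ (nbhs_filter x0) (open_cube x0 (core_radius (m := m) r1))).
  move=> x xr.
  apply: (local_vanishing r10 r1r oO rO measurable_finite_weight finite_weight_ge0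
    beta_gt Lam0 growth lam0 (lower x0 r r0 rO') diff_C1 w_ge0 C0 _ w0 xr).
  move=> e eta ge h h' e0 etaC etaK geK dh ch h_ge0 h'_ge0.
  exact: (energy x0 r1 r M e Omega rho (fun x => v x - u x) eta b gw ge h h' r1r r0 e0 oO rO
    measurable_finite_weight finite_weight_ge0 (lower x0 r r0 rO') diff_C1 w_ge0 mb bM wM bw bg
    weakC etaC etaK geK dh ch h_ge0 h'_ge0).
apply: open_nbhs_nbhs; split; first exact: open_open_cube.
by move=> i; rewrite subrr normr0 core_radius_gt0.
Qed.

Lemma diff_continuous x : Omega x -> {for x, continuous (fun y => v y - u y)}.
Proof. by move=> Ox; exact: C1with_continuous diff_C1 Ox. Qed.

(** The zero set of [v - u] is open by [diff_vanishing_nbhs] and closed by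
    continuity. *)
Lemma diff_vanishing (B : set V) x0 : connected B -> B `<=` Omega' -> B x0 ->
  v x0 - u x0 = 0 -> forall x, B x -> v x - u x = 0.
Proof.
move=> cB BO Bx0 w0.
pose Z := [set x | v x - u x = 0].
suff BZ : B `&` Z = B by move=> x; rewrite -BZ => -[].
apply: cB; first by exists x0.
- exists Z^°; first exact: open_interior.
  apply/seteqP; split => x [Bx Zx]; split => //; last exact: nbhs_singleton.
  exact: diff_vanishing_nbhs (BO x Bx) Zx.
- exists (closure (B `&` Z)); first exact: closed_closure.
  apply/seteqP; split => x [Bx Zx]; split => //; first exact: subset_closure.
  have Ox : Omega x by exact/subO/BO.
  apply/eqP; rewrite eq_le subr_ge0 uv// andbT leNgt; apply/negP => wx.
  have [y [[_ /= ->]]] := Zx _ (nbhs_gt (diff_continuous Ox) wx).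
  by rewrite /= ltxx.
Qed.

Hypothesis cO' : connected Omega'.
Hypotheses (closO' : compact (closure Omega')).

(** The infimum over the ball is bounded below by the minimum over its compact closure.
    If this minimum is 0, then [v - u] vanishes identically and so does the left side;
    otherwise the infimum is positive and [C] only has to exceed the quotient of the
    left side, which is finite, by the infimum. *)
Lemma harnack (delta : R) x0 s : 0 < delta -> closure (eball x0 (6 * delta)) `<=` Omega' ->
  0 < s -> exists C : R, 0 < C /\
    (((\int[weighted_measure (plap_weight p u v) Omega']_(y in eball x0 (2 * delta))
        ((v y - u y) `^ s)%:E) `^ s^-1)
      <= (C * inf [set v y - u y | y in eball x0 delta])%:E)%E.
Proof.
move=> delta0 ballO s0.
have [mu muE] := weighted_measure_isMeasure mO' mplap (fun x _ => plap_weight_ge0 x).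
have ball_le (a c : R) : a <= c -> eball x0 a `<=` (eball x0 c : set V).
  by move=> ac y h; exact: lt_le_trans ac.
have compact_ball (a : R) : a <= 6 * delta -> compact (closure (eball x0 a : set V)).
  move=> a6; apply: (subclosed_compact (@closed_closure _ _) closO').
  by apply: closure_subset; apply: subset_trans ballO; exact: subset_trans (ball_le _ _ a6) (@subset_closure _ _).
have ballO' (a : R) : a <= 6 * delta -> closure (eball x0 a : set V) `<=` Omega'.
  by move=> a6; apply: subset_trans ballO; apply: closure_subset; exact: ball_le.
have w_cont (a : R) : a <= 6 * delta ->
    {within closure (eball x0 a : set V), continuous (fun y => v y - u y)}.
  move=> a6; apply: continuous_in_subspaceT => y; rewrite inE => /(ballO' a a6) /subO.
  exact: diff_continuous.
have ball_center (a : R) : 0 < a -> closure (eball x0 a : set V) x0.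
  move=> a0; apply: subset_closure; rewrite /eball /= subrr.
  by rewrite -(@scale0r _ V 0) enormZ normr0 mul0r.
have d6 : delta <= 6 * delta by lra.
have d26 : 2 * delta <= 6 * delta by lra.
have d20 : 0 < 2 * delta by lra.
have w_ge0 y : Omega' y -> 0 <= v y - u y by move=> /subO /uv; rewrite subr_ge0.
have [c0 c0in min_c0] := compact_EVT_min (ex_intro _ x0 (ball_center _ delta0)) (compact_ball _ d6) (w_cont _ d6).
have {}c0in : closure (eball x0 delta : set V) c0 by rewrite inE in c0in.
have Oc0 := ballO' _ d6 _ c0in.
have inf_ge : v c0 - u c0 <= inf [set v y - u y | y in eball x0 delta].
  apply: lb_le_inf.
    exists (v x0 - u x0), x0 => //.
    by rewrite /eball /= subrr -(@scale0r _ V 0) enormZ normr0 mul0r.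
  by move=> _ [y yd <-]; apply: min_c0; rewrite inE; exact: subset_closure.
have := w_ge0 _ Oc0; rewrite le_eqVlt => /orP[/eqP wc0|wc0].
  have w_zero := diff_vanishing cO' (@subset_refl _ Omega') Oc0 (esym wc0).
  exists 1; split => //; rewrite mul1r muE integral0_eq.
    by rewrite poweR0r ?invr_eq0 ?gt_eqF// lee_fin wc0.
  move=> y y2; rewrite w_zero ?powR0 ?gt_eqF//.
  by apply: (ballO' _ d26); exact: subset_closure.
set low := inf _ in inf_ge *; have low0 : 0 < low by exact: lt_le_trans inf_ge.
set I := (\int[_]_(_ in _) _)%E.
have I0 : (0 <= I)%E.
  by rewrite /I muE; apply: integral_ge0 => y _; rewrite lee_fin powR_ge0.
have [c1 c1in max_c1] := compact_EVT_max (ex_intro _ x0 (ball_center _ d20)) (compact_ball _ d26) (w_cont _ d26).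
have ball2 : eball x0 (2 * delta) `<=` Omega'.
  exact: subset_trans (@subset_closure _ _) (ballO' _ d26).
have Ioo : (I < +oo)%E.
  have mB := @measurable_eball x0 (2 * delta).
  apply: (@le_lt_trans _ _ (\int[mu]_(y in eball x0 (2 * delta)) (cst ((v c1 - u c1) `^ s)%:E y))%E).
    rewrite /I muE; apply: ge0_le_integral => //.
    - by move=> y _; rewrite lee_fin powR_ge0.
    - apply/measurable_EFinP; apply: (@measurableT_comp _ _ _ _ _ _ (fun t : R => t `^ s)).
        exact: measurable_powR.
      by have [] := C1with_measurable oO (subset_trans ball2 subO) diff_C1 mB.
    - move=> y y2; rewrite lee_fin; apply: ge0_ler_powR; rewrite ?nnegrE ?(ltW s0) ?w_ge0//.
      + exact: ball2.
      + by rewrite inE in c1in; exact: (ballO' _ d26).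
      + by apply: max_c1; rewrite inE; exact: subset_closure.
  rewrite integral_cst// -muE.
  have [_ _ [lam [Lam [_ L0 _ growth]]]] := condrho.
  rewrite lte_mul_pinfty ?lee_fin ?powR_ge0//.
  exact: le_lt_trans (growth x0 _ d20) (ltry _).
have Pfin : (I `^ s^-1)%E \is a fin_num by rewrite ge0_fin_numE ?poweR_ge0// poweR_lty.
exists (fine (I `^ s^-1)%E / low + 1); split.
  by rewrite ltr_pwDr// divr_ge0 ?(ltW low0)// fine_ge0// poweR_ge0.
rewrite -[leLHS]fineK// lee_fin mulrDl mul1r divfK ?gt_eqF// lerDl; exact: ltW.
Qed.

End comparison.

Theorem theorem7 (R : realType) (N : nat) (hN : (2 <= N)%N)
  (Omega : set 'rV[R]_N) (hOmega : domain Omega)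
  (p : R) (hp : 1 < p)
  (u v : 'rV[R]_N -> R) (hu : C1_on Omega u) (hv : C1_on Omega v)
  (huv : forall x, Omega x -> u x <= v x)
  (Lambda : R) (hweak : weak_plap_le p Lambda Omega u v)
  (Omega' : set 'rV[R]_N) (hOmega' : subdomain_cc Omega' Omega)
  (kappa : R) (hkappa : 0 < kappa)
  (hM : condM kappa Omega' (plap_weight p u v)) :
  let mu := weighted_measure (plap_weight p u v) Omega' in
  (exists chi : R, 1 < chi /\
    forall (delta : R) (x : 'rV[R]_N) (s : R),
      0 < delta -> closure (eball x (6 * delta)) `<=` Omega' ->
      0 < s -> s < chi ->
      exists C : R, 0 < C /\
        (((\int[mu]_(y in eball x (2 * delta)) ((v y - u y) `^ s)%:E) `^ s^-1)
          <= (C * inf [set v y - u y | y in eball x delta])%:E)%E) /\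
  (forall Omega0 : set 'rV[R]_N, domain Omega0 -> Omega0 `<=` Omega' ->
    (forall x, Omega0 x -> u x = v x) \/ (forall x, Omega0 x -> u x < v x)).
Proof.
case: N hN Omega hOmega u v hu hv huv hweak Omega' hOmega' hM => [|[|m]] // _.
move=> Omega [_ oO _] u v hu hv huv hweak Omega' [[_ oO' cO'] closO' closO].
move=> hM mu.
have subO : Omega' `<=` Omega by apply: subset_trans closO; exact: subset_closure.
split.
  exists 2; split=> [|delta x s delta0 ballO s0 _]; first by rewrite ltr1n.
  exact: (harnack oO oO' subO hp hkappa hu hv huv hweak hM cO' closO').
move=> Omega0 [_ _ c0] sub0.
have [[x0 x00 e0]|none] := pselect (exists2 x, Omega0 x & v x - u x = 0).
  left=> x /(diff_vanishing oO oO' subO hp hkappa hu hv huv hweak hM c0 sub0 x00 e0).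
  by move=> /eqP; rewrite subr_eq0 => /eqP.
right=> x xO; rewrite lt_neqAle huv ?andbT; last exact/subO/sub0.
by apply/eqP => e; apply: none; exists x => //; rewrite e subrr.
Qed.
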